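(* Let $\theta>0$, let $\mathcal{L}$ be a probability distribution on $\mathbb{C}^*$, and let $(M_N)_{N\ge1}$ be a sequence of random matrices such that for each $N$, $M_N$ follows the distribution $\mathbb{P}(N,\theta,\mathcal{L})$. Suppose that if $Z$ is a random variable with distribution $\mathcal{L}$, then $\log|Z|$ is in $\mathcal{U}^q$ for some $q>0$. Let $R:=\exp(\mathbb{E}[\log|Z|])$. Then for every bounded, continuous function $f:\mathbb{C}\to\mathbb{R}$ such that $f=0$ on a neighborhood of the circle $\{|z|=R\}$, $f$ is almost surely integrable with respect to the random measure $\mu_\infty$, and $$\int_{\mathbb{C}} f\,d\mu(M_N)\ \underset{N\to\infty}{\longrightarrow}\ \int_{\mathbb{C}} f\,d\mu_\infty$$ in distribution.
   Context: $\Sigma_N$ is the group of permutations of $\{1,\dots,N\}$. For $\sigma\in\Sigma_N$ and $z_1,\dots,z_N\in\mathbb{C}^*$, $M(\sigma,z_1,\dots,z_N)$ is the $N\times N$ matrix $M$ with entries $M_{jk}=z_j\mathbf{1}_{j=\sigma(k)}$. $\mathbb{P}(N,\theta,\mathcal{L})$ is the law of $M(\sigma,z_1,\dots,z_N)$ where $\sigma$ follows the Ewens measure of parameter $\theta$ on $\Sigma_N$ (each permutation has probability proportional to $\theta^n$, $n$ its number of cycles), $z_1,\dots,z_N$ have law $\mathcal{L}$, and $\sigma,z_1,\dots,z_N$ are independent. $\mu(M)=\sum_\lambda m_M(\lambda)\delta_\lambda$ is the sum over the eigenvalues $\lambda$ of $M$ with multiplicity $m_M(\lambda)$. The random measure $\mu_\infty$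 is $$\mu_\infty=\sum_{k=1}^\infty\sum_{p=1}^{a_k}\sum_{\omega^k=T_{k,p}}\delta_\omega,$$ where all the variables $(a_k)_{k\ge1}$, $(T_{k,p})_{k,p\ge1}$ are independent, $a_k$ is a Poisson variable with $\mathbb{E}[a_k]=\theta/k$, and $T_{k,p}$ is distributed as the product of $k$ independent random variables of law $\mathcal{L}$. For $q>0$, a real integrable random variable $X$ is said to be in $\mathcal{U}^q$ if, for $(X_k)_{k\ge1}$ i.i.d. with the distribution of $X$ and for all $\epsilon>0$, there exists $C>0$ such that for all $n\ge1$, $\mathbb{P}\left[\left|\left(\frac1n\sum_{k=1}^nX_k\right)-\mathbb{E}[X]\right|\ge\epsilon\right]\le C/n^q$. *)

(* Defs.v *)
From HB Require Import structures.
From mathcomp Require Import all_boot all_order all_algebra all_fingroup.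
From mathcomp Require Import finmap.
From mathcomp Require Import all_classical all_reals all_analysis.
From mathcomp Require Export complex.

Set Implicit Arguments.
Unset Strict Implicit.
Unset Printing Implicit Defensive.

Import Order.TTheory GRing.Theory Num.Theory.
Import numFieldNormedType.Exports.

Local Open Scope classical_set_scope.
Local Open Scope ring_scope.

(* The topology of [R[i]] is the one of its norm, and its sigma-algebra is the
   Borel one. *)
HB.instance Definition _ (R : realType) :=
  PseudoPointedMetric.copy R[i] (R[i])^o.

Section complex_borel.
Variable R : realType.
Let G : set (set R[i]) := @open R[i].
Let sigmaC (A : set R[i]) : <<s G >> A -> <<s G >> (~` A).
Proof. by move=> ?; rewrite -setTD; exact: sigma_algebraCD. Qed.

HB.instance Definition _ := @isMeasurable.Build (sigma_display G)
  R[i] <<s G >> (@sigma_algebra0 _ setT G) sigmaC (@sigma_algebra_bigcup _ setT G).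
End complex_borel.

(* Matrices carry the sigma-algebra generated by their entries. *)
Definition mx_cylinders d (T : measurableType d) m n : set (set 'M[T]_(m, n)) :=
  \bigcup_(ij : 'I_m * 'I_n)
    preimage_set_system setT (fun A : 'M[T]_(m, n) => A ij.1 ij.2) measurable.

Section mx_measurable.
Variables (d : measure_display) (T : measurableType d) (m n : nat).
Let G := @mx_cylinders d T m n.
Let sigmaC (A : set 'M[T]_(m, n)) : <<s G >> A -> <<s G >> (~` A).
Proof. by move=> ?; rewrite -setTD; exact: sigma_algebraCD. Qed.

HB.instance Definition _ := @isMeasurable.Build (sigma_display G)
  'M[T]_(m, n) <<s G >> (@sigma_algebra0 _ setT G) sigmaC
  (@sigma_algebra_bigcup _ setT G).
End mx_measurable.

HB.instance Definition _ (T : finType) := isPointed.Build (perm_type T) 1%g.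

Section perm_measurable.
Variable T : finType.
Let perm0 : @discrete_measurable {perm T} set0. Proof. by []. Qed.
Let permC A : @discrete_measurable {perm T} A -> discrete_measurable (~` A).
Proof. by []. Qed.
Let permU (F : (set {perm T})^nat) :
  (forall i, discrete_measurable (F i)) -> discrete_measurable (\bigcup_i F i).
Proof. by []. Qed.

HB.instance Definition _ := @isMeasurable.Build default_measure_display
  (perm_type T) discrete_measurable perm0 permC permU.
End perm_measurable.

(* [sum_dirac S m] is the measure \sum_(x in S) m x * \d_x. *)
Definition sum_dirac (R : realType) d (T : measurableType d)
    (S : set T) (m : T -> nat) (A : set T) : \bar R :=
  \esum_(x in A `&` S) ((m x)%:R : R)%:E.

Section sum_dirac_measure.
Context (R : realType) d (T : measurableType d) (S : set T) (m : T -> nat).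
Local Open Scope ereal_scope.
Local Notation mu := (@sum_dirac R d T S m).

Let mu0 : mu set0 = 0.
Proof. by rewrite /sum_dirac set0I esum_set0. Qed.

Let mu_ge0 A : 0 <= mu A.
Proof. by apply: esum_ge0 => x _; rewrite lee_fin. Qed.

Let mu_sigma_additive : semi_sigma_additive mu.
Proof.
move=> F mF tF mUF.
have -> : mu (\bigcup_n F n) = \sum_(0 <= i <oo) mu (F i).
  rewrite /sum_dirac setI_bigcupl nneseries_sum_bigcup//.
  exact: trivIset_setIr.
by apply: is_cvg_ereal_nneg_natsum_cond => n _ _; exact: mu_ge0.
Qed.

HB.instance Definition _ := isMeasure.Build _ _ _ mu mu0 mu_ge0 mu_sigma_additive.
End sum_dirac_measure.

(* Joint independence of the family (F i)_(i in D) of sets of events.  It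
   becomes independence of random variables X i, possibly with values in
   different spaces, when F i is [events (X i)]. *)
Definition mutual_independence (R : realType) d (O : measurableType d)
    (P : probability O R) (I : choiceType) (D : set I)
    (F : I -> set (set O)) : Prop :=
  forall (J : {fset I}) (A : I -> set O),
    (forall i, i \in J -> D i /\ F i (A i)) ->
    P (\bigcap_(i in [set` J]) A i) = (\prod_(i <- J) P (A i))%E.

Definition events d (O : measurableType d) d' (T : measurableType d')
    (X : O -> T) : set (set O) :=
  preimage_set_system setT X measurable.

Definition has_law (R : realType) d (O : measurableType d)
    (P : probability O R) d' (T : measurableType d') (X : O -> T)
    (mu : set T -> \bar R) : Prop :=
  forall A, measurable A -> P (X @^-1` A) = mu A.

(* The law of X under P, for X that is not bundled with its measurability. *)
Definition law (R : realType) d (O : measurableType d) (P : probability O R)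
    d' (T : measurableType d') (X : O -> T) : set T -> \bar R :=
  fun A => P (X @^-1` A).

(* The underlying spaces are allowed to depend on n. *)
Definition cvg_in_distribution (R : realType) (d : nat -> measure_display)
    (O : forall n, measurableType (d n)) (P : forall n, probability (O n) R)
    (X : forall n, O n -> R) d' (O' : measurableType d')
    (P' : probability O' R) (Y : O' -> R) : Prop :=
  [/\ forall n, measurable_fun setT (X n),
      measurable_fun setT Y &
      forall g : R -> R, continuous g -> bounded_fun g ->
        (fun n => 'E_(P n)[g \o X n])%E @ \oo --> ('E_P'[g \o Y])%E].

Definition in_Uq (R : realType) (q : R) d (O : measurableType d)
    (P : probability O R) (X : O -> R) : Prop :=
  P.-integrable setT (EFin \o X) /\
  forall d' (O' : measurableType d') (P' : probability O' R)
         (Xs : nat -> {RV P' >-> R}),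
    mutual_independence P' setT (fun k => events (Xs k)) ->
    (forall k, has_law P' (Xs k) (law P X)) ->
    forall eps : R, 0 < eps ->
    exists2 C : R, 0 < C & forall n, (1 <= n)%N ->
      (P' [set w | (eps <= `| (n%:R^-1 * \sum_(k < n) Xs k w)
                              - fine 'E_P[X] |)%R]
       <= (C / n%:R `^ q)%:E)%E.

Definition ewens_pmf (R : realType) (theta : R) N (s : 'S_N) : R :=
  theta ^+ #|porbits s| / \sum_(t : 'S_N) theta ^+ #|porbits t|.

Definition mx_of_perm (R : realType) N (s : 'S_N) (z : 'I_N -> R[i]) :
    'M[R[i]]_N :=
  \matrix_(j, k) (z j *+ (j == s k)).

(* M follows P(N, theta, L).  The index None stands for s, and Some j for z j. *)
Definition ewens_mx_law (R : realType) (theta : R) (L : probability R[i] R) N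
    d (O : measurableType d) (P : probability O R)
    (M : {RV P >-> 'M[R[i]]_N}) : Prop :=
  exists d' (O' : measurableType d') (P' : probability O' R)
         (s : {RV P' >-> 'S_N}) (z : 'I_N -> {RV P' >-> R[i]}),
  [/\ forall t : 'S_N, P' (s @^-1` [set t]) = (ewens_pmf theta t)%:E,
      forall j, has_law P' (z j) L,
      mutual_independence P' setT
        (fun i : option 'I_N => if i is Some j then events (z j) else events s)
    & has_law P M (law P' (fun w => mx_of_perm (s w) (fun j => z j w)))].

Definition eigenvalue_measure (R : realType) N (M : 'M[R[i]]_N) :
    {measure set R[i] -> \bar R} :=
  sum_dirac R [set l | eigenvalue M l] (fun l => mup l (char_poly M)).

Definition kth_roots_measure (R : realType) (k : nat) (t : R[i]) :
    {measure set R[i] -> \bar R} :=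
  sum_dirac R [set w : R[i] | w ^+ k = t] (fun=> 1%N).

(* The indices k and p of T k p start at 1. *)
Definition mu_infty (R : realType) (a : nat -> nat) (T : nat -> nat -> R[i]) :
    {measure set R[i] -> \bar R} :=
  mseries (fun k => msum (fun p => kth_roots_measure k (T k p.+1)) (a k)) 1.

Definition law_of_product (R : realType) (L : probability R[i] R) (k : nat)
    d (O : measurableType d) (P : probability O R) (T : O -> R[i]) : Prop :=
  exists d' (O' : measurableType d') (P' : probability O' R)
         (Y : 'I_k -> {RV P' >-> R[i]}),
  [/\ mutual_independence P' setT (fun i => events (Y i)),
      forall i, has_law P' (Y i) L
    & has_law P T (law P' (fun w => \prod_(i < k) Y i w))].

(* The index inl k stands for a k and inr (k, p) for T k p, with k, p >= 1. *)
Definition poisson_roots_data (R : realType) (theta : R)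
    (L : probability R[i] R) d (O : measurableType d) (P : probability O R)
    (a : nat -> {RV P >-> nat}) (T : nat -> nat -> {RV P >-> R[i]}) : Prop :=
  [/\ mutual_independence P
        [set i : nat + nat * nat | match i with
           | inl k => (1 <= k)%N
           | inr (k, p) => (1 <= k)%N && (1 <= p)%N
           end]
        (fun i => match i with
           | inl k => events (a k)
           | inr (k, p) => events (T k p)
           end),
      forall k n, (1 <= k)%N ->
        P (a k @^-1` [set n]) = (poisson_pmf (theta / k%:R) n)%:E
    & forall k p, (1 <= k)%N -> (1 <= p)%N -> law_of_product L k P (T k p)].

(* Main.v *)
Require Import Defs.
From HB Require Import structures.
From mathcomp Require Import all_boot all_order all_algebra all_fingroup all_field.
From mathcomp Require Import finmap.
From mathcomp Require Import all_classical all_reals all_analysis.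
From mathcomp Require Import measurable_realfun complex ring lra zify.

Set Implicit Arguments.
Unset Strict Implicit.
Unset Printing Implicit Defensive.

Import Order.TTheory GRing.Theory Num.Theory.
Import numFieldNormedType.Exports.

(** A cycle of length k of the permutation contributes to the spectrum of M_N
    the k-th roots of the product of the k entries met along it
    ([char_poly_mx_of_perm]).  Given the permutation, these products are
    independent, and distributed as the variables T k p from which mu_infty is
    built.  So the mean of a test function of the linear statistic of f is an
    average over the Ewens measure of a functional of the cycle counts alone,
    the products being replaced with the T k p ([mean_ewens_matrix]).  The
    measure mu_infty is obtained when the counts are replaced with independent
    Poisson variables of parameters theta / k.  Two facts make this replacement
    legitimate in the limit.

    Finitely many cycle counts are asymptotically independent Poisson variables.
    The reason is the identity [ewens_mean_count]: the mean of n_k H(n), over the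
    permutations of N points, is theta / k times a ratio that tends to 1, times
    the mean of H(n + e_k) over the permutations of N - k points.  In the limit
    this is the Mecke identity that characterizes the Poisson law.  It is proved
    by inserting the points one by one ([esum_perm_count]), and [cvg_truncated]
    draws the consequence for functionals of finitely many counts and of the T k p.

    Long cycles do not matter.  The k-th roots of T k p have modulus
    exp(log|T k p| / k), where log|T k p| / k is the mean of k independent
    copies of log|Z|; by the assumption on log|Z| they lie in the annulus around
    the circle of radius R where f vanishes ([vanishing_annulus]), except with
    probability at most C / k^q ([off_annulus_prob]).  The mean number of cycles
    of length k is of order 1 / k, apart from the cycles that contain more than
    half of the points, of which there are at most two.  As the series of
    k^(-1-q) converges, cutting the linear statistic at length K makes an error
    that is small for large K, uniformly in N ([ewens_mean_truncate]).  The
    same bound for mu_infty ([bad_after_small]) shows moreover, by the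
    Borel-Cantelli lemma, that almost surely only finitely many points of
    mu_infty lie where f does not vanish; hence the integrability of f. *)

(** * Inserting a point into a permutation *)

Local Open Scope ring_scope.

Section Insertion.
Import mathcomp.boot.finset.
Context (n : nat).
Implicit Types (t : 'S_n) (i : 'I_n.+1) (c : {set 'I_n}).

(** The new point is [ord0]. For [i = lift ord0 j] it is put between [j] and
    [t j] on the cycle of [j]; for [i = ord0] it is fixed. This is a step of
    the Chinese restaurant process. *)
Definition perm_insert t i : 'S_n.+1 :=
  (tperm ord0 i * lift_perm ord0 ord0 t)%g.

(** The cycle of [perm_insert t i] that extends the cycle [c] of [t]. *)
Definition set_insert i c : {set 'I_n.+1} :=
  [set v | if unlift ord0 v is Some y then y \in c else i \in [set lift ord0 x | x in c]].

Lemma perm_insert_id t i : perm_insert t i i = ord0.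
Proof. by rewrite permM tpermR lift_perm_id. Qed.

Lemma perm_insert_ord0 t j : perm_insert t (lift ord0 j) ord0 = lift ord0 (t j).
Proof. by rewrite permM tpermL lift_perm_lift. Qed.

Lemma perm_insert_lift t i x : lift ord0 x != i ->
  perm_insert t i (lift ord0 x) = lift ord0 (t x).
Proof.
by move=> xi; rewrite permM tpermD ?lift_perm_lift// 1?eq_sym // neq_lift.
Qed.

Lemma perm_insert_inj : injective (fun ti : 'S_n * 'I_n.+1 => perm_insert ti.1 ti.2).
Proof.
move=> [t i] [t' i'] /= E.
have ii : i = i'.
  by apply: (@perm_inj _ (perm_insert t i)); rewrite {2}E !perm_insert_id.
subst i'; congr (_, _); apply/permP => x; apply: (@lift_inj _ ord0).
by rewrite -!(lift_perm_lift ord0 ord0); move/mulgI: E => ->.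
Qed.

Lemma sum_perm_insert (V : nmodType) (F : 'S_n.+1 -> V) :
  \sum_s F s = \sum_(t : 'S_n) \sum_(i : 'I_n.+1) F (perm_insert t i).
Proof.
rewrite pair_big/= (reindex (fun ti : 'S_n * 'I_n.+1 => perm_insert ti.1 ti.2))//=.
apply: onW_bij; apply: inj_card_bij; first exact: perm_insert_inj.
by rewrite card_prod !card_Sn card_ord factS mulnC.
Qed.

Lemma set_insert_ord0 i c : (ord0 \in set_insert i c) = (i \in [set lift ord0 x | x in c]).
Proof. by rewrite inE unlift_none. Qed.

Lemma set_insert_lift i c x : (lift ord0 x \in set_insert i c) = (x \in c).
Proof. by rewrite inE liftK. Qed.

Lemma set_insert_inj i : injective (set_insert i).
Proof. by move=> c c' E; apply/setP => x; rewrite -!(set_insert_lift i) E. Qed.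

Lemma mem_lift_imset c j : (lift ord0 j \in [set lift ord0 x | x in c]) = (j \in c).
Proof. by rewrite mem_imset //; exact: lift_inj. Qed.

Lemma ord0_lift_imset c : ord0 \in [set lift ord0 x | x in c] = false.
Proof. by apply/negbTE/imsetP => -[x _] /eqP; rewrite (negbTE (neq_lift _ _)). Qed.

Lemma porbit_perm_step (T : finType) (s : {perm T}) x : s x \in porbit s x.
Proof. by have := mem_porbit s 1 x; rewrite expg1. Qed.

(** A step of [t] is one or two steps of the enlarged permutation. Conversely,
    collapsing the new point onto the old point that precedes it turns every
    step of the enlarged permutation into a step or a pause of [t]. *)
Lemma porbit_insert_lift t i x : porbit (perm_insert t i) (lift ord0 x) = set_insert i (porbit t x).
Proof.
set s := perm_insert t i.
have step y : lift ord0 (t y) \in porbit s (lift ord0 y).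
  have [yi|yi] := eqVneq (lift ord0 y) i; last by rewrite -(perm_insert_lift t yi) porbit_perm_step.
  have -> : lift ord0 (t y) = (s ^+ 2)%g (lift ord0 y).
    by rewrite expgS expg1 permM /s -yi perm_insert_id perm_insert_ord0.
  exact: mem_porbit.
have fwd y : y \in porbit t x -> lift ord0 y \in porbit s (lift ord0 x).
  case/porbitP => k ->; elim: k => [|k IH]; first by rewrite expg0 perm1 porbit_id.
  rewrite expgSr permM.
  move: IH; rewrite -eq_porbit_mem => /eqP <-; exact: step.
(* [p] collapses [ord0] onto [j], the old point that precedes it. *)
pose j := if unlift ord0 i is Some j then j else x.
pose p v := if unlift ord0 v is Some y then y else j.
have pstep v : p (s v) \in porbit t (p v).
  have pl y : p (lift ord0 y) = y by rewrite /p liftK.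
  have p0 : p ord0 = j by rewrite /p unlift_none.
  case: (unliftP ord0 v) => [y ->|->].
    rewrite pl; have [yi|yi] := eqVneq (lift ord0 y) i.
      by rewrite /s -yi perm_insert_id p0 /j -yi liftK porbit_id.
    by rewrite /s perm_insert_lift // pl porbit_perm_step.
  rewrite p0 {1}/j; case: (unliftP ord0 i) => [y E|E].
    by rewrite /s E perm_insert_ord0 pl porbit_perm_step.
  have -> : s ord0 = ord0 by rewrite /s E perm_insert_id.
  by rewrite p0 /j E unlift_none porbit_id.
have bwd v : v \in porbit s (lift ord0 x) -> p v \in porbit t x.
  case/porbitP => k ->; elim: k => [|k IH]; first by rewrite expg0 perm1 /p liftK porbit_id.
  by rewrite expgSr permM; move: IH; rewrite -eq_porbit_mem => /eqP <-; exact: pstep.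
have lft y : (lift ord0 y \in porbit s (lift ord0 x)) = (y \in porbit t x).
  apply/idP/idP => [/bwd|/fwd //]; by rewrite /p liftK.
apply/setP => v; rewrite inE; case: unliftP => [y ->|->]; first exact: lft.
have [j' E|E] := unliftP ord0 i.
  rewrite E mem_lift_imset -lft -!eq_porbit_mem.
  suff /eqP -> : porbit s (lift ord0 j') == porbit s ord0 by [].
  have := porbit_perm_step s (lift ord0 j').
  by rewrite {1}/s -E perm_insert_id -eq_porbit_mem eq_sym.
rewrite E ord0_lift_imset; apply/negP; rewrite porbit_sym => /porbitP [k].
have s0 : s ord0 = ord0 by rewrite /s E perm_insert_id.
have -> : (s ^+ k)%g ord0 = ord0.
  by elim: k => [|k IH]; rewrite ?expg0 ?perm1// expgS permM s0.
by move/eqP; rewrite eq_sym (negbTE (neq_lift _ _)).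
Qed.

Lemma porbit_insert_ord0 t : porbit (perm_insert t ord0) ord0 = [set ord0].
Proof.
apply/setP => v; rewrite inE; apply/idP/idP => [/porbitP[k ->]|/eqP ->]; last exact: porbit_id.
have s0 : perm_insert t ord0 ord0 = ord0 by rewrite perm_insert_id.
by elim: k => [|k IH]; rewrite ?expg0 ?perm1// expgS permM s0.
Qed.

Lemma porbits_insert t i : porbits (perm_insert t i) =
  [set set_insert i c | c in porbits t] :|: (if i == ord0 then [set [set ord0]] else set0).
Proof.
apply/setP => b; rewrite inE; apply/imsetP/orP.
  case=> v _ ->; case: (unliftP ord0 v) => [x ->|->].
    by left; rewrite porbit_insert_lift imset_f// imset_f.
  have [->|i0] := eqVneq i ord0.
    by right; rewrite porbit_insert_ord0 inE.
  left; case: (unliftP ord0 i) i0 => [x E _|->]; last by rewrite eqxx.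
  have -> : porbit (perm_insert t i) ord0 = porbit (perm_insert t i) (lift ord0 x).
    have := porbit_perm_step (perm_insert t i) i.
    by rewrite perm_insert_id -eq_porbit_mem E => /eqP.
  by rewrite porbit_insert_lift imset_f// imset_f.
case=> [/imsetP[c /imsetP[x _ ->] ->]|].
  by exists (lift ord0 x) => //; rewrite porbit_insert_lift.
by case: eqP => [->|]; rewrite inE // => /eqP ->; exists ord0; rewrite ?porbit_insert_ord0.
Qed.

Lemma big_porbits_insert (V : Type) (idx : V) (op : Monoid.com_law idx)
    (F : {set 'I_n.+1} -> V) t i :
  \big[op/idx]_(b in porbits (perm_insert t i)) F b =
  op (if i == ord0 then F [set ord0] else idx)
     (\big[op/idx]_(c in porbits t) F (set_insert i c)).
Proof.
rewrite porbits_insert; have inj : injective (set_insert i) by exact: set_insert_inj.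
case: eqP => [->|_]; last by rewrite setU0 big_imset ?Monoid.mul1m//=; move=> *; apply: inj.
rewrite setUC big_setU1/=; first by rewrite big_imset//= => c c' _ _; exact: set_insert_inj.
apply/negP => /imsetP[c _ E].
have : ord0 \in set_insert ord0 c by rewrite -E inE.
by rewrite set_insert_ord0 ord0_lift_imset.
Qed.

Lemma card_set_insert i c : #|set_insert i c| = (#|c| + (i \in [set lift ord0 x | x in c]))%N.
Proof.
have -> : set_insert i c = [set lift ord0 x | x in c] :|:
   (if i \in [set lift ord0 x | x in c] then [set ord0] else set0).
  apply/setP => v; rewrite inE in_setU; case: unliftP => [y ->|->].
    by rewrite mem_lift_imset; case: ifP; rewrite inE ?orbF// eq_sym (negbTE (neq_lift _ _)) orbF.
  by rewrite ord0_lift_imset /=; case: ifP; rewrite inE ?eqxx.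
rewrite cardsU card_imset; last exact: lift_inj.
case: ifP => _; rewrite ?cards0 ?cards1 ?setI0 ?cards0 ?subn0 //.
rewrite (_ : _ :&: _ = set0) ?cards0 ?subn0//.
apply/setP => v; rewrite !inE; case: eqP => [->|]; by rewrite ?andbF// ord0_lift_imset.
Qed.

End Insertion.

(** * The determinant attached to a weighted permutation *)

Section Det.
Import mathcomp.boot.finset.
Context (R : comNzRingType).

Definition weighted_perm_mx n (s : 'S_n) (w : 'I_n -> R) : 'M[R]_n :=
  \matrix_(j, k) (w j *+ (j == s k)).

Lemma det_schur1 n (A : 'M[R]_(1 + n)) : A 0 0 = 1 ->
  \det A = \det (drsubmx A - dlsubmx A *m ursubmx A).
Proof.
move=> A1; have ul : ulsubmx A = 1%:M.
  by apply/matrixP => i j; rewrite !ord1 !mxE eqxx -A1; congr (A _ _); apply/val_inj.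
have E : A = block_mx 1%:M 0 (dlsubmx A) 1%:M *m
    block_mx 1%:M (ursubmx A) 0 (drsubmx A - dlsubmx A *m ursubmx A).
  by rewrite mulmx_block !(mul1mx, mulmx1, mul0mx, mulmx0, addr0, add0r) addrC subrK -ul submxK.
by rewrite [X in \det X = _]E det_mulmx det_lblock det_ublock !det1 !mul1r.
Qed.

Lemma det_lsplit1 n (A : 'M[R]_(1 + n)) : ursubmx A = 0 ->
  \det A = A 0 0 * \det (drsubmx A).
Proof.
move=> A0; rewrite -[in LHS](submxK A) A0 det_lblock det_mx11 !mxE.
by congr (A _ _ * _); exact: val_inj.
Qed.

(** By induction on the size, removing the point [ord0]. If it is fixed, the
    matrix is block triangular. Otherwise the corner entry is 1, and the Schur
    complement is the matrix of the permutation that bypasses [ord0], in which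
    the weight of [ord0] has been multiplied into that of its successor on the
    cycle. *)
Lemma det_sub_weighted_perm n (s : 'S_n) (w : 'I_n -> R) :
  \det (1%:M - weighted_perm_mx s w) =
  \prod_(c in porbits s) (1 - \prod_(j in c) w j).
Proof.
elim: n s w => [|n IH] s w.
  rewrite det_mx00 big1 // => c /imsetP[] []//.
have [[t i] -> {s}] : exists ti, s = perm_insert ti.1 ti.2.
  have [|g gK Kg] := @inj_card_bij _ _ _ (@perm_insert_inj n).
    by rewrite card_prod !card_Sn card_ord factS mulnC.
  by exists (g s); rewrite Kg.
rewrite /= big_porbits_insert /=.
(* The weights after [ord0] is bypassed: its weight passes to its successor. *)
pose w' x := w (lift ord0 x) * (if i == lift ord0 ((t^-1)%g x) then w ord0 else 1).
have prodE c : c \in porbits t ->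
    \prod_(j in set_insert i c) w j = \prod_(x in c) w' x.
  move=> cP; rewrite big_mkcond big_ord_recl/= set_insert_ord0 big_split /= mulrC.
  congr (_ * _); first by rewrite [RHS]big_mkcond; apply: eq_bigr => x _; rewrite set_insert_lift.
  case: (unliftP ord0 i) => [j ->|->]; last first.
    by rewrite ord0_lift_imset big1// => x _; rewrite (negbTE (neq_lift _ _)).
  rewrite mem_lift_imset.
  have jc : (j \in c) = (t j \in c).
    case/imsetP: cP => x _ ->; rewrite -!eq_porbit_mem.
    suff /eqP -> : porbit t (t j) == porbit t j by [].
    by rewrite eq_porbit_mem porbit_perm_step.
  case: ifPn => [jinc|jnc].
    rewrite (bigD1 (t j)) -?jc //= permK eqxx big1 ?mulr1// => x /andP[_ xj].
    case: eqP => // /lift_inj E; case/eqP: xj; by rewrite E permKV.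
  rewrite big1// => x xc; case: eqP => // /lift_inj E.
  by move: jnc; rewrite jc E permKV xc.
under [X in _ * X]eq_bigr => c cP do rewrite (prodE _ cP).
rewrite -IH; case: (unliftP ord0 i) => [j E|E]; last first.
  rewrite E eqxx big_set1.
  rewrite (@det_lsplit1 n); last first.
    apply/matrixP => a b; rewrite ord1 !mxE lshift0 rshift1.
    rewrite perm_insert_lift ?[_ == ord0]eq_sym ?neq_lift//.
    by rewrite !(negbTE (neq_lift _ _)) subr0.
  apply: (f_equal2 *%R); first by rewrite !mxE perm_insert_id !eqxx.
  congr (\det _).
  apply/matrixP => a b; rewrite !mxE.
  rewrite !rshift1.
  rewrite perm_insert_lift ?[_ == ord0]eq_sym ?neq_lift// !(inj_eq lift_inj).
  by rewrite /w' E (negbTE (neq_lift _ _)) mulr1.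
have -> : (i == ord0) = false by rewrite E eq_sym (negbTE (neq_lift _ _)).
rewrite mul1r (@det_schur1 n); last first.
  by rewrite !mxE eqxx E perm_insert_ord0 (negbTE (neq_lift _ _)) subr0.
congr (\det _); apply/matrixP => a b; rewrite !mxE big_ord1 !mxE.
rewrite !rshift1 !lshift0.
rewrite !(inj_eq lift_inj) (negbTE (neq_lift _ _)).
rewrite [lift ord0 a == ord0]eq_sym (negbTE (neq_lift _ _)).
rewrite E perm_insert_ord0 (inj_eq lift_inj) !sub0r.
have zE : (0 : 'I_n.+1) = ord0 by [].
rewrite !zE; have [bj|bj] := eqVneq b j.
  rewrite -bj perm_insert_id mulr1n [lift ord0 a == ord0]eq_sym.
  have [->|_] := eqVneq a (t b); last by rewrite !mulr0n oppr0 mul0r ?addr0 ?subr0.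
  by rewrite (negbTE (neq_lift _ _)) !mulr1n /w' E permK -bj eqxx mulr0n subr0 mulrNN.
rewrite perm_insert_lift; last by rewrite (inj_eq lift_inj).
rewrite (inj_eq lift_inj) (negbTE (neq_lift _ _)) mulr0n oppr0 mulr0 subr0.
have [->|_] := eqVneq a (t b); last by rewrite !mulr0n.
by rewrite /w' E permK (inj_eq lift_inj) [j == b]eq_sym (negbTE bj) mulr1.
Qed.
End Det.

(** * Cycle counts and a Mecke identity *)

Definition cycle_count n (s : 'S_n) (k : nat) : nat :=
  (\sum_(c in porbits s) (#|c| == k))%N.

Definition incr (k : nat) (m : nat -> nat) : nat -> nat := fun x => (m x + (x == k))%N.

(** The change of the cycle counts when a cycle of length [k] gets one more
    point. *)
Definition grow (k : nat) (m : nat -> nat) : nat -> nat :=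
  fun x => (m x + (x == k.+1) - (x == k))%N.

Lemma grow_incr k m : grow k (incr k m) = incr k.+1 m.
Proof. by apply: funext => x; rewrite /grow /incr; lia. Qed.

Lemma grow_incrC j k m : (0 < m j)%N -> grow j (incr k m) = incr k (grow j m).
Proof.
move=> mj; apply: funext => x; rewrite /grow /incr.
by case: (eqVneq x j) => [->|_]; lia.
Qed.

Section Cycles.
Import mathcomp.boot.finset.
Context (n : nat).
Implicit Types (t : 'S_n) (j : 'I_n).

Lemma mem_porbits_eq t c j : c \in porbits t -> (j \in c) = (c == porbit t j).
Proof. by case/imsetP => x _ ->; rewrite eq_sym eq_porbit_mem. Qed.

Lemma cycle_count_insert0 t : cycle_count (perm_insert t ord0) = incr 1 (cycle_count t).
Proof.
apply: funext => k; rewrite /cycle_count big_porbits_insert /= /incr cards1 addnC.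
congr (_ + _)%N; last by rewrite eq_sym.
by apply: eq_bigr => c _; rewrite card_set_insert ord0_lift_imset addn0.
Qed.

(** Only the cycle of [j] is lengthened. *)
Lemma cycle_count_insert t j :
  cycle_count (perm_insert t (lift ord0 j)) = grow #|porbit t j| (cycle_count t).
Proof.
have P : porbit t j \in porbits t by rewrite imset_f.
apply: funext => k; rewrite /cycle_count big_porbits_insert /grow.
rewrite [lift _ _ == _]eq_sym (negbTE (neq_lift _ _)) /=.
rewrite (bigD1 _ P) /= [in RHS](bigD1 _ P) /=.
rewrite card_set_insert mem_lift_imset porbit_id addn1.
rewrite (eq_bigr (fun c : {set _} => nat_of_bool (#|c| == k))).
  rewrite [k == _.+1]eq_sym [k == #|pred_of_set _|]eq_sym.
  move: (\sum_(_ | _) _)%N => S.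
 by case: (_.+1 == k); case: (_ == k) => /=; lia.
move=> c /andP[cP cj].
by rewrite card_set_insert mem_lift_imset (mem_porbits_eq _ cP) (negbTE cj) addn0.
Qed.

Lemma card_porbits_insert t i :
  #|porbits (perm_insert t i)| = ((i == ord0) + #|porbits t|)%N.
Proof.
by rewrite -!sum1_card big_porbits_insert /=; case: (i == ord0).
Qed.

Lemma sum_cycles_card (V : pzSemiRingType) t (F : nat -> V) B : (n < B)%N ->
  \sum_(c in porbits t) F #|c| = \sum_(k < B) (cycle_count t k)%:R * F k.
Proof.
move=> nB; rewrite /cycle_count.
under [RHS]eq_bigr => k _ do rewrite natr_sum mulr_suml.
rewrite exchange_big/=; apply: eq_bigr => c _.
have cB : (#|c| < B)%N by rewrite (leq_ltn_trans _ nB) // -[X in (_ <= X)%N]card_ord max_card.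
rewrite (bigD1 (Ordinal cB))//= eqxx mul1r big1 ?addr0// => k kc.
by case: eqP => [E|]; rewrite ?mul0r//; case/eqP: kc; apply: val_inj; rewrite /= E.
Qed.

(** There are [k * cycle_count t k] points on the cycles of length [k]. *)
Lemma sum_porbit_card (V : pzSemiRingType) t (F : nat -> V) B : (n < B)%N ->
  \sum_j F #|porbit t j| = \sum_(k < B) (k * cycle_count t k)%:R * F k.
Proof.
move=> nB; rewrite (partition_big (porbit t) (mem (porbits t)))/=; last by move=> j _; rewrite imset_f.
rewrite (eq_bigr (fun c : {set 'I_n} => #|c|%:R * F #|c|)); last first.
  move=> c cP; rewrite (eq_bigl (mem c)); last by move=> j; rewrite /= (mem_porbits_eq _ cP) eq_sym.
  rewrite (eq_bigr (fun=> F #|c|)); first by rewrite sumr_const mulr_natl.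
  by move=> j /=; rewrite (mem_porbits_eq _ cP) => /eqP <-.
rewrite (@sum_cycles_card _ t (fun k => k%:R * F k) B)//; apply: eq_bigr => k _.
by rewrite mulrA natrM commr_nat.
Qed.

End Cycles.

Section Ewens.
Import mathcomp.boot.finset.
Context (R : realFieldType) (theta : R).
Implicit Types (H : (nat -> nat) -> R).

Definition esum_perm n H : R := \sum_(s : 'S_n) theta ^+ #|porbits s| * H (cycle_count s).

(** The weighted sum of [H] over the cycle counts that one insertion can
    produce. The bound [B] makes the sum finite; it exceeds the number of
    points wherever the sum is used. *)
Definition ewens_gen B H m : R :=
  theta * H (incr 1 m) + \sum_(j < B) (j * m j)%:R * H (grow j m).

(** Opening a new cycle multiplies the weight by [theta], and a cycle of
    length [j] can be lengthened at [j] places. *)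
Lemma esum_permS n H B : (n < B)%N -> esum_perm n.+1 H = esum_perm n (ewens_gen B H).
Proof.
move=> nB; rewrite /esum_perm sum_perm_insert; apply: eq_bigr => t _.
rewrite big_ord_recl cycle_count_insert0 card_porbits_insert eqxx exprS /ewens_gen mulrDr.
congr (_ + _); first by rewrite mulrCA mulrA.
rewrite -(@sum_porbit_card n R t (fun k => H (grow k (cycle_count t)))) // mulr_sumr.
apply: eq_bigr => j _; rewrite cycle_count_insert card_porbits_insert.
by rewrite eq_sym (negbTE (neq_lift _ _)).
Qed.

Lemma esum_permD n H H' : esum_perm n (fun m => H m + H' m) = esum_perm n H + esum_perm n H'.
Proof. by rewrite /esum_perm -big_split; apply: eq_bigr => s _; rewrite mulrDr. Qed.

Lemma esum_permZ n a H : esum_perm n (fun m => a * H m) = a * esum_perm n H.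
Proof. by rewrite /esum_perm mulr_sumr; apply: eq_bigr => s _; rewrite mulrCA. Qed.

(** The defect of commutation between an insertion and the multiplication by a
    cycle count: it comes from the insertions that create or destroy a cycle
    of length [k.+1]. *)
Lemma ewens_gen_count B k H m : (k.+1 < B)%N ->
  ewens_gen B (fun m => (m k.+1)%:R * H m) m =
  (m k.+1)%:R * ewens_gen B H m + (k == 0)%:R * theta * H (incr 1 m)
  + (k * m k)%:R * H (grow k m) - (k.+1 * m k.+1)%:R * H (grow k.+1 m).
Proof.
move=> kB; rewrite /ewens_gen.
have -> : \sum_(j < B) (j * m j)%:R * ((grow j m k.+1)%:R * H (grow j m)) =
  (m k.+1)%:R * (\sum_(j < B) (j * m j)%:R * H (grow j m))
  + (k * m k)%:R * H (grow k m) - (k.+1 * m k.+1)%:R * H (grow k.+1 m).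
  rewrite mulr_sumr.
  have delta i (F : nat -> R) : (i < B)%N -> F i = \sum_(j < B) (i == j)%:R * F j.
    move=> iB; rewrite (bigD1 (Ordinal iB))//= eqxx mul1r big1 ?addr0// => j ji.
    by case: eqP => [E|]; rewrite ?mul0r//; case/eqP: ji; apply: val_inj; rewrite /= E.
  rewrite (delta k (fun k => (k * m k)%:R * H (grow k m))) ?(ltnW kB)//.
  rewrite (delta k.+1 (fun k => (k * m k)%:R * H (grow k m)))// -sumrN -!big_split/=.
  apply: eq_bigr => j _; rewrite /grow eqSS.
  case: (posnP (m j)) => [mj0|mj]; first by rewrite mj0 muln0; have [E|_] := eqVneq k j; have [E'|_] := eqVneq k.+1 j; rewrite ?E ?E' ?mj0 ?muln0 ?mul0r; ring.
  have -> : (m k.+1 + (k == j) - (k.+1 == j))%:R = (m k.+1)%:R + (k == j)%:R - (k.+1 == j)%:R :> R.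
    by rewrite natrB ?natrD//; case: (eqVneq k.+1 j) => [E|_] //=; rewrite E; lia.
  ring.
rewrite /incr eqSS natrD; ring.
Qed.

Lemma ewens_gen_incr B k H m : (k < B)%N ->
  ewens_gen B H (incr k m) = ewens_gen B (H \o incr k) m + k%:R * H (incr k.+1 m).
Proof.
move=> kB; rewrite /ewens_gen -addrA; congr (_ + _).
  by congr (_ * H _); apply: funext => x; rewrite /incr addnAC.
rewrite (bigD1 (Ordinal kB))//= [in RHS](bigD1 (Ordinal kB))//=.
rewrite grow_incr {1}/incr eqxx.
rewrite (eq_bigr (fun j : 'I_B => (j * m j)%:R * H (incr k (grow j m)))); last first.
  move=> j jk; rewrite {1}/incr.
  have -> : (j == k :> nat) = false by apply/negbTE; apply: contraNneq jk => E; apply/eqP/val_inj.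
  rewrite addn0; case: (posnP (m j)) => [->|mj]; first by rewrite muln0 !mul0r.
  by rewrite grow_incrC.
rewrite mulnDr natrD mulrDl muln1.
case: (posnP (m k)) => [->|mk]; first by rewrite muln0 !mul0r; ring.
by rewrite -grow_incrC // grow_incr; ring.
Qed.

(** The Ewens counterpart of the Mecke identity E[a H(a)] = x E[H(a + 1)],
    which characterizes the Poisson law of parameter x. Bijectively, marking a
    cycle of length [k.+1] and deleting it leaves a permutation of the other
    points; the proof by induction on the number of points, inserting them one
    by one, avoids handling permutations of arbitrary subsets. *)
Lemma esum_perm_count n k H :
  k.+1%:R * esum_perm n (fun m => (m k.+1)%:R * H m) =
  theta * (n ^_ k.+1)%:R * esum_perm (n - k.+1) (H \o incr k.+1).
Proof.
elim: n k H => [|n IH] k H.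
  rewrite ffact0n /= mulr0 mul0r /esum_perm big1 ?mulr0// => s _.
  rewrite /cycle_count big1 ?mul0r ?mulr0// => c /imsetP[] []//.
pose B := (n + k).+2.
have nB : (n < B)%N by rewrite /B; lia.
have kB : (k.+1 < B)%N by rewrite /B; lia.
rewrite (esum_permS _ nB).
rewrite (_ : ewens_gen B _ = (fun m => ((m k.+1)%:R * ewens_gen B H m
   + (k == 0)%:R * theta * (H \o incr 1) m)
   + (k%:R * ((m k)%:R * (H \o grow k) m) + - k.+1%:R * ((m k.+1)%:R * (H \o grow k.+1) m)))); last first.
  by apply: funext => m; rewrite ewens_gen_count//= !natrM; ring.
rewrite !esum_permD !esum_permZ !mulrDr.
rewrite (IH k (ewens_gen B H)) [X in _ + (_ + X)]mulrCA (IH k (H \o grow k.+1)).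
have -> : (ewens_gen B H \o incr k.+1) =
   (fun m => ewens_gen B (H \o incr k.+1) m + k.+1%:R * (H \o incr k.+2) m).
  by apply: funext => m; rewrite /= ewens_gen_incr.
have -> : ((H \o grow k.+1) \o incr k.+1) = (H \o incr k.+2).
  by apply: funext => m; rewrite /= grow_incr.
rewrite esum_permD esum_permZ -esum_permS; last by rewrite (leq_ltn_trans (leq_subr _ _)).
(* The insertions that complete a cycle of length [k.+1]; for [k = 0] these are
   the openings of a new cycle. *)
have E3 : k.+1%:R * ((k == 0)%:R * theta * esum_perm n (H \o incr 1)) +
   k.+1%:R * (k%:R * esum_perm n (fun m => (m k)%:R * (H \o grow k) m)) =
   k.+1%:R * theta * (n ^_ k)%:R * esum_perm (n - k) (H \o incr k.+1).
  case: k {B nB kB} => [|k]; first by rewrite ffactn0 subn0 !mul1r mul0r addr0 mulr1.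
  rewrite /= mul0r mul0r mulr0 add0r IH.
  have -> : ((H \o grow k.+1) \o incr k.+1) = (H \o incr k.+2).
    by apply: funext => m; rewrite /= grow_incr.
  by ring.
transitivity (theta * (n ^_ k.+1)%:R * esum_perm (n - k.+1).+1 (H \o incr k.+1) +
  k.+1%:R * theta * (n ^_ k)%:R * esum_perm (n - k) (H \o incr k.+1)).
  by rewrite -E3; ring.
have [kn|nk] := ltnP k n.
  have -> : (n - k.+1).+1 = (n - k)%N by lia.
  have -> : (n.+1 ^_ k.+1 = n ^_ k.+1 + k.+1 * n ^_ k)%N.
    by rewrite ffactSS ffactnSr [(k.+1 * _)%N]mulnC -mulnDr mulnC; congr (_ * _)%N; lia.
  by rewrite subSS natrD natrM; ring.
rewrite subSS ffact_small ?ltnS// mulr0 mul0r add0r ffactSS.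
have [->|kn] := eqVneq k n; first by rewrite natrM; ring.
by rewrite (@ffact_small n k) ?muln0 ?mulr0 ?mul0r//; lia.
Qed.

End Ewens.

(** * Averages over the Ewens measure *)

Local Open Scope classical_set_scope.
Local Open Scope ring_scope.

Section EwensMean.
Context (R : realType) (theta : R) (theta_gt0 : 0 < theta).
Implicit Types (H : (nat -> nat) -> R).

Definition total_weight n : R := esum_perm theta n (fun=> 1).

(** Up to the factor [theta / k], this is the mean number of cycles of length
    [k] in a permutation of [n] points. It would be 1 for independent Poisson
    counts. *)
Definition weight_ratio n k : R := (n ^_ k)%:R * total_weight (n - k) / total_weight n.

Definition ewens_mean n H : R := \sum_(s : 'S_n) ewens_pmf theta s * H (cycle_count s).

Lemma ewens_meanE n H : ewens_mean n H = esum_perm theta n H / total_weight n.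
Proof.
rewrite /ewens_mean /esum_perm mulr_suml; apply: eq_bigr => s _.
rewrite /ewens_pmf /total_weight /esum_perm mulrAC; congr (_ * _ / _).
by apply: eq_bigr => t _; rewrite mulr1.
Qed.

Lemma total_weightS n : total_weight n.+1 = (theta + n%:R) * total_weight n.
Proof.
rewrite /total_weight (esum_permS _ _ (ltnSn n)) /esum_perm mulr_sumr.
apply: eq_bigr => t _; rewrite mulr1 mulrC /ewens_gen mulr1.
rewrite -(@sum_porbit_card n R t (fun=> 1))// sumr_const card_ord; congr (_ * _).
Qed.

Lemma total_weight_gt0 n : 0 < total_weight n.
Proof.
elim: n => [|n IH]; last by rewrite total_weightS mulr_gt0 ?ltr_wpDr.
rewrite /total_weight /esum_perm (bigD1 1%g)//= ltr_pwDl ?mulr1 ?exprn_gt0//.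
by apply: sumr_ge0 => s _; rewrite mulr1 exprn_ge0// ltW.
Qed.

Let tw_neq0 n : total_weight n != 0. Proof. by rewrite gt_eqF// total_weight_gt0. Qed.

Lemma ewens_mean_count n k H : (0 < k)%N ->
  ewens_mean n (fun m => (m k)%:R * H m) =
  theta / k%:R * weight_ratio n k * ewens_mean (n - k) (H \o incr k).
Proof.
case: k => // k _; rewrite !ewens_meanE /weight_ratio.
have := esum_perm_count theta n k H.
have k0 : k.+1%:R != 0 :> R by rewrite pnatr_eq0.
move/(canRL (mulKf k0)) ->; field.
by rewrite !tw_neq0 addrC natr1 pnatr_eq0.
Qed.

Lemma ewens_meanD n H H' : ewens_mean n (fun m => H m + H' m) = ewens_mean n H + ewens_mean n H'.
Proof. by rewrite !ewens_meanE esum_permD mulrDl. Qed.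

Lemma ewens_meanZ n a H : ewens_mean n (fun m => a * H m) = a * ewens_mean n H.
Proof. by rewrite !ewens_meanE esum_permZ mulrA. Qed.

Lemma ewens_mean_sum n I (r : seq I) (P : pred I) (F : I -> (nat -> nat) -> R) :
  ewens_mean n (fun m => \sum_(i <- r | P i) F i m) = \sum_(i <- r | P i) ewens_mean n (F i).
Proof.
rewrite exchange_big; apply: eq_bigr => s _; by rewrite mulr_sumr.
Qed.

Lemma ewens_pmf_ge0 n (s : 'S_n) : 0 <= ewens_pmf theta s.
Proof. by rewrite divr_ge0 ?sumr_ge0// => *; rewrite exprn_ge0// ltW. Qed.

Lemma ewens_mean_cst n a : ewens_mean n (fun=> a) = a.
Proof.
have -> : (fun=> a) = (fun m : nat -> nat => a * 1) by apply/funext => m; rewrite mulr1.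
by rewrite ewens_meanZ ewens_meanE -[esum_perm _ _ _]/(total_weight n) divff ?tw_neq0 ?mulr1.
Qed.

Lemma ewens_mean_le n H H' : (forall s : 'S_n, H (cycle_count s) <= H' (cycle_count s)) ->
  ewens_mean n H <= ewens_mean n H'.
Proof. by move=> HH; apply: ler_sum => s _; rewrite ler_wpM2l ?ewens_pmf_ge0. Qed.

Lemma ewens_mean_norm_le n H H' :
  (forall s : 'S_n, `|H (cycle_count s)| <= H' (cycle_count s)) ->
  `|ewens_mean n H| <= ewens_mean n H'.
Proof.
move=> HH; rewrite (le_trans (ler_norm_sum _ _ _))//; apply: ler_sum => s _.
by rewrite normrM ger0_norm ?ewens_pmf_ge0// ler_wpM2l ?ewens_pmf_ge0.
Qed.

Lemma ewens_mean_bound n H b : (forall m, `|H m| <= b) -> `|ewens_mean n H| <= b.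
Proof.
by move=> Hb; rewrite -[leRHS](ewens_mean_cst n); apply: ewens_mean_norm_le => s.
Qed.

Lemma weight_ratio0 n : weight_ratio n 0 = 1.
Proof. by rewrite /weight_ratio ffactn0 subn0 mul1r divff. Qed.

Lemma weight_ratio_small n k : (n < k)%N -> weight_ratio n k = 0.
Proof. by move=> nk; rewrite /weight_ratio ffact_small// !mul0r. Qed.

(** This recursion makes the ratios tractable: all bounds below come from it
    by telescoping. *)
Lemma weight_ratioS n k : (k < n)%N ->
  weight_ratio n k.+1 = weight_ratio n k * ((n - k)%:R / (theta + (n - k.+1)%:R)).
Proof.
move=> kn; rewrite /weight_ratio ffactnSr natrM (_ : n - k = (n - k.+1).+1)%N ?total_weightS; last lia.
field.
by rewrite tw_neq0/= gt_eqF// ltr_wpDr.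
Qed.

Lemma weight_ratio_ge0 n k : 0 <= weight_ratio n k.
Proof. by rewrite divr_ge0 ?mulr_ge0// ltW// total_weight_gt0. Qed.

Lemma weight_ratioD n k l : weight_ratio n (k + l) = weight_ratio n k * weight_ratio (n - k) l.
Proof.
rewrite /weight_ratio subnDA.
have [nk|kn] := ltnP n k.
  by rewrite [in RHS]ffact_small// ffact_small ?ltn_addr// !mul0r.
have -> : (n ^_ (k + l) = n ^_ k * (n - k) ^_ l)%N.
  elim: l => [|l IH]; first by rewrite addn0 ffactn0 muln1.
  by rewrite addnS !ffactnSr IH subnDA mulnA.
by rewrite natrM; field; rewrite !tw_neq0.
Qed.

Lemma weight_ratio_le_frac n k : (k <= n)%N -> weight_ratio n k * (n - k)%:R <= n%:R.
Proof.
elim: k => [|k IH] kn; first by rewrite weight_ratio0 subn0 mul1r.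
rewrite weight_ratioS// (le_trans _ (IH (ltnW kn)))// {IH}.
move: (weight_ratio n k) (weight_ratio_ge0 n k) => W W0.
rewrite -!mulrA ler_wpM2l// -[leRHS]mulr1 ler_wpM2l//.
rewrite mulrC ler_pdivrMr ?mul1r; first by rewrite lerDr ltW.
by rewrite ltr_wpDr.
Qed.

(** Cycles of length at most half the number of points are in the Poisson
    regime up to a factor 2. *)
Lemma weight_ratio_le2 n k : (0 < n)%N -> (2 * k <= n)%N -> weight_ratio n k <= 2.
Proof.
move=> n0 kn; have := @weight_ratio_le_frac n k.
have /[swap] /[apply] : (k <= n)%N by lia.
move=> h; have nk : (n%:R <= 2 * (n - k)%:R :> R) by rewrite -natrM ler_nat; lia.
have nk0 : 0 < (n - k)%:R :> R by rewrite ltr0n; lia.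
by rewrite -(ler_pM2r nk0) (le_trans h).
Qed.

(** For lengths close to [n] the ratio can be large; a bound that is linear in
    [k] and uniform in [n] suffices for dominated convergence. *)
Lemma weight_ratio_le n k : weight_ratio n k <= k.+1%:R * (1 + theta^-1).
Proof.
have t0 : 0 <= theta^-1 by rewrite invr_ge0 ltW.
have key j : (j < n)%N -> weight_ratio n j <= j.+1%:R.
  move=> jn; have h := weight_ratio_le_frac (ltnW jn).
  have nk0 : 0 < (n - j)%:R :> R by rewrite ltr0n; lia.
  rewrite -(ler_pM2r nk0) (le_trans h)// -natrM ler_nat; nia.
have [kn|nk] := ltnP k n.
  by rewrite (le_trans (key _ kn))// ler_peMr// lerDl.
have [nk'|kn] := ltnP n k.
  by rewrite weight_ratio_small // mulr_ge0// addr_ge0.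
have {nk kn} E : n = k by apply/eqP; rewrite eqn_leq nk kn.
subst n; case: k key => [_|k key]; first by rewrite weight_ratio0 mul1r lerDl.
rewrite weight_ratioS// subnn addr0 subSnn mul1r.
apply: ler_pM => //; first exact: weight_ratio_ge0.
  by rewrite (le_trans (key _ _))// ler_nat.
by rewrite lerDr.
Qed.

Lemma cvg_weight_ratio k : weight_ratio^~ k @ \oo --> (1 : R).
Proof.
elim: k => [|k IH].
  by under eq_fun do rewrite weight_ratio0; exact: cvg_cst.
have step : (fun n : nat => (n - k)%:R / (theta + (n - k.+1)%:R)) @ \oo --> (1 : R).
  rewrite -(cvg_shiftn k.+1).
  have E : (fun n : nat => (n + k.+1 - k)%:R / (theta + (n + k.+1 - k.+1)%:R)) =
           (fun n : nat => 1 + (1 - theta) * (theta + n%:R)^-1).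
    apply/funext => n; rewrite addnK addnS subSn ?leq_addl// addnK -natr1.
    have : theta + n%:R != 0 by rewrite gt_eqF// ltr_wpDr.
    by move=> ?; field.
  rewrite E -[1 in X in _ --> X](addr0 (1:R)); apply: cvgD; first exact: cvg_cst.
  rewrite -(mulr0 (1 - theta)); apply: cvgMl_tmp.
  apply/gtr0_cvgV0; first by near=> n; rewrite ltr_wpDr.
  apply/cvgryPge => A; near=> n; rewrite (@le_trans _ _ n%:R)//; last by rewrite lerDr ltW.
  by near: n; move/cvgryPge : (@cvgr_idn R); apply.
have := cvgM IH step; rewrite mulr1 => P; refine (cvg_trans _ (P _)).
apply: near_eq_cvg; near=> n; rewrite weight_ratioS//; by near: n; exact: nbhs_infty_gt.
Unshelve. all: by end_near.
Qed.

(** Factorial moments come from iterating the Mecke identity, as long as the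
    other factor [H] does not see the count of cycles of length [k]. *)
Lemma ewens_mean_choose n k j H : (0 < k)%N -> H \o incr k = H ->
  ewens_mean n (fun m => 'C(m k, j)%:R * H m) =
  (theta / k%:R) ^+ j / j`!%:R * weight_ratio n (k * j) * ewens_mean (n - k * j) H.
Proof.
move=> k0 Hk; elim: j n => [|j IH] n.
  rewrite muln0 weight_ratio0 subn0 expr0 fact0 !mulr1 divr1 mul1r.
  by congr ewens_mean; apply/funext => m; rewrite bin0 mul1r.
have j0 : j.+1%:R != 0 :> R by rewrite pnatr_eq0.
apply: (mulfI j0); rewrite -[LHS]ewens_meanZ.
have -> : (fun m : nat -> nat => j.+1%:R * ('C(m k, j.+1)%:R * H m)) =
    (fun m => (m k)%:R * ('C((m k).-1, j)%:R * H m)).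
  by apply/funext => m; rewrite !mulrA -!natrM mul_bin_diag.
rewrite (@ewens_mean_count n k (fun m => 'C((m k).-1, j)%:R * H m))//.
have -> : (fun m => 'C((m k).-1, j)%:R * H m) \o incr k = (fun m => 'C(m k, j)%:R * H m).
  apply/funext => m /=; rewrite [H _](_ : _ = H m); last by rewrite -[in RHS]Hk.
  by rewrite /incr eqxx addn1.
rewrite IH mulnS weight_ratioD subnDA exprS factS natrM.
have f0 : j`!%:R != 0 :> R by rewrite pnatr_eq0 -lt0n fact_gt0.
have k0' : k%:R != 0 :> R by rewrite pnatr_eq0 -lt0n.
by field; rewrite k0' f0 addrC natr1 j0.
Qed.

(** The cycles of length [k] occupy disjoint sets of points. *)
Lemma cycle_count_le n (s : 'S_n) k : (0 < k)%N -> (k * cycle_count s k <= n)%N.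
Proof.
move=> k0; have := @sum_porbit_card n nat s (fun j => j == k) (n + k).+1.
rewrite ltnS leq_addr => /(_ isT).
have kB : (k < (n + k).+1)%N by rewrite ltnS leq_addl.
rewrite (bigD1 (Ordinal kB))//= eqxx mulr1 [X in _ = _ + X]big1 ?addr0; last first.
  move=> i ik; have [E|_] := eqVneq (i : nat) k; rewrite ?mulr0//.
  by case/eqP: ik; apply: val_inj; rewrite /= E.
rewrite natn => <-.
apply: leq_trans (_ : \sum_(j < n) 1 <= _)%N; last by rewrite sum1_card card_ord.
by apply: leq_sum => i _; case: eqP.
Qed.

(** Inclusion and exclusion: the indicator of a zero count [c] is the binomial
    expansion of [(1 - 1) ^+ c], whose terms are factorial moments. *)
Lemma ewens_mean_zero n k H : (0 < k)%N -> H \o incr k = H ->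
  ewens_mean n (fun m => (m k == 0%N)%:R * H m) =
  \sum_(j < n.+1) (- (theta / k%:R)) ^+ j / j`!%:R * weight_ratio n (k * j) * ewens_mean (n - k * j) H.
Proof.
move=> k0 Hk.
transitivity (ewens_mean n (fun m => \sum_(j < n.+1) (-1) ^+ j * ('C(m k, j)%:R * H m))).
  apply: eq_bigr => s _; congr (_ * _).
  set c := cycle_count s k.
  have cn : (c <= n)%N by rewrite (leq_trans _ (cycle_count_le s k0))// leq_pmull.
  under eq_bigr do rewrite mulrA; rewrite -mulr_suml; congr (_ * _).
  have -> : (c == 0%N)%:R = (1 - 1 : R) ^+ c by rewrite subrr expr0n.
  rewrite exprBn (big_ord_widen n.+1 (fun i => (-1) ^+ i * 1 ^+ (c - i) * 1 ^+ i *+ 'C(c, i)))//.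
  rewrite [in RHS](bigID (fun i : 'I_n.+1 => (i < c.+1)%N))/= [X in _ + X]big1 ?addr0; last first.
    by move=> i; rewrite -leqNgt => ci; rewrite bin_small// mulr0.
  by apply: eq_bigr => i _; rewrite !expr1n !mulr1 mulr_natr.
rewrite ewens_mean_sum; apply: eq_bigr => j _.
by rewrite ewens_meanZ ewens_mean_choose// [(- (theta / _)) ^+ _]exprNn !mulrA.
Qed.

End EwensMean.

(** * Poisson limits of the cycle counts *)

Lemma series_tail_small (R : realType) (b : nat -> R) : (forall j, 0 <= b j) ->
  cvgn (series b) -> forall e, 0 < e ->
  exists J, forall n, \sum_(J <= j < n) b j <= e.
Proof.
move=> b0 cb e e0.
have nd : nondecreasing_seq (series b) by apply/nondecreasing_series => i _ _; exact: b0.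
have le n : series b n <= limn (series b) by exact: nondecreasing_cvgn_le.
move: le cb; set l := limn _ => le cb.
have /cvgrPdist_le/(_ e e0)[J _ HJ] : series b @ \oo --> l by [].
have h : l - series b J <= e.
  by have h := HJ J (leqnn J); apply: le_trans h; exact: ler_norm.
exists J => n; have [nJ|Jn] := leqP n J; first by rewrite big_geq// ltW.
have -> : \sum_(J <= j < n) b j = series b n - series b J.
  by rewrite sub_series_geq//; exact: ltnW Jn.
by apply: le_trans h; rewrite lerD2r; exact: le.
Qed.

(** Dominated convergence for series: by domination, the terms of large rank
    are small uniformly in [n], and the others converge one by one. *)
Lemma tannery (R : realType) (u : nat -> nat -> R) (v b : nat -> R) (S : R) :
  (forall j, u^~ j @ \oo --> v j) -> (forall n j, `|u n j| <= b j) ->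
  cvgn (series b) -> series v @ \oo --> S ->
  (fun n => \sum_(j < n.+1) u n j) @ \oo --> S.
Proof.
move=> uv ub cb vS; apply/cvgrPdist_le => e e0.
have b0 j : 0 <= b j by rewrite (le_trans _ (ub 0%N j)).
have e3 : 0 < e / 3 by rewrite divr_gt0.
have [J1 HJ1] := series_tail_small b0 cb e3.
move/cvgrPdist_le : (vS) => /(_ _ e3) [J2 _ HJ2].
pose J := maxn J1 J2.
have cJ : (fun n => \sum_(j < J) u n j) @ \oo --> \sum_(j < J) v j.
  by apply: cvg_big => [|j _]; [exact: add_continuous|exact: uv].
move/cvgrPdist_le : cJ => /(_ _ e3) cJ.
near=> n.
have nJ : (J <= n.+1)%N by near: n; exists J => // k /= /leqW.
have -> : \sum_(j < n.+1) u n j = \sum_(j < J) u n j + \sum_(J <= j < n.+1) u n j.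
  by rewrite -!(big_mkord xpredT) [LHS](@big_cat_nat _ _ _ J).
have h1 : `|S - \sum_(j < J) v j| <= e / 3.
  by rewrite -(big_mkord xpredT) HJ2//= leq_maxr.
have h2 : `|\sum_(j < J) v j - \sum_(j < J) u n j| <= e / 3 by near: n.
have h3 : `|\sum_(J <= j < n.+1) u n j| <= e / 3.
  rewrite (le_trans (ler_norm_sum _ _ _))// (@le_trans _ _ (\sum_(J <= j < n.+1) b j))//.
    exact: ler_sum.
  rewrite (le_trans _ (HJ1 n.+1))// [leRHS](@big_cat_nat _ _ _ J) ?leq_maxl//=.
  by rewrite lerDr sumr_ge0.
move: h1 h2 h3; rewrite !ler_norml; lra.
Unshelve. all: by end_near.
Qed.

Section CountLimit.
Context (R : realType) (theta : R) (theta_gt0 : 0 < theta).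
Implicit Types (H : (nat -> nat) -> R).
Local Notation EN := (ewens_mean theta).

(** Term by term, the inclusion-exclusion series tends to the series of [expR
    (- (theta / k))] times the limit of the means of [H]. The factor [H] is
    carried along so that the counts can be treated one after the other. *)
Lemma cvg_ewens_mean_zero k H (B l : R) : (0 < k)%N -> H \o incr k = H ->
  (forall m, `|H m| <= B) -> EN^~ H @ \oo --> l ->
  (fun n => EN n (fun m => (m k == 0%N)%:R * H m)) @ \oo --> expR (- (theta / k%:R)) * l.
Proof.
move=> k0 Hk HB Hl.
set x := theta / k%:R; have x0 : 0 <= x by rewrite divr_ge0// ltW.
have B0 : 0 <= B by rewrite (le_trans _ (HB (fun=> 0%N))).
under eq_fun do rewrite ewens_mean_zero//.
(* Since k * j + 1 <= (k + 1) * 2 ^ j, the linear bound on the weight ratio is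
   absorbed by doubling the argument of the exponential series. *)
pose b j := (2 * x) ^+ j / j`!%:R * (k.+1%:R * (1 + theta^-1) * B).
have inv0 : 0 <= theta^-1 by rewrite invr_ge0 ltW.
have pow2 j : ((k * j).+1 <= k.+1 * 2 ^ j)%N.
  by have := ltn_expl j (ltnSn 1); nia.
apply: (@tannery R (fun n j => (- x) ^+ j / j`!%:R * weight_ratio theta n (k * j) * EN (n - k * j) H)
  (fun j => exp_coeff (- x) j * l) b).
- move=> j; have h1 := @cvg_weight_ratio R theta theta_gt0 (k * j).
  have h2 : (fun n => EN (n - k * j) H) @ \oo --> l.
    by rewrite -(cvg_shiftn (k * j)); under eq_fun do rewrite addnK.
  have := cvgM (cvgMl_tmp (a := (- x) ^+ j / j`!%:R) h1) h2.
  by rewrite mulr1; apply.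
- move=> n j.
  move: (weight_ratio_ge0 theta_gt0 n (k * j)) (weight_ratio_le theta_gt0 n (k * j)).
  move: (weight_ratio _ _ _) => W W0 W1; rewrite /b.
  have Eb : `|EN (n - k * j) H| <= B by exact: ewens_mean_bound.
  move: (EN _ _) Eb => E Eb.
  rewrite !normrM normfV normr_nat normrX normrN (ger0_norm x0) (ger0_norm W0).
  have -> : (2 * x) ^+ j / j`!%:R * (k.+1%:R * (1 + theta^-1) * B) =
            (x ^+ j / j`!%:R) * ((k.+1%:R * 2 ^+ j) * (1 + theta^-1)) * B by rewrite exprMn; ring.
  rewrite ler_pM// ?mulr_ge0 ?divr_ge0 ?exprn_ge0// ler_wpM2l ?divr_ge0 ?exprn_ge0//.
  rewrite (le_trans W1)// ler_wpM2r ?addr_ge0//.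
  by rewrite -natrX -natrM ler_nat.
- have -> : series b = (fun n => (k.+1%:R * (1 + theta^-1) * B) * series (exp_coeff (2 * x)) n).
    by apply/funext => n; rewrite /series/= mulr_sumr; apply: eq_bigr => j _; rewrite /b mulrC.
  apply: cvgP; apply: cvgMl_tmp; exact: is_cvg_series_exp_coeff.
- have -> : series (fun j => exp_coeff (- x) j * l) = (fun n => series (exp_coeff (- x)) n * l).
    by apply/funext => n; rewrite /series/= mulr_suml.
  by apply: cvgMr_tmp; exact: is_cvg_series_exp_coeff.
Qed.

(** The Mecke identity turns the event that the count is [j.+1] into the event
    that it is [j]; in the limit the probabilities satisfy the recursion of
    the Poisson law, and the value at 0 is known. *)
Lemma cvg_ewens_mean_eq k j H (B l : R) : (0 < k)%N -> H \o incr k = H ->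
  (forall m, `|H m| <= B) -> EN^~ H @ \oo --> l ->
  (fun n => EN n (fun m => (m k == j)%:R * H m)) @ \oo --> poisson_pmf (theta / k%:R) j * l.
Proof.
move=> k0 Hk HB Hl; rewrite /poisson_pmf divr_gt0 ?ltr0n//.
set x := theta / k%:R.
elim: j => [|j IH].
  by rewrite expr0 fact0 invr1 !mul1r; exact: cvg_ewens_mean_zero HB Hl.
have j0 : j.+1%:R != 0 :> R by rewrite pnatr_eq0.
have E n : EN n (fun m => (m k == j.+1)%:R * H m) =
    (x / j.+1%:R) * (weight_ratio theta n k * EN (n - k) (fun m => (m k == j)%:R * H m)).
  apply: (mulfI j0); rewrite -[LHS]ewens_meanZ.
  have -> : (fun m : nat -> nat => j.+1%:R * ((m k == j.+1)%:R * H m)) =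
      (fun m => (m k)%:R * (((m k).-1 == j)%:R * H m)).
    apply/funext => m; case: (m k) => [|i] /=; first by rewrite !mul0r mulr0.
    by rewrite eqSS; case: eqP => [->|_]//; rewrite !mul0r !mulr0.
  rewrite (@ewens_mean_count R theta theta_gt0 n k (fun m => ((m k).-1 == j)%:R * H m))//.
  have -> : (fun m => ((m k).-1 == j)%:R * H m) \o incr k = (fun m => (m k == j)%:R * H m).
    apply/funext => m /=; rewrite [H _](_ : _ = H m); last by rewrite -[in RHS]Hk.
    by rewrite /incr eqxx addn1.
  by rewrite -/x; field; rewrite addrC natr1.
under eq_fun do rewrite E.
have h2 : (fun n => EN (n - k) (fun m => (m k == j)%:R * H m)) @ \oo -->
    x ^+ j / j`!%:R * expR (- x) * l.
  by rewrite -(cvg_shiftn k); under eq_fun do rewrite addnK.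
have := cvgMl_tmp (a := x / j.+1%:R) (cvgM (@cvg_weight_ratio R theta theta_gt0 k) h2).
have -> : x / j.+1%:R * (1 * (x ^+ j / j`!%:R * expR (- x) * l)) =
    x ^+ j.+1 / (j.+1)`!%:R * expR (- x) * l.
  have f0 : j`!%:R != 0 :> R by rewrite pnatr_eq0 -lt0n fact_gt0.
  by rewrite exprS factS natrM; field; rewrite f0 addrC natr1.
by apply.
Qed.

Lemma ewens_mean_countE n k : (0 < k)%N -> EN n (fun m => (m k)%:R) = theta / k%:R * weight_ratio theta n k.
Proof.
move=> k0; have := @ewens_mean_count R theta theta_gt0 n k (fun=> 1) k0.
rewrite (_ : (fun=> 1) \o _ = (fun=> 1))// ewens_mean_cst// mulr1 => <-.
by congr ewens_mean; apply/funext => m; rewrite mulr1.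
Qed.

(** The cycle lengths add up to [n], so a permutation has few cycles with more
    than half of the points. *)
Lemma ewens_mean_large_cycles n : (0 < n)%N ->
  \sum_(k < n.+1 | (n < 2 * k)%N) EN n (fun m => (m k)%:R) <= 2.
Proof.
move=> n0; rewrite -ewens_mean_sum -[leRHS](@ewens_mean_cst R theta theta_gt0 n).
apply: ewens_mean_le => // s; rewrite -natr_sum ler_nat -(leq_pmul2l n0) big_distrr/=.
have := @sum_porbit_card n nat s (fun=> 1%N) n.+1 (ltnSn n).
rewrite sum1_card card_ord => cardE.
rewrite [X in (_ <= X * _)%N]cardE mulnC big_distrr/=.
rewrite [leqRHS](bigID (fun k : 'I_n.+1 => (n < 2 * k)%N))/=.
apply: leq_trans (leq_addr _ _); apply: leq_sum => k nk.
by rewrite mulr1 natn mulnA leq_mul2r ltnW ?orbT.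
Qed.

End CountLimit.

(** * Borel sets of the complex plane *)

Import Normc.
Local Notation Re := complex.Re.
Local Notation Im := complex.Im.

Lemma continuous_sum (R : realType) (T : topologicalType) (I : Type) (s : seq I) (h : I -> T -> R) :
  (forall i, continuous (h i)) -> continuous (fun v => \sum_(i <- s) h i v).
Proof.
move=> ch v; apply: cvg_big => [|i _]; first exact: add_continuous.
exact: ch.
Qed.

Section RealFamilies.
Context (R : realType) d (O : measurableType d) (I : finType).

(** An open set of a finite power of the line is a countable union of boxes
    with rational centers. *)
Lemma measurable_open_preimage (c : I -> O -> R) (U : set (I -> R)) :
  (forall i, measurable_fun setT (c i)) ->
  (forall x, U x -> exists2 e : R, 0 < e & forall y, (forall i, `|x i - y i| < e) -> U y) ->
  measurable [set w | U (c^~ w)].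
Proof.
move=> mc Uo.
pose box (q : {ffun I -> rat}) (m : nat) := [set y : I -> R | forall i, `|ratr (q i) - y i| < m.+1%:R^-1].
pose D := [set qm : {ffun I -> rat} * nat | box qm.1 qm.2 `<=` U].
have -> : [set w | U (c^~ w)] = \bigcup_(qm in D) \bigcap_(i in [set: I])
    (c i @^-1` (ball (ratr (qm.1 i) : R) qm.2.+1%:R^-1)).
  apply/seteqP; split => [w /= Uw|w [[q m] /= Dqm h]]; last first.
    by apply: Dqm => i; exact: h.
  have [e e0 he] := Uo _ Uw.
  have e2 : 0 < e / 2 by rewrite divr_gt0.
  have [m me] : exists m : nat, m.+1%:R^-1 < e / 2 :> R.
    have [m _ /(_ m (leqnn m)) /= h] := near_infty_natSinv_lt (PosNum e2).
    by exists m.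
  have qx (i : I) : exists q : rat, `|ratr q - c i w| < m.+1%:R^-1.
    have /rat_in_itvoo[q] : c i w < c i w + m.+1%:R^-1 by rewrite ltrDl invr_gt0.
    rewrite in_itv/= => /andP[q1 q2]; exists q.
    have m0 : 0 < m.+1%:R^-1 :> R by rewrite invr_gt0.
    move: q1 q2 m0; move: (m.+1%:R^-1) (ratr q : R) => t r q1 q2 m0.
    by rewrite ltr_norml; apply/andP; split; lra.
  have [q hq] := choice qx.
  exists (finfun q, m); last by move=> i _ /=; rewrite ffunE; exact: hq.
  move=> y hy; apply: he => i; have := hy i; have := hq i; rewrite /= ffunE => h1 h2.
  rewrite -(subrK (ratr (q i)) (c i w)) -addrA (le_lt_trans (ler_normD _ _))//.
  by rewrite distrC (splitr e) ltrD// (lt_trans _ me).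
rewrite bigcup_mkcond; apply: countable_bigcupT_measurable; first exact: countableP.
move=> qm; case: ifP => // _; apply: fin_bigcap_measurable; first exact: finite_finset.
move=> i _; rewrite -[X in measurable X]setTI; apply: mc => //.
exact: measurable_ball.
Qed.

(** The image of [K] is closed because the distance of an outer point to it
    attains a positive minimum on [K]. This replaces a measurable selection of
    [v]. *)
Lemma measurable_compact_image (T : topologicalType) (K : set T) (E : I -> T -> R)
    (c : I -> O -> R) : compact K -> (forall i, continuous (E i)) ->
  (forall i, measurable_fun setT (c i)) ->
  measurable [set w | exists2 v, K v & forall i, E i v = c i w].
Proof.
move=> cK cE mc.
rewrite -[X in measurable X]setCK; apply: measurableC.
apply: (@measurable_open_preimage c (fun x => ~ exists2 v, K v & forall i, E i v = x i)) => //.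
move=> x xK.
have [K0|K0] := pselect (K !=set0); last first.
  by exists 1 => // y _ [v Kv _]; apply: K0; exists v.
pose g v := \sum_i `|E i v - x i|.
have cg : continuous g.
  apply: continuous_sum => i v.
  apply: cvg_norm; apply: cvgB; [exact: cE|exact: cvg_cst].
have [v0] := compact_EVT_min K0 cK (continuous_subspaceT cg).
rewrite inE => Kv0 gmin.
have g0 : 0 < g v0.
  rewrite lt_neqAle sumr_ge0// andbT; apply/negP => /eqP /esym /eqP.
  rewrite psumr_eq0// => /allP h; apply: xK; exists v0 => // i.
  by have := h i (mem_index_enum i); rewrite /= normr_eq0 subr_eq0 => /eqP.
exists (g v0 / (#|I|.+1)%:R); first by rewrite divr_gt0.
move=> y xy [v Kv vy].
have : g v0 <= g v by apply: gmin; rewrite inE.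
apply/negP; rewrite -ltNge.
apply: (@le_lt_trans _ _ (\sum_(i : I) (g v0 / (#|I|.+1)%:R))).
  by apply: ler_sum => i _; rewrite vy distrC ltW.
rewrite sumr_const -[X in X < _]mulr_natr mulrAC ltr_pdivrMr// ltr_pM2l// ltr_nat.
by rewrite cardE.
Qed.

End RealFamilies.

Section ComplexBorel.
Local Open Scope complex_scope.
Context (R : realType).
Implicit Types (z w : R[i]).

Lemma normc_norm z : `|z| = (normc z)%:C.
Proof. by []. Qed.

Lemma normc_ge0 z : 0 <= normc z.
Proof. by case: z => a b; rewrite sqrtr_ge0. Qed.

Lemma normc_gt0 z : z != 0 -> 0 < normc z.
Proof. by move=> z0; rewrite lt_neqAle normc_ge0 andbT eq_sym; apply: contra z0 => /eqP/eq0_normc ->. Qed.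

Lemma normc_lt z e : (`|z| < e%:C) = (normc z < e).
Proof. by rewrite normc_norm ltcR. Qed.

Lemma normc_leD z : normc z <= `|Re z| + `|Im z|.
Proof.
case: z => a b /=; rewrite -[leRHS]ger0_norm ?addr_ge0// -sqrtr_sqr ler_wsqrtr//.
rewrite sqrrD !real_normK ?num_real// addrAC lerDl mulrn_wge0//.
Qed.

Lemma Re_le_normc z : `|Re z| <= normc z.
Proof. by case: z => a b /=; rewrite -sqrtr_sqr ler_wsqrtr// lerDl sqr_ge0. Qed.

Lemma Im_le_normc z : `|Im z| <= normc z.
Proof. by case: z => a b /=; rewrite -sqrtr_sqr ler_wsqrtr// lerDr sqr_ge0. Qed.

Lemma nbhs_normcP z (U : set R[i]) :
  nbhs z U <-> exists2 e : R, 0 < e & forall w, normc (z - w) < e -> U w.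
Proof.
split=> [/nbhs_ballP[e /= e0 zU]|[e e0 zU]].
  case: e e0 zU => [a b]; rewrite ltcE /= => /andP[/eqP -> a0] zU.
  by exists a => // w zw; apply: zU; rewrite /ball/= normc_lt.
by apply/nbhs_ballP; exists e%:C; rewrite /= ?ltcR// => w; rewrite /ball/= normc_lt; exact: zU.
Qed.

Lemma continuous_complex (T : topologicalType) (h : T -> R[i]) :
  continuous (fun v => Re (h v)) -> continuous (fun v => Im (h v)) -> continuous h.
Proof.
move=> cre cim v U /nbhs_normcP[e e0 hU].
have e2 : 0 < e / 2 by rewrite divr_gt0.
have /cvgrPdist_lt/(_ _ e2) h1 := cre v.
have /cvgrPdist_lt/(_ _ e2) h2 := cim v.
near=> y; apply: hU; rewrite (le_lt_trans (normc_leD _))// (splitr e) ltrD//.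
  rewrite raddfB; near: y; exact: h1.
rewrite raddfB; near: y; exact: h2.
Unshelve. all: by end_near.
Qed.

Lemma continuous_Re : continuous (@complex.Re R : R[i] -> R).
Proof.
move=> z; apply/(cvgrPdist_lt (FF := nbhs_filter z)) => e e0; apply/nbhs_normcP; exists e => // w zw.
by rewrite -raddfB (le_lt_trans (Re_le_normc _)).
Qed.

Lemma continuous_Im : continuous (@complex.Im R : R[i] -> R).
Proof.
move=> z; apply/(cvgrPdist_lt (FF := nbhs_filter z)) => e e0; apply/nbhs_normcP; exists e => // w zw.
by rewrite -raddfB (le_lt_trans (Im_le_normc _)).
Qed.

Lemma measurable_open_complex (U : set R[i]) : open U -> measurable U.
Proof. exact: sub_sigma_algebra. Qed.

Lemma measurable_continuous_complex (f : R[i] -> R) : continuous f -> measurable_fun setT f.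
Proof.
move=> cf; apply: (measurability _ (RGenOpens.measurableE R)) => _ [_ [a [b ->] <-]].
rewrite setTI; apply: measurable_open_complex; apply: open_comp; last exact: interval_open.
by move=> z _; exact: cf.
Qed.

Lemma measurable_Re : measurable_fun setT (@complex.Re R : R[i] -> R).
Proof. exact: measurable_continuous_complex continuous_Re. Qed.

Lemma measurable_Im : measurable_fun setT (@complex.Im R : R[i] -> R).
Proof. exact: measurable_continuous_complex continuous_Im. Qed.

Section MeasurableInto.
Context d (O : measurableType d).
Implicit Types (h g : O -> R[i]).

Lemma measurable_complexP h : measurable_fun setT h <->
  measurable_fun setT (fun v => Re (h v)) /\ measurable_fun setT (fun v => Im (h v)).
Proof.
split=> [mh|[mre mim]].
  by split; apply: measurableT_comp => //; [exact: measurable_Re|exact: measurable_Im].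
apply: (@measurability _ _ _ _ _ _ (@open R[i])) => // _ [U oU <-]; rewrite setTI.
have := @measurable_open_preimage R _ O bool (fun b v => if b then Re (h v) else Im (h v))
  (fun x => U (x true +i* x false)).
rewrite (_ : [set w | _] = h @^-1` U); last first.
  by apply/seteqP; split => w /=; case: (h w).
apply; first by case.
move=> x Ux; have /nbhs_normcP[e e0 he] : nbhs (x true +i* x false) U by exact: open_nbhs_nbhs.
exists (e / 2); first by rewrite divr_gt0.
move=> y xy; apply: he; rewrite (le_lt_trans (normc_leD _))//= (splitr e).
by rewrite ltrD//; exact: xy.
Qed.

Lemma measurable_complexM h g : measurable_fun setT h -> measurable_fun setT g ->
  measurable_fun setT (fun v => h v * g v).
Proof.
move=> /measurable_complexP[h1 h2] /measurable_complexP[g1 g2]; apply/measurable_complexP; split.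
  rewrite (_ : (fun _ => _) = (fun v => Re (h v) * Re (g v) - Im (h v) * Im (g v))).
    by apply: measurable_funB; apply: measurable_funM.
  by apply/funext => v; case: (h v) (g v) => [? ?] [? ?].
rewrite (_ : (fun _ => _) = (fun v => Re (h v) * Im (g v) + Im (h v) * Re (g v))).
  by apply: measurable_funD; apply: measurable_funM.
by apply/funext => v; case: (h v) (g v) => [? ?] [? ?].
Qed.

Lemma measurable_complexB h g : measurable_fun setT h -> measurable_fun setT g ->
  measurable_fun setT (fun v => h v - g v).
Proof.
move=> /measurable_complexP[h1 h2] /measurable_complexP[g1 g2]; apply/measurable_complexP; split.
  rewrite (_ : (fun _ => _) = (fun v => Re (h v) - Re (g v))); first exact: measurable_funB.
  by apply/funext => v; rewrite raddfB.
rewrite (_ : (fun _ => _) = (fun v => Im (h v) - Im (g v))); first exact: measurable_funB.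
by apply/funext => v; rewrite raddfB.
Qed.

Lemma measurable_complex_prod (I : Type) (s : seq I) (h : I -> O -> R[i]) :
  (forall i, measurable_fun setT (h i)) -> measurable_fun setT (fun v => \prod_(i <- s) h i v).
Proof.
move=> mh; elim: s => [|i s IH].
  by under eq_fun do rewrite big_nil; exact: measurable_cst.
by under eq_fun do rewrite big_cons; exact: measurable_complexM.
Qed.

Lemma measurable_complex_sum (I : Type) (s : seq I) (h : I -> O -> R[i]) :
  (forall i, measurable_fun setT (h i)) -> measurable_fun setT (fun v => \sum_(i <- s) h i v).
Proof.
move=> mh; elim: s => [|i s IH].
  by under eq_fun do rewrite big_nil; exact: measurable_cst.
under eq_fun do rewrite big_cons -[X in _ + X]opprK.
apply: measurable_complexB => //; under eq_fun do rewrite -[X in - X]subr0 opprB.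
by apply: measurable_complexB => //; exact: measurable_cst.
Qed.

End MeasurableInto.
End ComplexBorel.

(** * Measurable dependence of the roots of a polynomial *)

Section RootSum.
Local Open Scope complex_scope.
Context (R : realType).

Definition roots_seq (p : {poly R[i]}) : seq R[i] := sval (closed_field_poly_normal p).

Lemma monic_roots_seq (p : {poly R[i]}) : p \is monic -> p = \prod_(z <- roots_seq p) ('X - z%:P).
Proof.
move=> /monicP p1; rewrite /roots_seq; case: closed_field_poly_normal => r /=.
by rewrite p1 scale1r.
Qed.

Lemma size_roots_seq (p : {poly R[i]}) : p \is monic -> (size p).-1 = size (roots_seq p).
Proof. by move=> /monic_roots_seq {1}->; rewrite size_prod_XsubC. Qed.

(** With both parts required separately, products reduce to the real case. *)
Definition ccont (T : topologicalType) (h : T -> R[i]) :=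
  continuous (fun v => Re (h v)) /\ continuous (fun v => Im (h v)).

Lemma ccont_cst (T : topologicalType) (z : R[i]) : ccont (fun _ : T => z).
Proof. by split=> ?; exact: cvg_cst. Qed.

Lemma ccontB (T : topologicalType) (h g : T -> R[i]) : ccont h -> ccont g -> ccont (fun v => h v - g v).
Proof.
move=> [h1 h2] [g1 g2]; split.
  under eq_fun do rewrite raddfB; move=> v; apply: cvgB; [exact: h1|exact: g1].
under eq_fun do rewrite raddfB; move=> v; apply: cvgB; [exact: h2|exact: g2].
Qed.

Lemma ccontM (T : topologicalType) (h g : T -> R[i]) : ccont h -> ccont g -> ccont (fun v => h v * g v).
Proof.
move=> [h1 h2] [g1 g2]; split.
  rewrite (_ : (fun _ => _) = (fun v => Re (h v) * Re (g v) - Im (h v) * Im (g v))).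
    by move=> v; apply: cvgB; apply: cvgM; [exact: h1|exact: g1|exact: h2|exact: g2].
  by apply/funext => v; case: (h v) (g v) => [? ?] [? ?].
rewrite (_ : (fun _ => _) = (fun v => Re (h v) * Im (g v) + Im (h v) * Re (g v))).
  by move=> v; apply: cvgD; apply: cvgM; [exact: h1|exact: g2|exact: h2|exact: g1].
by apply/funext => v; case: (h v) (g v) => [? ?] [? ?].
Qed.

Lemma ccont_prod (T : topologicalType) (I : Type) (s : seq I) (h : I -> T -> R[i]) :
  (forall i, ccont (h i)) -> ccont (fun v => \prod_(i <- s) h i v).
Proof.
move=> ch; elim: s => [|i s IH].
  by under eq_fun do rewrite big_nil; exact: ccont_cst.
by under eq_fun do rewrite big_cons; exact: ccontM.
Qed.

(** [n.+1] evaluation points encode a monic polynomial by finitely many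
    numbers that depend continuously on its roots. *)
Lemma monic_eq_values n (p p' : {poly R[i]}) : p \is monic -> p' \is monic ->
  size p = n.+1 -> size p' = n.+1 ->
  (forall j : 'I_n.+1, p.[j%:R] = p'.[j%:R]) -> p = p'.
Proof.
move=> m m' sp sp' E; apply/eqP; rewrite -subr_eq0; apply/eqP.
apply: (@roots_geq_poly_eq0 _ _ [seq (j%:R : R[i]) | j <- iota 0 n.+1]).
- apply/allP => _ /mapP[j + ->]; rewrite mem_iota => /= jn.
  by rewrite rootE hornerD hornerN (E (Ordinal jn)) subrr.
- by rewrite map_inj_uniq ?iota_uniq// => i j /eqP; rewrite eqr_nat => /eqP.
- by rewrite size_map size_iota (leq_trans (size_polyD _ _))// size_polyN sp sp' maxnn.
Qed.

Context d (O : measurableType d) (n : nat) (p : O -> {poly R[i]}) (f : R[i] -> R).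
Context (p_monic : forall w, p w \is monic) (p_size : forall w, size (p w) = n.+1).
Context (p_meas : forall j : nat, measurable_fun setT (fun w => (p w).[j%:R])).
Context (f_cont : continuous f).

Let root_of (v : 'rV[R]_(n + n)) (i : 'I_n) : R[i] := v 0 (lshift n i) +i* v 0 (rshift n i).

Let ccont_root i : ccont (root_of^~ i).
Proof. by split => v; exact: coord_continuous. Qed.

(** There is no continuous labelling of the roots. However, the sum is at
    least [a] exactly when, for some bound on the roots, the polynomial has
    the same values as one whose roots lie in a compact set on which the sum
    is at least [a]; this is a condition of belonging to a compact image. *)
Lemma measurable_root_sum : measurable_fun setT (fun w => \sum_(z <- roots_seq (p w)) f z).
Proof.
apply: (measurability _ (RGenCInfty.measurableE R)) => _ [_ [a ->] <-]; rewrite setTI.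
pose K (B : nat) := [set v : 'rV[R]_(n + n) | forall j, `[- B%:R, B%:R]%classic (v ord0 j)].
pose F (v : 'rV[R]_(n + n)) := \sum_i f (root_of v i).
pose q (v : 'rV[R]_(n + n)) : {poly R[i]} := \prod_i ('X - (root_of v i)%:P).
have cF : continuous F.
  apply: continuous_sum => i v.
  have cr : continuous (root_of^~ i).
    by have [h1 h2] := ccont_root i; exact: continuous_complex h1 h2.
  by apply: (@continuous_comp _ _ _ (root_of^~ i) f v); [exact: cr|exact: f_cont].
pose part (b : bool) (z : R[i]) := if b then Re z else Im z.
have -> : (fun w => \sum_(z <- roots_seq (p w)) f z) @^-1` `[a, +oo[%classic =
  \bigcup_B [set w | exists2 v, (K B `&` F @^-1` `[a, +oo[%classic) v &
     forall i : 'I_n.+1 * bool, part i.2 (q v).[i.1%:R] = part i.2 (p w).[i.1%:R] ].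
  apply/seteqP; split => [w /= aw|w [B _ /= [v [Kv av] vE]]].
    pose r := roots_seq (p w).
    have sr : size r = n by rewrite -size_roots_seq// p_size.
    pose v : 'rV[R]_(n + n) := \row_j (match fintype.split j with inl i => Re (nth 0 r i) | inr i => Im (nth 0 r i) end).
    have rv i : root_of v i = nth 0 r i.
      rewrite /root_of !mxE.
      have -> : fintype.split (lshift n i) = inl i by rewrite -[lshift n i]/(unsplit (inl i)) unsplitK.
      have -> : fintype.split (rshift n i) = inr i by rewrite -[rshift n i]/(unsplit (inr i)) unsplitK.
      by case: nth.
    have [B hB] : exists B : nat, forall j, `|v ord0 j| <= B%:R.
      exists (Num.truncn (\sum_j `|v ord0 j|)).+1 => j.
      rewrite (@le_trans _ _ (\sum_j `|v ord0 j|))//; last by rewrite ltW// truncnS_gt.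
      by rewrite (bigD1 j)//= lerDl sumr_ge0.
    exists B => //=; exists v.
      split; first by move=> j /=; rewrite in_itv/= -ler_norml.
      move: aw; rewrite /F /= !in_itv/= !andbT => /le_trans; apply.
      rewrite (big_nth 0) -/r sr big_mkord le_eqVlt; apply/orP; left; apply/eqP.
      by apply: eq_bigr => i _; rewrite rv.
    move=> [j b] /=; congr part; congr horner.
    rewrite [RHS](monic_roots_seq (p_monic w)) -/r (big_nth 0) sr big_mkord.
    by apply: eq_bigr => i _; rewrite rv.
  move: av; rewrite /= !in_itv/= !andbT => /le_trans; apply.
  have pq : q v = p w.
    apply: (@monic_eq_values n) => //.
    - exact: monic_prod_XsubC.
    - by rewrite size_prod_XsubC /index_enum -enumT size_enum_ord.
    - move=> j; have := vE (j, true); have := vE (j, false); rewrite /part /=.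
      by case: (_.[_]) => a1 b1; case: (_.[_]) => a2 b2 /= -> ->.
  rewrite /F le_eqVlt; apply/orP; left; apply/eqP.
  have E : perm_eq (roots_seq (p w)) [seq root_of v i | i <- index_enum 'I_n].
    by apply: prod_XsubC_eq; rewrite -monic_roots_seq// big_map -pq.
  by rewrite (perm_big _ E)/= big_map.
apply: bigcupT_measurable => B.
apply: (@measurable_compact_image R d O ('I_n.+1 * bool)%type _ _ (fun i v => part i.2 (q v).[i.1%:R])
  (fun i w => part i.2 (p w).[i.1%:R])).
- have cK : compact (K B).
    by apply: (@rV_compact R (n + n) (fun=> `[- B%:R, B%:R]%classic)) => j; exact: segment_compact.
  apply: compact_closedI => //.
  apply: preimage_closed; first by move=> v _; exact: cF.
  exact: rray_closed.
- move=> [j b].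
  have [h1 h2] : ccont (fun v => (q v).[j%:R]).
    rewrite (_ : (fun _ => _) = (fun v => \prod_i (j%:R - root_of v i))).
      by apply: ccont_prod => i; apply: ccontB; [exact: ccont_cst|exact: ccont_root].
    by apply/funext => v; rewrite horner_prod; apply: eq_bigr => i _; rewrite hornerXsubC.
  by case: b.
- move=> [j b]; have /measurable_complexP[h1 h2] := p_meas j.
  by case: b.
Qed.

End RootSum.

(** * Sums of Dirac masses and sums over k-th roots *)

Section SumDirac.
Context (R : realType) d (T : measurableType d).

Lemma sum_dirac_seq (S : set T) (m : T -> nat) (s : seq T) (A : set T) :
  uniq s -> S = [set` s] ->
  sum_dirac R S m A = (\sum_(x <- s) ((m x)%:R : R)%:E * \d_x A)%E.
Proof.
move=> us ->; rewrite /sum_dirac esum_mkcondl esum_fset; [|exact: finite_seq|by move=> i _; case: ifP => // _; rewrite lee_fin].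
rewrite -fsbig_seq//; apply: eq_bigr => x _; rewrite diracE.
by case: ifP => _; rewrite ?mule1 ?mule0.
Qed.

Lemma ge0_integral_sum_dirac (S : set T) (m : T -> nat) (s : seq T) (h : T -> R) :
  uniq s -> S = [set` s] -> measurable_fun setT h -> (forall x, 0 <= h x) ->
  (\int[sum_dirac R S m]_x (h x)%:E = (\sum_(x <- s) (m x)%:R * h x)%:E)%E.
Proof.
move=> us Ss mh h0; pose x0 := nth point s.
have mhE : measurable_fun setT (EFin \o h) by exact/measurable_EFinP.
pose nu (i : nat) : {measure set T -> \bar R} := mscale (NngNum (ler0n R (m (x0 i)))) (dirac (x0 i)).
rewrite (@eq_measure_integral _ _ _ setT (msum nu (size s))); last first.
  move=> A mA _; rewrite [LHS](_ : _ = (\sum_(x <- s) ((m x)%:R : R)%:E * \d_x A)%E); last exact: sum_dirac_seq.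
  rewrite (big_nth point) big_mkord.
  by apply: eq_bigr => i _.
rewrite ge0_integral_measure_sum//; last by move=> x _; rewrite lee_fin.
rewrite [in RHS](big_nth point) big_mkord -sumEFin; apply: eq_bigr => i _.
rewrite ge0_integral_mscale//; last by move=> x _; rewrite lee_fin.
by rewrite integral_dirac// diracT mul1e.
Qed.

Lemma integral_sum_dirac (S : set T) (m : T -> nat) (s : seq T) (h : T -> R) :
  uniq s -> S = [set` s] -> measurable_fun setT h ->
  \int[sum_dirac R S m]_x (h x) = \sum_(x <- s) (m x)%:R * h x.
Proof.
move=> us Ss mh; rewrite /Rintegral integralE.
rewrite (eq_integral (fun x => (Num.max (h x) 0)%:E)); last by move=> x _; rewrite funeposE EFin_max.
rewrite [X in (_ - X)%E](eq_integral (fun x => (Num.max (- h x) 0)%:E)); last first.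
  by move=> x _; rewrite funenegE EFin_max.
have mN : measurable_fun setT (fun x => - h x) by exact: measurableT_comp.
rewrite !(ge0_integral_sum_dirac m us Ss)//=.
- rewrite -sumrB; apply: eq_bigr => x _; rewrite -mulrBr; congr (_ * _).
  by case: (leP (h x) 0); case: (leP (- h x) 0); lra.
- by apply: measurable_maxr => //; exact: measurable_cst.
- by move=> x; rewrite le_max lexx orbT.
- by apply: measurable_maxr => //; exact: measurable_cst.
- by move=> x; rewrite le_max lexx orbT.
Qed.

End SumDirac.

Section Roots.
Context (R : realType).
Implicit Types (h : R[i] -> R) (t : R[i]).

(** [undup] makes a difference at [t = 0] only: there the root 0 has
    multiplicity [k] in the polynomial, but mass 1 in the measure on the
    solutions of [w ^+ k = t]. *)
Definition root_sum h (k : nat) t : R := \sum_(x <- undup (roots_seq ('X^k - t%:P))) h x.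

Lemma mem_roots_seq (p : {poly R[i]}) x : p \is monic -> (x \in roots_seq p) = root p x.
Proof. by move=> mp; rewrite {2}(monic_roots_seq mp) root_prod_XsubC. Qed.

Lemma XnsubC_monic k t : (0 < k)%N -> 'X^k - t%:P \is monic.
Proof. by move=> k0; rewrite monicXnsubC. Qed.

Lemma kth_roots_setE k t : (0 < k)%N ->
  [set w : R[i] | w ^+ k = t] = [set` undup (roots_seq ('X^k - t%:P))].
Proof.
move=> k0; apply/seteqP; split => w /=; rewrite mem_undup mem_roots_seq ?XnsubC_monic//.
  by move=> <-; rewrite rootE hornerD hornerN hornerXn hornerC subrr.
by rewrite rootE hornerD hornerN hornerXn hornerC subr_eq0 => /eqP.
Qed.

Lemma ge0_integral_kth_roots h k t : (0 < k)%N -> measurable_fun setT h -> (forall x, 0 <= h x) ->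
  (\int[kth_roots_measure k t]_x (h x)%:E = (root_sum h k t)%:E)%E.
Proof.
move=> k0 mh h0; rewrite (ge0_integral_sum_dirac _ (undup_uniq _) (kth_roots_setE t k0))//.
by congr EFin; apply: eq_bigr => x _; rewrite mul1r.
Qed.

Lemma root_sum_neq0 h k t : (0 < k)%N -> root_sum h k t != 0 -> exists w, w ^+ k = t /\ h w != 0.
Proof.
move=> k0; apply: contra_neqP => hw.
rewrite /root_sum big_seq big1// => w wr.
apply: contra_notP hw => /eqP hw0; exists w; split => //.
by have : [set` undup (roots_seq ('X^k - t%:P))] w by []; rewrite -kth_roots_setE.
Qed.

(** The derivative vanishes at 0 only. *)
Lemma uniq_roots_XnsubC k t : (0 < k)%N -> t != 0 -> uniq (roots_seq ('X^k - t%:P)).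
Proof.
move=> k0 t0; rewrite -separable_prod_XsubC -monic_roots_seq ?XnsubC_monic//.
rewrite unlock derivB derivC subr0 derivXn -scaler_nat coprimepZr ?pnatr_eq0 -?lt0n//.
rewrite coprimep_expr// -[X in coprimep _ X]subr0 -polyC0 coprimep_XsubC.
by rewrite rootE hornerD hornerN hornerXn hornerC expr0n eqn0Ngt k0/= sub0r oppr_eq0.
Qed.

Lemma root_sum_roots_seq h k t : (0 < k)%N -> t != 0 ->
  root_sum h k t = \sum_(x <- roots_seq ('X^k - t%:P)) h x.
Proof. by move=> k0 t0; rewrite /root_sum undup_id// uniq_roots_XnsubC. Qed.

Lemma measurable_set1_complex (z : R[i]) : measurable [set z].
Proof.
have -> : [set z] = (@complex.Re R) @^-1` [set complex.Re z] `&` (@complex.Im R) @^-1` [set complex.Im z].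
  by apply/seteqP; split => [w -> //|w /=]; case: z w => [a b] [a' b'] /= [-> ->].
apply: measurableI; rewrite -[X in measurable X]setTI.
  exact: measurable_Re.
exact: measurable_Im.
Qed.

(** The sum that counts multiplicities is measurable, and [root_sum] differs
    from it at a single point. *)
Lemma measurable_root_sum_XnsubC h k : (0 < k)%N -> continuous h -> measurable_fun setT (root_sum h k).
Proof.
move=> k0 ch; pose S t := \sum_(x <- roots_seq ('X^k - t%:P)) h x.
have -> : root_sum h k = (fun t => S t + \1_[set 0] t * (root_sum h k 0 - S 0)).
  apply/funext => t; have [->|t0] := eqVneq t 0.
    by rewrite indicE mem_set// mul1r addrC subrK.
  by rewrite indicE memNset ?mul0r ?addr0 ?root_sum_roots_seq//; exact/eqP.
apply: measurable_funD; last first.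
  apply: measurable_funM; last exact: measurable_cst.
  exact: measurable_indic (measurable_set1_complex _).
apply: (@measurable_root_sum R _ _ k) => //.
- by move=> t; rewrite XnsubC_monic.
- by move=> t; rewrite size_XnsubC.
- move=> j; under eq_fun do rewrite hornerD hornerN hornerXn hornerC.
  apply: measurable_complexB; [exact: measurable_cst|exact: measurable_id].
Qed.

End Roots.

(** * Linear statistics of the spectrum and of the limit measure *)

Section Eigen.
Context (R : realType).
Implicit Types (h : R[i] -> R).

Lemma prod_porbits (V : comPzSemiRingType) n (s : 'S_n) (F : 'I_n -> V) :
  \prod_j F j = \prod_(c in porbits s) \prod_(j in c) F j.
Proof.
rewrite (partition_big (porbit s) (mem (porbits s)))/=; last by move=> j _; rewrite imset_f.
apply: eq_bigr => c cP; apply: eq_bigl => j.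
by rewrite /= (mem_porbits_eq _ cP) eq_sym.
Qed.

(** The points of evaluation avoid 0, since [char_poly_mx_of_perm] divides by
    them. *)
Lemma poly_eq_values (p q : {poly R[i]}) : (forall j : nat, p.[j.+1%:R] = q.[j.+1%:R]) -> p = q.
Proof.
move=> E; apply/eqP; rewrite -subr_eq0; apply/eqP.
apply: (@roots_geq_poly_eq0 _ _ [seq (j.+1%:R : R[i]) | j <- iota 0 (size (p - q))]).
- by apply/allP => _ /mapP[j _ ->]; rewrite rootE hornerD hornerN E subrr.
- by rewrite map_inj_uniq ?iota_uniq// => i j /eqP; rewrite eqr_nat eqSS => /eqP.
- by rewrite size_map size_iota.
Qed.

Lemma horner_char_poly n (A : 'M[R[i]]_n) x : (char_poly A).[x] = \det (x%:M - A).
Proof.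
rewrite /char_poly -[_.[x]]/(horner_eval x _) -det_map_mx; congr (\det _).
apply/matrixP => i j; rewrite !mxE; change (('X *+ (i == j) - (A i j)%:P).[x] = x *+ (i == j) - A i j).
by rewrite hornerD hornerN hornerC hornerMn hornerX.
Qed.

(** At [x != 0], dividing the weights by [x] reduces the characteristic
    polynomial to [det_sub_weighted_perm]. *)
Lemma char_poly_mx_of_perm n (s : 'S_n) (z : 'I_n -> R[i]) :
  char_poly (mx_of_perm s z) = \prod_(c in porbits s) ('X^#|c| - (\prod_(j in c) z j)%:P).
Proof.
apply: poly_eq_values => j; rewrite horner_char_poly.
set x := j.+1%:R; have x0 : x != 0 by rewrite pnatr_eq0.
have -> : x%:M - mx_of_perm s z = x *: (1%:M - weighted_perm_mx s (fun j => z j / x)).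
  apply/matrixP => i k; rewrite !mxE mulrBr mulrnAr mulr1 mulrnAr; congr (_ - _ *+ _).
  by rewrite mulrC divfK.
rewrite detZ det_sub_weighted_perm horner_prod.
have -> : x ^+ n = \prod_(i < n) x by rewrite prodr_const card_ord.
rewrite (prod_porbits s) -big_split/=; apply: eq_bigr => c _.
rewrite hornerD hornerN hornerXn hornerC mulrBr mulr1 -big_split/= prodr_const; congr (_ - _).
by apply: eq_bigr => i _; rewrite mulrC divfK.
Qed.

Lemma integral_eigenvalue_measure n (A : 'M[R[i]]_n) h : measurable_fun setT h ->
  \int[eigenvalue_measure A]_x h x = \sum_(x <- roots_seq (char_poly A)) h x.
Proof.
move=> mh; have mA := char_poly_monic A.
rewrite (integral_sum_dirac _ (undup_uniq (roots_seq (char_poly A))))//; last first.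
  apply/seteqP; split => x /=; by rewrite mem_undup mem_roots_seq// eigenvalue_root_char.
rewrite -[RHS]big_undup_iterop_count; apply: eq_bigr => x _.
by rewrite {1}(monic_roots_seq mA) mu_prod_XsubC mulr_natl.
Qed.

(** Over the nonzero complex numbers, the factors of the characteristic
    polynomial are separable, so each cycle contributes every root of its
    product once. *)
Lemma integral_eigenvalue_mx_of_perm n (s : 'S_n) (z : 'I_n -> R[i]) h :
  measurable_fun setT h -> (forall j, z j != 0) ->
  \int[eigenvalue_measure (mx_of_perm s z)]_x h x =
  \sum_(c in porbits s) root_sum h #|c| (\prod_(j in c) z j).
Proof.
move=> mh z0; rewrite integral_eigenvalue_measure//.
have c0 c : c \in porbits s -> (0 < #|c|)%N.
  by case/imsetP => x _ ->; rewrite card_gt0; apply/set0Pn; exists x; exact: porbit_id.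
pose rr (c : {set 'I_n}) := roots_seq ('X^#|c| - (\prod_(j in c) z j)%:P).
have E : perm_eq (roots_seq (char_poly (mx_of_perm s z))) (flatten [seq rr c | c <- enum (porbits s)]).
  apply: prod_XsubC_eq; rewrite -monic_roots_seq ?char_poly_monic// char_poly_mx_of_perm.
  rewrite big_flatten big_map -big_enum/=.
  rewrite [LHS]big_seq [RHS]big_seq; apply: eq_bigr => c; rewrite mem_enum => cP.
  by rewrite -monic_roots_seq// XnsubC_monic// c0.
rewrite (perm_big _ E)/= big_flatten big_map -big_enum/=.
rewrite [LHS]big_seq [RHS]big_seq; apply: eq_bigr => c; rewrite mem_enum => cP.
by rewrite root_sum_roots_seq// ?c0//; apply/prodf_neq0 => j _; exact: z0.
Qed.

Lemma measurable_mx_entry d (O : measurableType d) m n (A : O -> 'M[R[i]]_(m, n)) :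
  measurable_fun setT A -> forall i j, measurable_fun setT (fun w => A w i j).
Proof.
move=> mA i j _ B mB; rewrite setTI.
have := mA measurableT [set M : 'M[R[i]]_(m, n) | B (M i j)].
rewrite setTI; apply; apply: sub_sigma_algebra.
by exists (i, j) => //; exists B => //; rewrite setTI.
Qed.

Lemma measurable_mx_of_entries d (O : measurableType d) m n (A : O -> 'M[R[i]]_(m, n)) :
  (forall i j, measurable_fun setT (fun w => A w i j)) -> measurable_fun setT A.
Proof.
move=> mA; apply: (@measurability _ _ _ _ _ _ (@mx_cylinders _ R[i] m n)) => //.
move=> _ [_ [[i j] _ [B mB <-]] <-]; rewrite !setTI.
have := mA i j measurableT B mB; by rewrite setTI.
Qed.

Lemma measurable_det d (O : measurableType d) n (A : O -> 'M[R[i]]_n) :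
  (forall i j, measurable_fun setT (fun w => A w i j)) -> measurable_fun setT (fun w => \det (A w)).
Proof.
move=> mA; rewrite /determinant; apply: measurable_complex_sum => s.
apply: measurable_complexM; first exact: measurable_cst.
by apply: measurable_complex_prod.
Qed.

Lemma measurable_integral_eigenvalue d (O : measurableType d) n (A : O -> 'M[R[i]]_n) h :
  continuous h -> measurable_fun setT A ->
  measurable_fun setT (fun w => \int[eigenvalue_measure (A w)]_x h x).
Proof.
move=> ch mA; have mh := measurable_continuous_complex ch.
rewrite (_ : (fun w => _) = (fun w => \sum_(x <- roots_seq (char_poly (A w))) h x)); last first.
  by apply/funext => w; rewrite integral_eigenvalue_measure.
apply: (@measurable_root_sum R _ _ n) => // [w|w|j].
- exact: char_poly_monic.
- exact: size_char_poly.
- under eq_fun do rewrite horner_char_poly.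
  apply: measurable_det => i k; under eq_fun do rewrite !mxE.
  by apply: measurable_complexB; [exact: measurable_cst|exact: measurable_mx_entry].
Qed.

Lemma ge0_integral_mu_infty h (a : nat -> nat) (T : nat -> nat -> R[i]) :
  measurable_fun setT h -> (forall x, 0 <= h x) ->
  (\int[mu_infty a T]_x (h x)%:E =
   \sum_(1 <= k <oo) (\sum_(p < a k) root_sum h k (T k p.+1))%:E)%E.
Proof.
move=> mh h0.
pose nu (k : nat) : {measure set R[i] -> \bar R} :=
  msum (fun p => kth_roots_measure k.+1 (T k.+1 p.+1)) (a k.+1).
have mhE : measurable_fun setT (EFin \o h) by exact/measurable_EFinP.
have hE0 x : (0 <= (h x)%:E)%E by rewrite lee_fin.
have shift (u : nat -> \bar R) : (forall k, (0 <= u k)%E) ->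
    (\sum_(1 <= k <oo) u k = \sum_(0 <= k <oo) u k.+1)%E.
  move=> u0; rewrite -(@nneseries_addn R u 1)//.
  by apply: eq_eseriesr => k _; rewrite addn1.
rewrite (@eq_measure_integral _ _ _ setT (mseries nu 0)); last first.
  by move=> A mA _; rewrite [LHS]shift.
rewrite ge0_integral_measure_series// shift; last first.
  move=> k; rewrite lee_fin sumr_ge0// => p _; rewrite sumr_ge0//.
apply: eq_eseriesr => k _; rewrite ge0_integral_measure_sum// -sumEFin.
by apply: eq_bigr => p _; rewrite ge0_integral_kth_roots.
Qed.

End Eigen.

(** * Independence of sigma-algebras and joint laws *)

Section PiSystem.
Context (O : pointedType) (I : choiceType).
Implicit Types (B : set I) (F : I -> set (set O)).

(** A pi-system that generates the sigma-algebra of the block [B]. *)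
Definition fin_cylinders B F : set (set O) :=
  [set A | exists (J : {fset I}) (E : I -> set O),
     (forall i, i \in J -> B i /\ F i (E i)) /\ A = \bigcap_(i in [set` J]) E i].

Lemma setI_closed_fin_cylinders B F : (forall i, B i -> setI_closed (F i)) ->
  setI_closed (fin_cylinders B F).
Proof.
move=> FI _ _ [J [E [JE ->]]] [J' [E' [JE' ->]]].
exists (J `|` J')%fset, (fun i => (if i \in J then E i else setT) `&` (if i \in J' then E' i else setT)).
split.
  move=> i; rewrite inE => /orP[iJ|iJ'].
    have [Bi Fi] := JE _ iJ; split => //; rewrite iJ; case: ifPn => [/JE'[_ ?]|_]; last by rewrite setIT.
    exact: FI.
  have [Bi Fi] := JE' _ iJ'; split => //; rewrite iJ'; case: ifPn => [/JE[_ ?]|_]; last by rewrite setTI.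
  exact: FI.
apply/seteqP; split=> [w [h h'] i /=|w h].
  by move=> _; split; case: ifP => // iJ; [exact: h|exact: h'].
split=> i /= iJ; have := h i; rewrite /= inE iJ ?orbT => /(_ isT)[]//.
Qed.

Lemma fin_cylindersT B F : fin_cylinders B F setT.
Proof.
exists fset0, (fun=> setT); split => [i|]; first by rewrite in_fset0.
by rewrite bigcapT.
Qed.

Lemma fin_cylinders1 B F i A : B i -> F i A -> fin_cylinders B F A.
Proof.
move=> Bi FA; exists [fset i]%fset, (fun=> A); split => [j|]; first by rewrite inE => /eqP ->.
by rewrite set_fset1 bigcap_set1.
Qed.

Lemma g_sigma_fin_cylinders B F : <<s \bigcup_(i in B) F i >> = <<s fin_cylinders B F >>.
Proof.
apply/seteqP; split; apply: smallest_sub; try exact: smallest_sigma_algebra.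
  by move=> A [i Bi FA]; apply: sub_sigma_algebra; exact: fin_cylinders1 FA.
move=> _ [J [E [JE ->]]].
apply: (@fin_bigcap_measurable _ (g_sigma_algebraType (\bigcup_(i in B) F i))) => [|i /= /JE[Bi FE]].
  exact: finite_fset.
by apply: sub_sigma_algebra; exists i.
Qed.
End PiSystem.

Section Independence.
Context (R : realType) d (O : measurableType d) (P : probability O R).

(** The restriction of [P] to [A2] and the multiple [P A2 * P] are finite
    measures that agree on a pi-system. *)
Lemma indep_g_sigma (G : set (set O)) (A2 : set O) :
  setI_closed G -> G setT -> G `<=` measurable -> measurable A2 ->
  (forall A, G A -> P (A `&` A2) = (P A * P A2)%E) ->
  forall A, <<s G >> A -> P (A `&` A2) = (P A * P A2)%E.
Proof.
move=> GI GT Gm mA2 GP A sA.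
have PA2 : P A2 \is a fin_num by exact: fin_num_measure.
have r0 : 0 <= fine (P A2) by exact: fine_ge0.
pose r := NngNum r0; have rE : (r%:num)%:E = P A2 by rewrite fineK.
have h : mrestr P mA2 A = mscale r P A.
  apply: (@g_sigma_algebra_measure_unique _ R O G Gm (fun=> setT) (fun=> GT) _ _ _ GI) => //.
  - by rewrite bigcup_const//; exists 0%N.
  - by move=> B GB; change (P (B `&` A2) = r%:num%:E * P B)%E; rewrite rE muleC; exact: GP.
  - move=> _; change (P (setT `&` A2) < +oo)%E; rewrite setTI.
    by rewrite (le_lt_trans (probability_le1 _ _))// ltry.
by move: h; rewrite /mrestr /mscale rE muleC.
Qed.

Context (I : choiceType) (D : set I) (F : I -> set (set O)).
Context (Find : mutual_independence P D F).
Context (FI : forall i, D i -> setI_closed (F i)).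
Context (Fm : forall i, D i -> F i `<=` measurable).

Lemma fin_cylinders_measurable B : B `<=` D -> fin_cylinders B F `<=` measurable.
Proof.
move=> BD _ [J [E [JE ->]]]; apply: fin_bigcap_measurable; first exact: finite_fset.
by move=> i /= /JE[Bi FE]; apply: (Fm (BD _ Bi)).
Qed.

Lemma indep_blocks B1 B2 A1 A2 : B1 `<=` D -> B2 `<=` D -> B1 `&` B2 = set0 ->
  <<s \bigcup_(i in B1) F i >> A1 -> <<s \bigcup_(i in B2) F i >> A2 ->
  P (A1 `&` A2) = (P A1 * P A2)%E.
Proof.
move=> B1D B2D B12; rewrite !g_sigma_fin_cylinders => sA1 sA2.
have FI1 i : B1 i -> setI_closed (F i) by move=> /B1D; exact: FI.
have FI2 i : B2 i -> setI_closed (F i) by move=> /B2D; exact: FI.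
have m1 := fin_cylinders_measurable B1D.
have m2 := fin_cylinders_measurable B2D.
have sm2 : <<s fin_cylinders B2 F >> `<=` measurable by exact: smallest_sub (sigma_algebra_measurable _) m2.
apply: (indep_g_sigma (setI_closed_fin_cylinders FI1) (fin_cylindersT _ _) m1 (sm2 _ sA2)) => // {sA1}{}A1 cA1.
rewrite setIC muleC.
apply: (indep_g_sigma (setI_closed_fin_cylinders FI2) (fin_cylindersT _ _) m2 (m1 _ cA1)) => // {sA2}{}A2 cA2.
case: cA1 cA2 => [J1 [E1 [JE1 ->]]] [J2 [E2 [JE2 ->]]].
have J12 i : i \in J1 -> i \in J2 -> False.
  by move=> /JE1[h1 _] /JE2[h2 _]; have : (B1 `&` B2) i by []; rewrite B12.
pose E i := if i \in J1 then E1 i else E2 i.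
have e1 : \bigcap_(i in [set` J1]) E1 i = \bigcap_(i in [set` J1]) E i.
  by apply: eq_bigcapr => i /= iJ; rewrite /E iJ.
have e2 : \bigcap_(i in [set` J2]) E2 i = \bigcap_(i in [set` J2]) E i.
  by apply: eq_bigcapr => i /= iJ; rewrite /E; case: ifPn => // /J12; case.
rewrite e1 e2 -bigcap_setU.
have -> : [set` J2] `|` [set` J1] = [set` (J2 `|` J1)%fset] by rewrite set_fsetU.
have JE i : i \in (J2 `|` J1)%fset -> D i /\ F i (E i).
  rewrite inE /E; case: ifPn => [/JE1[? ?] _|_]; first by split=> //; exact: B1D.
  by rewrite orbF => /JE2[? ?]; split=> //; exact: B2D.
rewrite !Find//; last 2 first.
- by move=> i iJ; apply: JE; rewrite inE iJ orbT.
- by move=> i iJ; apply: JE; rewrite inE iJ.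
have pJ : perm_eq (J2 `|` J1)%fset (J2 ++ J1).
  apply: uniq_perm; first exact: fset_uniq.
    rewrite cat_uniq !fset_uniq andbT/=; apply/hasPn => i i1; apply/negP => i2; exact: J12 i1 i2.
  by move=> i; rewrite inE mem_cat.
by rewrite (perm_big _ pJ)/= big_cat.
Qed.

(** By induction on the finite subfamily: the blocks already met form a single
    block, disjoint from the next one. *)
Lemma mutual_independence_blocks (K : choiceType) (D' : set K) (B : K -> set I) :
  (forall k, D' k -> B k `<=` D) ->
  (forall k l, D' k -> D' l -> k != l -> B k `&` B l = set0) ->
  mutual_independence P D' (fun k => <<s \bigcup_(i in B k) F i >>).
Proof.
move=> BD Bdisj J A JA; rewrite bigcap_fset.
have : forall s : seq K, uniq s -> (forall k, k \in s -> D' k /\ <<s \bigcup_(i in B k) F i >> (A k)) ->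
  <<s \bigcup_(i in \bigcup_(k in [set` s]) B k) F i >> (\big[setI/setT]_(k <- s) A k) /\
  P (\big[setI/setT]_(k <- s) A k) = (\prod_(k <- s) P (A k))%E.
  elim=> [_ _|k s IH /= /andP[ks us] sA].
    rewrite !big_nil probability_setT; split => //.
    exact: (@measurableT _ (g_sigma_algebraType (\bigcup_(i in _) F i))).
  have sA' l : l \in s -> D' l /\ <<s \bigcup_(i in B l) F i >> (A l).
    by move=> ls; apply: sA; rewrite inE ls orbT.
  have [IH1 IH2] := IH us sA'.
  have [D'k sk] := sA k (mem_head _ _).
  rewrite !big_cons; split.
    apply: (@measurableI _ (g_sigma_algebraType (\bigcup_(i in _) F i))).
      move: sk; apply: sub_sigma_algebra2 => i [j Bj Fj]; exists j => //; exists k => //=; exact: mem_head.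
    move: IH1; apply: sub_sigma_algebra2 => i [j [l /= ls Bj] Fj]; exists j => //; exists l => //=.
    by rewrite inE ls orbT.
  rewrite -IH2; apply: (indep_blocks (B1 := B k) (B2 := \bigcup_(l in [set` s]) B l)) => //.
  - exact: BD.
  - by apply: bigcup_sub => l /= /sA'[? _]; exact: BD.
  - apply/seteqP; split => // i [Bi [l /= ls Bl]].
    have kl : k != l by apply: contraNneq ks => ->.
    have [D'l _] := sA' _ ls.
    by have := Bdisj _ _ D'k D'l kl; rewrite -subset0 => /(_ i); apply.
by move=> /(_ _ (fset_uniq J)) h; have [] := h _.
Qed.

End Independence.

Section Events.
Context (R : realType) d (O : measurableType d) (P : probability O R).
Context d' (T : measurableType d').

Lemma events_measurable (X : O -> T) : measurable_fun setT X -> events X `<=` measurable.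
Proof. by move=> mX _ [B mB <-]; exact: mX. Qed.

Lemma setI_closed_preimage (O' : Type) (X : O' -> T) :
  setI_closed (preimage_set_system setT X measurable).
Proof.
move=> _ _ [A mA <-] [B mB <-]; exists (A `&` B); first exact: measurableI.
by rewrite !setTI preimage_setI.
Qed.

Lemma events_preimage (X : O -> T) A : measurable A -> events X (X @^-1` A).
Proof. by move=> mA; exists A => //; rewrite setTI. Qed.

End Events.

Section JointLaw.
Context (R : realType) (d1 d2 d' : measure_display).
Context (O1 : measurableType d1) (O2 : measurableType d2) (T : measurableType d').
Context (P1 : probability O1 R) (P2 : probability O2 R).
Context (I : choiceType) (D : set I).
Context (X1 : I -> O1 -> T) (X2 : I -> O2 -> T).
Context (mX1 : forall i, D i -> measurable_fun setT (X1 i)).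
Context (mX2 : forall i, D i -> measurable_fun setT (X2 i)).
Context (ind1 : mutual_independence P1 D (fun i => events (X1 i))).
Context (ind2 : mutual_independence P2 D (fun i => events (X2 i))).
Context (law12 : forall i A, D i -> measurable A -> P1 (X1 i @^-1` A) = P2 (X2 i @^-1` A)).

Definition coord_events (i : I) : set (set (I -> T)) :=
  preimage_set_system setT (fun x : I -> T => x i) measurable.

(** Both laws are given by the product rule on finite cylinders, which form a
    pi-system. *)
Lemma joint_law_eq (A : set (I -> T)) : <<s \bigcup_(i in D) coord_events i >> A ->
  P1 ((fun w i => X1 i w) @^-1` A) = P2 ((fun w i => X2 i w) @^-1` A).
Proof.
pose Y1 w i := X1 i w; pose Y2 w i := X2 i w.
rewrite g_sigma_fin_cylinders; set G := fin_cylinders _ _ => sA.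
suff [] : [/\ measurable (Y1 @^-1` A), measurable (Y2 @^-1` A) & P1 (Y1 @^-1` A) = P2 (Y2 @^-1` A)] by [].
move: A sA; apply: (@dynkin_induction _ (g_sigma_algebraType G) G
  (fun A => [/\ measurable (Y1 @^-1` A), measurable (Y2 @^-1` A) & P1 (Y1 @^-1` A) = P2 (Y2 @^-1` A)])) => //.
- by apply: setI_closed_fin_cylinders => i _; exact: setI_closed_preimage.
- by rewrite !preimage_setT !probability_setT; split.
- move=> _ [J [E [JE ->]]].
  have /choice[B hB] : forall i, exists B : set T, i \in J -> measurable B /\ E i = (fun x => x i) @^-1` B.
    move=> i; have [iJ|_] := boolP (i \in J); last by exists setT.
    by have [_ [B mB <-]] := JE _ iJ; exists B => _; rewrite setTI.
  have e1 : Y1 @^-1` (\bigcap_(i in [set` J]) E i) = \bigcap_(i in [set` J]) (X1 i @^-1` B i).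
    by rewrite preimage_bigcap; apply: eq_bigcapr => i /= /hB[_ ->].
  have e2 : Y2 @^-1` (\bigcap_(i in [set` J]) E i) = \bigcap_(i in [set` J]) (X2 i @^-1` B i).
    by rewrite preimage_bigcap; apply: eq_bigcapr => i /= /hB[_ ->].
  rewrite e1 e2; split.
  + apply: fin_bigcap_measurable => [|i /= iJ]; first exact: finite_fset.
    by rewrite -[X in measurable X]setTI; apply: mX1 => //; have [] := hB _ iJ; have [] := JE _ iJ.
  + apply: fin_bigcap_measurable => [|i /= iJ]; first exact: finite_fset.
    by rewrite -[X in measurable X]setTI; apply: mX2 => //; have [] := hB _ iJ; have [] := JE _ iJ.
  + rewrite ind1; last first.
      by move=> i iJ; split; [have [] := JE _ iJ|apply: events_preimage; have [] := hB _ iJ].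
    rewrite ind2; last first.
      by move=> i iJ; split; [have [] := JE _ iJ|apply: events_preimage; have [] := hB _ iJ].
    rewrite big_seq [RHS]big_seq; apply: eq_bigr => i iJ.
    by apply: law12; [have [] := JE _ iJ|have [] := hB _ iJ].
- move=> S _ [m1 m2 E].
  have e1 : Y1 @^-1` (~` S) = ~` (Y1 @^-1` S) by [].
  have e2 : Y2 @^-1` (~` S) = ~` (Y2 @^-1` S) by [].
  rewrite e1 e2; split; [exact: measurableC m1|exact: measurableC m2|].
  by rewrite (probability_setC P1 m1) (probability_setC P2 m2) E.
- move=> F _ tF h.
  have e1 : Y1 @^-1` (\bigcup_k F k) = \bigcup_k (Y1 @^-1` F k) by exact: preimage_bigcup.
  have e2 : Y2 @^-1` (\bigcup_k F k) = \bigcup_k (Y2 @^-1` F k) by exact: preimage_bigcup.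
  rewrite e1 e2; split.
  + by apply: bigcupT_measurable => n; have [] := h n.
  + by apply: bigcupT_measurable => n; have [] := h n.
  + have t1 : trivIset setT (fun n => Y1 @^-1` F n).
      by apply/trivIsetP => i j _ _ ij; rewrite -preimage_setI; move/trivIsetP : tF => ->//; rewrite preimage_set0.
    have t2 : trivIset setT (fun n => Y2 @^-1` F n).
      by apply/trivIsetP => i j _ _ ij; rewrite -preimage_setI; move/trivIsetP : tF => ->//; rewrite preimage_set0.
    rewrite !measure_semi_bigcup//.
    * by apply: eq_eseriesr => n _; have [] := h n.
    * by move=> n; have [] := h n.
    * by apply: bigcupT_measurable => n; have [] := h n.
    * by move=> n; have [] := h n.
    * by apply: bigcupT_measurable => n; have [] := h n.
Qed.

End JointLaw.

(** * Means of bounded variables *)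

Section Mean.
Context (R : realType) d (O : measurableType d) (P : probability O R).
Implicit Types (h : O -> R) (B : R).

Lemma bounded_prob_integrable h B : measurable_fun setT h -> (forall w, `|h w| <= B) ->
  P.-integrable setT (EFin \o h).
Proof.
move=> mh hB; have PT : (P setT < +oo)%E by rewrite probability_setT ltry.
apply: measurable_bounded_integrable => //.
exists B; split; first exact: num_real.
by move=> x Bx w _; rewrite /= (le_trans (hB w))// ltW.
Qed.

Lemma mean_cst (c : R) : \int[P]_w c = c.
Proof.
rewrite Rintegral_cst// -[RHS]mulr1; congr (_ * _).
exact: (congr1 fine (probability_setT P)).
Qed.

Lemma mean_norm_le h B : measurable_fun setT h -> (forall w, `|h w| <= B) ->
  `|\int[P]_w h w| <= B.
Proof.
move=> mh hB; have ih := bounded_prob_integrable mh hB.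
rewrite (le_trans (le_normr_Rintegral _ ih))// -[leRHS]mean_cst.
apply: le_Rintegral => //.
  by apply: (bounded_prob_integrable (B := B)) => [|w]; [exact: measurableT_comp|rewrite normr_id].
by apply: (bounded_prob_integrable (B := `|B|)) => //; exact: measurable_cst.
Qed.

Lemma mean_sum (I : Type) (s : seq I) (h : I -> O -> R) (B : I -> R) :
  (forall i, measurable_fun setT (h i)) -> (forall i w, `|h i w| <= B i) ->
  \int[P]_w (\sum_(i <- s) h i w) = \sum_(i <- s) \int[P]_w h i w.
Proof.
move=> mh hB; elim: s => [|i s IH].
  by rewrite big_nil; under eq_Rintegral do rewrite big_nil; exact: mean_cst.
rewrite big_cons -IH; under eq_Rintegral do rewrite big_cons.
rewrite RintegralD//; first exact: (bounded_prob_integrable (B := B i)).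
apply: (bounded_prob_integrable (B := \sum_(i <- s) B i)).
  by apply: measurable_sum => //.
by move=> w; rewrite (le_trans (ler_norm_sum _ _ _))// ler_sum.
Qed.

Lemma mean_indic (A : set O) : measurable A -> \int[P]_w \1_A w = fine (P A).
Proof. by move=> mA; rewrite /Rintegral integral_indic// setIT. Qed.

(** The two variables differ by at most [2 * B], and only on [A]. *)
Lemma mean_dist_le h h' B (A : set O) : measurable_fun setT h -> measurable_fun setT h' ->
  (forall w, `|h w| <= B) -> (forall w, `|h' w| <= B) -> measurable A ->
  (forall w, ~ A w -> h w = h' w) ->
  `|\int[P]_w h w - \int[P]_w h' w| <= 2 * B * fine (P A).
Proof.
move=> mh mh' hB hB' mA hA.
have i1 := bounded_prob_integrable mh hB; have i2 := bounded_prob_integrable mh' hB'.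
have B0 : 0 <= B by rewrite (le_trans _ (hB point)).
have md : measurable_fun setT (fun w => h w - h' w) by exact: measurable_funB.
have dB w : `|h w - h' w| <= 2 * B by rewrite mulr_natl mulr2n (le_trans (ler_normB _ _))// lerD.
rewrite -RintegralB//.
rewrite (le_trans (le_normr_Rintegral _ (bounded_prob_integrable md dB)))//.
have mi : measurable_fun setT (\1_A : O -> R) by exact: measurable_indic.
have iB w : `|\1_A w| <= 1 :> R by rewrite indicE normr_nat; case: (w \in A).
rewrite -mean_indic// -RintegralZl//; last exact: bounded_prob_integrable mi iB.
apply: le_Rintegral => //.
- by apply: (bounded_prob_integrable (B := 2 * B)) => [|w]; [exact: measurableT_comp|rewrite normr_id].
- apply: (bounded_prob_integrable (B := 2 * B)) => [|w]; first exact: measurable_funM.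
  by rewrite normrM ger0_norm ?mulr_ge0// ler_piMr// mulr_ge0.
- move=> w _; rewrite indicE; have [wA|wA] := boolP (w \in A); first by rewrite mulr1.
  by rewrite hA ?subrr ?normr0 ?mulr0//; move/negP: wA; rewrite inE.
Qed.

Lemma mean_eq_off_null h h' B (A : set O) : measurable_fun setT h -> measurable_fun setT h' ->
  (forall w, `|h w| <= B) -> (forall w, `|h' w| <= B) -> measurable A -> P A = 0%E ->
  (forall w, ~ A w -> h w = h' w) ->
  \int[P]_w h w = \int[P]_w h' w.
Proof.
move=> mh mh' hB hB' mA PA hA; apply/eqP; rewrite -subr_eq0 -normr_le0.
by rewrite (le_trans (mean_dist_le mh mh' hB hB' mA hA))// PA mulr0.
Qed.

(** By independence, the law of the variable under [P] restricted to [A] is [P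
    A] times its law under [P]. *)
Lemma mean_indep_ge0 h B (A : set O) : measurable_fun setT h -> (forall w, `|h w| <= B) ->
  (forall w, 0 <= h w) -> measurable A ->
  (forall C, measurable C -> P (A `&` h @^-1` C) = (P A * P (h @^-1` C))%E) ->
  \int[P]_w (\1_A w * h w) = fine (P A) * \int[P]_w h w.
Proof.
move=> mh hB h0 mA ind.
have PA : P A \is a fin_num by exact: fin_num_measure.
have r0 : 0 <= fine (P A) by exact: fine_ge0.
pose r := NngNum r0; have rE : (r%:num)%:E = P A by rewrite fineK.
have ih := bounded_prob_integrable mh hB.
pose Q : {measure set O -> \bar R} := mrestr P mA.
have Qoo : (Q setT < +oo)%E.
  by change (P (setT `&` A) < +oo)%E; rewrite setTI ltey_eq PA.
have iQ : Q.-integrable setT (EFin \o h).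
  apply: measurable_bounded_integrable => //.
  exists B; split; first exact: num_real.
  by move=> x Bx w _; rewrite /= (le_trans (hB w))// ltW.
have mE : measurable_fun setT (EFin \o h) by exact/measurable_EFinP.
have e1 : (\int[P]_w (\1_A w * h w)%:E = \int[P]_(w in A) (h w)%:E)%E.
  rewrite [RHS]integral_mkcond; apply: eq_integral => w _.
  by rewrite patchE indicE; case: ifP => _; rewrite ?mul1r ?mul0r.
have e2 : (\int[P]_(w in A) (h w)%:E = \int[Q]_(w in A) (h w)%:E)%E.
  by apply: eq_measure_integral => S mS SA; change (P S = P (S `&` A)); rewrite setIidl.
have e3 : (\int[Q]_(w in A) (h w)%:E = \int[Q]_w (h w)%:E)%E.
  have mCA : measurable (~` A) by exact: measurableC.
  rewrite [RHS](@negligible_integral _ O R Q setT (~` A))//; last first.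
    by change (P (~` A `&` A) = 0%E); rewrite setICl measure0.
  by rewrite setTD setCK.
pose m0 (y : R) := (Num.max y 0)%:E.
have mm0 : measurable_fun setT m0.
  by apply/measurable_EFinP; apply: measurable_maxr => //; exact: measurable_cst.
have hm0 : (fun w => (h w)%:E) = m0 \o h.
  by apply/funext => w; rewrite /m0/= max_l.
have m00 y : (0 <= m0 y)%E by rewrite lee_fin le_max lexx orbT.
have e4 : (\int[Q]_w (h w)%:E = \int[mscale r (pushforward P h)]_y m0 y)%E.
  transitivity (\int[pushforward Q h]_y m0 y)%E.
    by rewrite hm0 (@ge0_integral_pushforward _ _ _ _ R h mh Q setT m0).
  apply: eq_measure_integral => S mS _.
  have E := ind S mS; rewrite setIC -rE in E; exact: E.
rewrite /Rintegral e1 e2 e3 e4 ge0_integral_mscale//.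
rewrite ge0_integral_pushforward// -hm0 fineM//.
by rewrite preimage_setT; exact: integrable_fin_num ih.
Qed.

(** Adding the bound [B] reduces to the nonnegative case. *)
Lemma mean_indep h B (A : set O) : measurable_fun setT h -> (forall w, `|h w| <= B) ->
  measurable A ->
  (forall C, measurable C -> P (A `&` h @^-1` C) = (P A * P (h @^-1` C))%E) ->
  \int[P]_w (\1_A w * h w) = fine (P A) * \int[P]_w h w.
Proof.
move=> mh hB mA ind.
have ih := bounded_prob_integrable mh hB.
have iBB : P.-integrable setT (EFin \o (fun=> B)).
  by apply: (bounded_prob_integrable (B := `|B|)) => //; exact: measurable_cst.
have m1 : measurable_fun setT (\1_A : O -> R) by exact: measurable_indic.
have b1 w : `|\1_A w| <= 1 :> R by rewrite indicE normr_nat; case: (w \in A).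
have B0 : 0 <= B by rewrite (le_trans _ (hB point)).
have mhB : measurable_fun setT (fun w => h w + B).
  by apply: measurable_funD => //; exact: measurable_cst.
have := @mean_indep_ge0 (fun w => h w + B) (2 * B) A mhB _ _ mA.
rewrite RintegralD// mean_cst mulrDr => H.
have := H _ _ _; rewrite (_ : (fun w => \1_A w * (h w + B)) = (fun w => \1_A w * h w + \1_A w * B)); last first.
  by apply/funext => w; rewrite mulrDr.
rewrite RintegralD//; last 2 first.
- apply: (bounded_prob_integrable (B := B)) => [|w]; first exact: measurable_funM.
  by rewrite normrM -[B]mul1r ler_pM.
- apply: (bounded_prob_integrable (B := B)) => [|w].
    by apply: measurable_funM => //; exact: measurable_cst.
  by rewrite normrM (ger0_norm B0) ler_piMl.
rewrite RintegralZr//; last exact: bounded_prob_integrable m1 b1.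
rewrite mean_indic// => H'; apply: (addIr (fine (P A) * B)); apply: H'.
- by move=> w; rewrite mulr_natl mulr2n (le_trans (ler_normD _ _))// lerD// ger0_norm.
- by move=> w; have := hB w; rewrite ler_norml -lerBlDr sub0r => /andP[].
- move=> C mC.
  have -> : (fun w => h w + B) @^-1` C = h @^-1` ((fun y => y + B) @^-1` C) by [].
  apply: ind; rewrite -[X in measurable X]setTI; apply: measurable_funD => //; exact: measurable_cst.
Qed.

Lemma fine_prob_le (A B : set O) : measurable A -> measurable B -> A `<=` B ->
  fine (P A) <= fine (P B).
Proof.
move=> mA mB AB; apply: fine_le; [exact: fin_num_measure|exact: fin_num_measure|].
by apply: le_measure; rewrite ?inE.
Qed.

Lemma fine_prob_le_sum (I : eqType) (s : seq I) (A : set O) (E : I -> set O) :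
  measurable A -> (forall i, measurable (E i)) ->
  (forall w, A w -> exists2 i, i \in s & E i w) ->
  fine (P A) <= \sum_(i <- s) fine (P (E i)).
Proof.
move=> mA mE; elim: s A mA => [|i s IH] A mA AE.
  suff -> : A = set0 by rewrite measure0 big_nil.
  by apply/seteqP; split => // w /AE[].
have mAD : measurable (A `\` E i) by exact: measurableD.
have h := IH _ mAD _.
rewrite big_cons; apply: (@le_trans _ _ (fine (P (E i) + P (A `\` E i))%E)).
  apply: fine_le; [exact: fin_num_measure|by rewrite fin_numD !fin_num_measure|].
  apply: le_trans (measureU2 P (mE i) mAD).
  apply: le_measure; rewrite ?inE//; first exact: measurableU.
  by move=> w Aw; have [?|?] := pselect (E i w); [left|right].
rewrite fineD ?fin_num_measure// lerD2l; apply: h => w [Aw nE].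
by have [j] := AE _ Aw; rewrite inE => /orP[/eqP ->//|js Ej]; exists j.
Qed.

End Mean.

Lemma mean_same_law (R : realType) d1 d2 (O1 : measurableType d1) (O2 : measurableType d2)
    (P1 : probability O1 R) (P2 : probability O2 R) (U : O1 -> R) (V : O2 -> R) (g : R -> R) (B : R) :
  measurable_fun setT U -> measurable_fun setT V ->
  (forall C, measurable C -> P1 (U @^-1` C) = P2 (V @^-1` C)) ->
  measurable_fun setT g -> (forall x, `|g x| <= B) ->
  \int[P1]_w g (U w) = \int[P2]_w g (V w).
Proof.
move=> mU mV UV mg gB; rewrite /Rintegral; congr fine.
have iU := bounded_prob_integrable P1 (measurableT_comp mg mU) (fun w => gB (U w)).
have iV := bounded_prob_integrable P2 (measurableT_comp mg mV) (fun w => gB (V w)).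
have mgE : measurable_fun setT (EFin \o g) by exact/measurable_EFinP.
transitivity (\int[pushforward P1 U]_y (g y)%:E)%E.
  by rewrite (@integral_pushforward _ _ _ _ R U mU P1 setT (EFin \o g)).
transitivity (\int[pushforward P2 V]_y (g y)%:E)%E; last first.
  by rewrite (@integral_pushforward _ _ _ _ R V mV P2 setT (EFin \o g)).
by apply: eq_measure_integral => C mC _; exact: UV.
Qed.

(** * From the random matrix to its cycle counts *)

Lemma mutual_independence_sub (R : realType) d (O : measurableType d) (P : probability O R)
    (I : choiceType) (D D' : set I) (F F' : I -> set (set O)) :
  D' `<=` D -> (forall i, D' i -> F' i `<=` F i) ->
  mutual_independence P D F -> mutual_independence P D' F'.
Proof.
move=> DD FF ind J A JA; apply: ind => i iJ; have [Di Fi] := JA i iJ.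
by split; [exact: DD|exact: FF].
Qed.

(** A special case of the grouping of blocks, with singletons. *)
Lemma mutual_independence_reindex (R : realType) d (O : measurableType d) (P : probability O R)
    (I K : choiceType) (D : set I) (D' : set K) (F : I -> set (set O)) (e : K -> I) :
  mutual_independence P D F ->
  (forall i, D i -> setI_closed (F i)) -> (forall i, D i -> F i `<=` measurable) ->
  (forall k, D' k -> D (e k)) -> (forall k l, D' k -> D' l -> e k = e l -> k = l) ->
  mutual_independence P D' (fun k => F (e k)).
Proof.
move=> ind FI Fm eD einj.
apply: (@mutual_independence_sub _ _ _ _ _ D' D' (fun k => <<s \bigcup_(i in [set e k]) F i >>)) => //.
  by move=> k _ A FA; apply: sub_sigma_algebra; exists (e k).
apply: (mutual_independence_blocks ind FI Fm).
  by move=> k /eD ek _ ->.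
move=> k l Dk Dl kl; apply/seteqP; split => // i [-> /einj]; move=> /(_ Dk Dl)/eqP.
by rewrite (negbTE kl).
Qed.

(** A product is a measurable function of the joint law of its factors. *)
Lemma mean_products (R : realType) d1 d2 (O1 : measurableType d1) (O2 : measurableType d2)
    (P1 : probability O1 R) (P2 : probability O2 R) k
    (X1 : 'I_k -> O1 -> R[i]) (X2 : 'I_k -> O2 -> R[i]) (L : set R[i] -> \bar R) :
  (forall i, measurable_fun setT (X1 i)) -> (forall i, measurable_fun setT (X2 i)) ->
  mutual_independence P1 setT (fun i => events (X1 i)) ->
  mutual_independence P2 setT (fun i => events (X2 i)) ->
  (forall i, has_law P1 (X1 i) L) -> (forall i, has_law P2 (X2 i) L) ->
  forall A, measurable A ->
  P1 ((fun w => \prod_i X1 i w) @^-1` A) = P2 ((fun w => \prod_i X2 i w) @^-1` A).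
Proof.
move=> m1 m2 i1 i2 l1 l2 A mA.
pose G := \bigcup_(i in [set: 'I_k]) @coord_events _ R[i] 'I_k i.
pose g (x : g_sigma_algebraType G) := \prod_(i : 'I_k) (x : 'I_k -> R[i]) i.
have mg : measurable_fun setT g.
  apply: measurable_complex_prod => i _ B mB; rewrite setTI.
  by apply: sub_sigma_algebra; exists i => //; exists B => //; rewrite setTI.
have := @joint_law_eq R _ _ _ O1 O2 R[i] P1 P2 'I_k setT X1 X2 (fun i _ => m1 i) (fun i _ => m2 i) i1 i2.
move=> /(_ _ (g @^-1` A)); apply; first by move=> i B _ mB; rewrite l1// l2.
by rewrite -[X in <<s _ >> X]setTI; apply: mg.
Qed.

Section CycleRank.
Context (N : nat) (t : 'S_N).
Implicit Types (c : {set 'I_N}).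

Definition cycles_of_size (k : nat) : seq {set 'I_N} :=
  [seq c : {set 'I_N} <- enum (porbits t) | #|c| == k].

(** Ranking the cycles of each length attaches to every cycle its own pair
    [(k, p)], hence its own variable [T k p.+1]. *)
Definition cycle_rank (c : {set 'I_N}) := index c (cycles_of_size #|c|).

Lemma size_cycles_of_size k : size (cycles_of_size k) = cycle_count t k.
Proof.
rewrite size_filter /cycle_count -sum1_count big_mkcond big_enum/=.
by apply: eq_bigr => c _; case: eqP.
Qed.

Lemma cycle_rank_inj c c' : c \in porbits t -> c' \in porbits t ->
  #|c| = #|c'| -> cycle_rank c = cycle_rank c' -> c = c'.
Proof.
rewrite /cycle_rank => cP c'P cc; rewrite -cc => E.
have cin : c \in cycles_of_size #|c| by rewrite mem_filter eqxx mem_enum.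
have c'in : c' \in cycles_of_size #|c| by rewrite mem_filter cc eqxx mem_enum.
by rewrite -(nth_index c cin) E nth_index.
Qed.

Lemma sum_cycles (V : nmodType) (F : nat -> nat -> V) :
  \sum_(c in porbits t) F #|c| (cycle_rank c) =
  \sum_(k < N) \sum_(p < cycle_count t k.+1) F k.+1 p.
Proof.
have cN c : c \in porbits t -> (0 < #|c| <= N)%N.
  case/imsetP => x _ ->; apply/andP; split; last by rewrite -[X in (_ <= X)%N]card_ord max_card.
  by rewrite card_gt0; apply/set0Pn; exists x; exact: porbit_id.
transitivity (\sum_(k < N) \sum_(c in porbits t | #|c| == k.+1) F #|c| (cycle_rank c)).
  rewrite [LHS](eq_bigr (fun c => \sum_(k < N | #|c| == k.+1) F #|c| (cycle_rank c))).
    by rewrite (exchange_big_dep xpredT).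
  move=> c /cN; case cE : #|c| => [|k]// kN.
  rewrite (bigD1 (Ordinal kN))//= big1 ?addr0// => l /andP[/eqP[kl]] /eqP; case; exact: val_inj.
apply: eq_bigr => k _; rewrite -size_cycles_of_size.
transitivity (\sum_(c <- cycles_of_size k.+1) F k.+1 (index c (cycles_of_size k.+1))).
  rewrite big_filter -big_enum_cond/=.
  by apply: eq_bigr => c /eqP cE; rewrite /cycle_rank cE.
have ul : uniq (cycles_of_size k.+1) by rewrite filter_uniq// enum_uniq.
rewrite (big_nth (finset.set0 : {set 'I_N})) big_mkord; apply: eq_bigr => p _.
by rewrite index_uniq.
Qed.

End CycleRank.

Section EwensMatrix.
Context (R : realType) (theta : R) (L : probability R[i] R).
Context (L_Cstar : L [set z | z != 0] = 1%E).
Context d (O : measurableType d) (P : probability O R) (T : nat -> nat -> {RV P >-> R[i]}).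
Context (T_ind : mutual_independence P [set kp : nat * nat | (1 <= kp.1)%N && (1 <= kp.2)%N]
  (fun kp => events (T kp.1 kp.2))).
Context (T_law : forall k p, (1 <= k)%N -> (1 <= p)%N -> law_of_product L k P (T k p)).
Context (f : R[i] -> R) (f_cont : continuous f).

(** The linear statistic of [f] for a permutation with [n k] cycles of length
    [k], when [T k p] stands for the product of the entries along the [p]-th
    of these cycles; cycles longer than [K] are ignored. *)
Definition cycle_sum K (n : nat -> nat) (w : O) : R :=
  \sum_(k < K) \sum_(p < n k.+1) root_sum f k.+1 (T k.+1 p.+1 w).

Let mf : measurable_fun setT f := measurable_continuous_complex f_cont.

Lemma measurable_cycle_sum K n : measurable_fun setT (cycle_sum K n).
Proof.
apply: measurable_sum => k; apply: measurable_sum => p.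
by apply: measurableT_comp => //; apply: measurable_root_sum_XnsubC.
Qed.

Section Model.
Context (N : nat) d' (O' : measurableType d') (P' : probability O' R).
Context (s : {RV P' >-> 'S_N}) (z : 'I_N -> {RV P' >-> R[i]}).
Context (s_law : forall t : 'S_N, P' (s @^-1` [set t]) = (ewens_pmf theta t)%:E).
Context (z_law : forall j, has_law P' (z j) L).
Context (sz_ind : mutual_independence P' setT
  (fun i : option 'I_N => if i is Some j then events (z j) else events s)).

Let F (i : option 'I_N) := if i is Some j then events (z j) else events s.
Let FI i : setT i -> setI_closed (F i).
Proof. by case: i => [j|] _; exact: setI_closed_preimage. Qed.
Let Fm i : setT i -> F i `<=` measurable.
Proof. by case: i => [j|] _; exact: events_measurable. Qed.

Definition eigen_sum (A : 'M[R[i]]_N) : R := \int[eigenvalue_measure A]_x f x.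

Lemma measurable_eigen_perm d0 (O0 : measurableType d0) (t : 'S_N) (y : 'I_N -> O0 -> R[i]) :
  (forall j, measurable_fun setT (y j)) ->
  measurable_fun setT (fun w => eigen_sum (mx_of_perm t (fun j => y j w))).
Proof.
move=> my; apply: measurable_integral_eigenvalue => //.
apply: measurable_mx_of_entries => i j; under eq_fun do rewrite mxE -mulr_natr.
by apply: measurable_complexM => //; exact: measurable_cst.
Qed.

Lemma measurable_perm_mx : measurable_fun setT (fun w => mx_of_perm (s w) (fun j => z j w)).
Proof.
apply: measurable_mx_of_entries => i j; under eq_fun do rewrite mxE -mulr_natr.
apply: measurable_complexM => //.
by apply: (@measurableT_comp _ _ _ _ _ _ (fun t : 'S_N => (i == t j)%:R : R[i]) setT s).
Qed.

Let null_z : set O' := \bigcup_(j in [set: 'I_N]) (z j @^-1` [set 0]).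

Lemma law_neq0 d0 (O0 : measurableType d0) (P0 : probability O0 R) (y : {RV P0 >-> R[i]}) :
  has_law P0 y L -> P0 (y @^-1` [set 0]) = 0%E.
Proof.
move=> yL; rewrite yL; last exact: measurable_set1_complex.
have -> : [set 0] = ~` [set z : R[i] | z != 0].
  by apply/seteqP; split => x /=; [move=> ->; rewrite eqxx|move/negP; rewrite negbK => /eqP].
rewrite probability_setC ?L_Cstar ?subee//.
have -> : [set z : R[i] | z != 0] = ~` [set 0] by apply/seteqP; split => x /= /eqP.
by apply: measurableC; exact: measurable_set1_complex.
Qed.

Let mnull : measurable null_z.
Proof.
apply: fin_bigcup_measurable; first exact: finite_finset.
by move=> j _; rewrite -[X in measurable X]setTI; apply: measurable_funP => //; exact: measurable_set1_complex.
Qed.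

Let Pnull : P' null_z = 0%E.
Proof.
apply/eqP; rewrite -(fineK (fin_num_measure P' _ mnull)) eqe eq_le fine_ge0// andbT.
have mz j : measurable (z j @^-1` [set 0]).
  by rewrite -[X in measurable X]setTI; apply: measurable_funP => //; exact: measurable_set1_complex.
rewrite (le_trans (fine_prob_le_sum P' (s := index_enum 'I_N) mnull mz _))//.
  by move=> w [j _ zj]; exists j => //; exact: mem_index_enum.
by rewrite big1// => j _; rewrite law_neq0.
Qed.

Context (g : R -> R) (B : R) (g_cont : continuous g) (g_bound : forall x, `|g x| <= B).

Let mg : measurable_fun setT g := continuous_measurable_fun g_cont.

(** Conditioning on the permutation, which is independent of the entries. *)
Lemma mean_perm_mx_split :
  \int[P']_w g (eigen_sum (mx_of_perm (s w) (fun j => z j w))) =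
  \sum_(t : 'S_N) ewens_pmf theta t * \int[P']_w g (eigen_sum (mx_of_perm t (fun j => z j w))).
Proof.
pose h t w := g (eigen_sum (mx_of_perm t (fun j => z j w))).
have mh t : measurable_fun setT (h t).
  by apply: (measurableT_comp mg); apply: measurable_eigen_perm.
have ms t : measurable (s @^-1` [set t]).
  by rewrite -[X in measurable X]setTI; apply: measurable_funP.
have mi t : measurable_fun setT (\1_(s @^-1` [set t]) : O' -> R) by exact: measurable_indic.
transitivity (\int[P']_w (\sum_(t : 'S_N) \1_(s @^-1` [set t]) w * h t w)).
  apply: eq_Rintegral => w _; rewrite (bigD1 (s w))//= big1 ?addr0.
    by rewrite indicE mem_set// mul1r.
  by move=> t ts; rewrite indicE memNset ?mul0r//= => E; rewrite E eqxx in ts.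
rewrite (@mean_sum _ _ _ P' _ _ _ (fun=> B)); last 2 first.
- by move=> t; exact: measurable_funM.
- move=> t w; rewrite normrM indicE; have B0 : 0 <= B by rewrite (le_trans _ (g_bound 0)).
  by case: (_ \in _); rewrite ?mulr1n ?mulr0n ?normr1 ?mul1r ?normr0 ?mul0r //; exact: g_bound.
apply: eq_bigr => t _; rewrite (mean_indep (mh t) (fun w => g_bound _) (ms t)); first by rewrite s_law.
move=> C mC.
have sT X : (X : set (option 'I_N)) `<=` setT by [].
refine (@indep_blocks _ _ _ P' _ setT F sz_ind FI Fm [set None] (range Some) _ _ (sT _) (sT _) _ _ _).
- by apply/seteqP; split => // i [-> []].
- by apply: sub_sigma_algebra; exists None => //; exact: events_preimage.
- pose G := \bigcup_(i in range (@Some 'I_N)) F i.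
  have mz j : measurable_fun (setT : set (g_sigma_algebraType G)) (z j : g_sigma_algebraType G -> R[i]).
    move=> _ D mD; rewrite setTI; apply: sub_sigma_algebra; exists (Some j); first by exists j.
    exact: events_preimage.
  have mhG : measurable_fun (setT : set (g_sigma_algebraType G)) (h t : g_sigma_algebraType G -> R).
    by apply: (measurableT_comp mg); apply: measurable_eigen_perm.
  by have := mhG measurableT C mC; rewrite setTI.
Qed.

(** Different cycles use disjoint sets of entries, so the products along the
    cycles are independent, each with the law of the corresponding [T k p]:
    the two families have the same joint law. The entries vanish with
    probability 0 only. *)
Lemma mean_perm_mx_cycle_sum (t : 'S_N) :
  \int[P']_w g (eigen_sum (mx_of_perm t (fun j => z j w))) =
  \int[P]_w g (cycle_sum N (cycle_count t) w).
Proof.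
pose V (c : {set 'I_N}) w := \prod_(j in c) z j w.
pose W (x : {set 'I_N} -> R[i]) := \sum_(c in porbits t) root_sum f #|c| (x c).
pose T' (c : {set 'I_N}) w := T #|c| (cycle_rank t c).+1 w.
have cT w : cycle_sum N (cycle_count t) w = W (T'^~ w).
  by rewrite /W /T' (sum_cycles t (fun k p => root_sum f k (T k p.+1 w))).
have c0 c : c \in porbits t -> (0 < #|c|)%N.
  by case/imsetP => x _ ->; rewrite card_gt0; apply/set0Pn; exists x; exact: porbit_id.
pose D := [set c : {set 'I_N} | c \in porbits t].
have mV c : measurable_fun setT (V c).
  rewrite /V; under eq_fun do rewrite big_mkcond; apply: measurable_complex_prod => j.
  by case: (j \in c) => //; exact: measurable_cst.
have mW d0 (O0 : measurableType d0) (X : {set 'I_N} -> O0 -> R[i]) :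
    (forall c, D c -> measurable_fun setT (X c)) -> measurable_fun setT (fun w => W (X^~ w)).
  move=> mX; rewrite /W; under eq_fun do rewrite big_mkcond; apply: measurable_sum => c.
  case: (boolP (c \in porbits t)) => cP; last exact: measurable_cst.
  by apply: measurableT_comp; [exact: measurable_root_sum_XnsubC (c0 _ cP) f_cont|exact: mX].
have ind1 : mutual_independence P' D (fun c => events (V c)).
  pose Bk (c : {set 'I_N}) : set (option 'I_N) := [set i | if i is Some j then j \in c else false].
  have dBk c c' : D c -> D c' -> c != c' -> Bk c `&` Bk c' = set0.
    move=> cP c'P cc'; apply/seteqP; split => // -[j|] [] //=; rewrite /Bk /= => jc jc'.
    case/eqP: cc'; move: jc jc'.
    by rewrite (mem_porbits_eq _ cP) (mem_porbits_eq _ c'P) => /eqP -> /eqP.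
  have Bks c : D c -> Bk c `<=` setT by [].
  have indB := mutual_independence_blocks sz_ind FI Fm Bks dBk.
  apply: (mutual_independence_sub (subset_refl (A := D)) _ indB) => c _ _ [A mA <-].
  pose G := \bigcup_(i in Bk c) F i.
  have mVG : measurable_fun (setT : set (g_sigma_algebraType G)) (V c : g_sigma_algebraType G -> R[i]).
    rewrite /V; under eq_fun do rewrite big_mkcond; apply: measurable_complex_prod => j.
    case: (boolP (j \in c)) => jc; last exact: measurable_cst.
    move=> _ E mE; rewrite setTI; apply: sub_sigma_algebra; exists (Some j) => //.
    exact: events_preimage.
  exact: mVG.
have ind2 : mutual_independence P D (fun c => events (T' c)).
  refine (@mutual_independence_reindex _ _ _ P _ _ _ D _
    (fun c : {set 'I_N} => (#|c|, (cycle_rank t c).+1)) T_ind _ _ _ _).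
  - by move=> i _; exact: setI_closed_preimage.
  - by move=> i _; exact: events_measurable.
  - by move=> c /c0 /= ->.
  - by move=> c c' cP c'P [E1 E2]; exact: cycle_rank_inj E1 E2.
have law12 c A : D c -> measurable A -> P' (V c @^-1` A) = P (T' c @^-1` A).
  move=> cP mA; have [dY [OY [PY [Y [Yind Ylaw TY]]]]] := @T_law #|c| (cycle_rank t c).+1 (c0 _ cP) isT.
  rewrite [RHS]TY// /law.
  have -> : V c = (fun w => \prod_(i < #|c|) z (enum_val i) w).
    by apply/funext => w; rewrite /V big_enum_val.
  apply: (mean_products (L := L)) => //.
  have := mutual_independence_reindex (e := fun i : 'I_#|c| => Some (enum_val i)) (D' := setT) sz_ind FI Fm.
  by apply => // i j _ _ [/enum_val_inj].
have mT' c : D c -> measurable_fun setT (T' c) by [].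
transitivity (\int[P']_w g (W (V^~ w))).
  apply: (mean_eq_off_null (B := B) (A := null_z)) => //.
  - by apply: (measurableT_comp mg); exact: measurable_eigen_perm.
  - by apply: (measurableT_comp mg); exact: mW.
  - move=> w nw; congr g; rewrite /eigen_sum integral_eigenvalue_mx_of_perm//.
    by move=> j; apply/eqP => zj; apply: nw; exists j.
rewrite (@eq_Rintegral _ _ _ P setT (fun w => g (W (T'^~ w)))); last by move=> w _; rewrite cT.
apply: (mean_same_law (B := B)) => //; [exact: mW|exact: mW|move=> C mC].
pose G := \bigcup_(c in D) @coord_events _ R[i] {set 'I_N} c.
have mWG : measurable_fun (setT : set (g_sigma_algebraType G)) (W : g_sigma_algebraType G -> R).
  apply: (mW _ (g_sigma_algebraType G) (fun c (x : {set 'I_N} -> R[i]) => x c)) => c cP _ E mE; rewrite setTI.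
  by apply: sub_sigma_algebra; exists c => //; exists E => //; rewrite setTI.
have := mWG measurableT C mC; rewrite setTI.
exact: (joint_law_eq (fun c _ => mV c) mT' ind1 ind2 law12).
Qed.

End Model.

(** The law of the linear statistic of the random matrix is thus a mixture,
    over the cycle counts of an Ewens permutation, of laws of sums built on
    the space that carries the limit measure. *)
Lemma mean_ewens_matrix N d' (O' : measurableType d') (P' : probability O' R)
    (M : {RV P' >-> 'M[R[i]]_N}) (g : R -> R) (B : R) :
  ewens_mx_law theta L M -> continuous g -> (forall x, `|g x| <= B) ->
  \int[P']_w g (eigen_sum (M w)) =
  ewens_mean theta N (fun n => \int[P]_w g (cycle_sum N n w)).
Proof.
move=> [dz [Oz [Pz [s [z [s_law z_law sz_ind M_law]]]]]] g_cont g_bound.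
transitivity (\int[Pz]_w g (eigen_sum (mx_of_perm (s w) (fun j => z j w)))).
  apply: (@mean_same_law R _ _ O' Oz P' Pz (fun w => eigen_sum (M w))
    (fun w => eigen_sum (mx_of_perm (s w) (fun j => z j w))) g B).
  - exact: (@measurable_integral_eigenvalue R _ O' N (fun w => M w) f f_cont (@measurable_funPT _ _ _ _ M)).
  - exact: (@measurable_integral_eigenvalue R _ Oz N _ f f_cont (measurable_perm_mx s z)).
  - move=> C mC; have mE : measurable ((@eigen_sum N) @^-1` C).
      rewrite -[X in measurable X]setTI.
      by apply: (measurable_integral_eigenvalue f_cont (@measurable_id _ 'M[R[i]]_N setT)).
    exact: (M_law _ mE).
  - exact: continuous_measurable_fun.
  - exact: g_bound.
rewrite (mean_perm_mx_split s_law sz_ind g_cont g_bound) /ewens_mean.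
by apply: eq_bigr => t _; rewrite (mean_perm_mx_cycle_sum z_law sz_ind g_cont g_bound).
Qed.

End EwensMatrix.

(** * Joint limit of finitely many cycle counts *)

Lemma cvg_approx (R : realType) (x : nat -> R) (l : R) :
  (forall e, 0 < e -> exists s S, [/\ s @ \oo --> S,
     \forall n \near \oo, `|x n - s n| <= e & `|l - S| <= e]) ->
  x @ \oo --> l.
Proof.
move=> H; apply/cvgrPdist_le => e e0.
have e3 : 0 < e / 3 by rewrite divr_gt0.
have [s [S [sS xs lS]]] := H _ e3.
move/cvgrPdist_le : sS => /(_ _ e3) sS.
near=> n.
have h1 : `|x n - s n| <= e / 3 by near: n.
have h2 : `|S - s n| <= e / 3 by near: n.
by move: h1 h2 lS; rewrite !ler_norml; lra.
Unshelve. all: by end_near.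
Qed.

Section Truncated.
Context (R : realType) (theta : R) (theta_gt0 : 0 < theta).
Context d (O : measurableType d) (P : probability O R) (a : nat -> {RV P >-> nat}).
Context (I : choiceType) (D : set I) (F : I -> set (set O)) (D0 : set I) (ia : nat -> I).
Context (F_ind : mutual_independence P D F).
Context (FI : forall i, D i -> setI_closed (F i)).
Context (Fm : forall i, D i -> F i `<=` measurable).
Context (ia_inj : injective ia).
Context (D0D : D0 `<=` D).
Context (iaD : forall k, (1 <= k)%N -> D (ia k)).
Context (iaD0 : forall k, ~ D0 (ia k)).
Context (F_ia : forall k, (1 <= k)%N -> F (ia k) = events (a k)).
Context (a_pmf : forall k n, (1 <= k)%N -> P (a k @^-1` [set n]) = (poisson_pmf (theta / k%:R) n)%:E).

Local Notation EN := (ewens_mean theta).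
Local Notation aw w := (fun k => a k w).

Let block K : set I := D0 `|` [set i | exists2 k, (1 <= k <= K)%N & i = ia k].

(** Such a variable is independent of the counts beyond the first [K]. The
    sources [D0] are those independent of all counts. *)
Definition block_measurable K (h : O -> R) :=
  forall C, measurable C -> <<s \bigcup_(i in block K) F i >> (h @^-1` C).

Let blockD K : block K `<=` D.
Proof. by move=> i [/D0D//|[k /andP[k1 _] ->]]; exact: iaD. Qed.

Let blockS K : block K `<=` block K.+1.
Proof. by move=> i [?|[k /andP[k1 kK] ->]]; [left|right; exists k => //; rewrite k1 leqW]. Qed.

Lemma block_measurableW K h : block_measurable K h -> measurable_fun setT h.
Proof.
move=> hm _ C mC; rewrite setTI; have := hm C mC.
apply: smallest_sub; first exact: sigma_algebra_measurable.
by move=> A [i /blockD Di]; exact: Fm.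
Qed.

Lemma measurable_count_eq k j : measurable (a k @^-1` [set j]).
Proof. by rewrite -[X in measurable X]setTI; apply: measurable_funP. Qed.

Lemma measurable_count_ge k j : measurable [set w | (j <= a k w)%N].
Proof. by rewrite -[X in measurable X]setTI; apply: (measurable_funP (a k) measurableT [set n | (j <= n)%N]). Qed.

Lemma count_ge_small k e : 0 < e -> exists J, forall j, (J <= j)%N -> fine (P [set w | (j <= a k w)%N]) <= e.
Proof.
move=> e0; pose E j := [set w | (j <= a k w)%N].
have mE j : measurable (E j) by exact: measurable_count_ge.
have capE : \bigcap_j E j = set0.
  by apply/seteqP; split => // w h; have := h (a k w).+1 Logic.I; rewrite /E/= ltnn.
have := @nonincreasing_cvg_mu _ O R P E _ mE _ _.
rewrite capE measure0 => /(_ _ measurable0 _).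
have h1 : (P (E 0%N) < +oo)%E by rewrite (le_lt_trans (probability_le1 P (mE _)))// ltry.
have h2 : nonincreasing_seq E.
  by move=> i j ij; apply/subsetPset => w; rewrite /E/=; exact: leq_trans.
move=> /(_ h1 h2) /fine_cvgP[_] /cvgrPdist_le /(_ _ e0) [J _ HJ].
exists J => j Jj; have := HJ j Jj; rewrite /= sub0r normrN; apply: le_trans; exact: ler_norm.
Qed.

Definition set_coord (k j : nat) (n : nat -> nat) : nat -> nat := fun x => if x == k then j else n x.

(** By induction on [K], splitting along the value [j] of the count of cycles
    of length [K.+1]. For permutations the factor [poisson_pmf] of [j] comes
    out in the limit by [cvg_ewens_mean_eq], for the Poisson variables it
    comes out by independence. Large values of [j] are negligible on both
    sides. *)
Lemma cvg_truncated K (H : (nat -> nat) -> O -> R) (B : R) :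
  (forall n w, `|H n w| <= B) -> (forall n, block_measurable 0 (H n)) ->
  (forall n n', (forall k, (1 <= k <= K)%N -> n k = n' k) -> H n = H n') ->
  block_measurable K (fun w => H (aw w) w) /\
  (fun N => EN N (fun n => \int[P]_w H n w)) @ \oo --> \int[P]_w H (aw w) w.
Proof.
elim: K H => [|K IH] H HB Hm HK.
  have HE n : H n = H (fun=> 0%N) by apply: HK => k /andP[k1]; rewrite leqNgt k1.
  split; first by move=> C mC; have := Hm (fun=> 0%N) C mC; rewrite (_ : H (fun=> 0%N) = fun w => H (aw w) w) //; apply/funext => w; rewrite [in RHS]HE.
  rewrite (_ : (fun N => _) = (fun=> \int[P]_w H (fun=> 0%N) w)); last first.
    by apply/funext => N; under eq_fun do rewrite HE; rewrite ewens_mean_cst.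
  rewrite (_ : \int[P]_w H (aw w) w = \int[P]_w H (fun=> 0%N) w); first exact: cvg_cst.
  by apply: eq_Rintegral => w _; rewrite HE.
pose Hj j n := H (set_coord K.+1 j n).
have HjB j n w : `|Hj j n w| <= B by exact: HB.
have Hjm j n : block_measurable 0 (Hj j n) by exact: Hm.
have HjK j n n' : (forall k, (1 <= k <= K)%N -> n k = n' k) -> Hj j n = Hj j n'.
  move=> nn; apply: HK => k /andP[k1 kK]; rewrite /set_coord; case: eqP => // kK'.
  by apply: nn; rewrite k1 -ltnS ltn_neqAle kK andbT; apply/eqP.
have IHj j := IH (Hj j) (HjB j) (Hjm j) (HjK j).
have HE n : H n = Hj (n K.+1) n.
  by congr H; apply/funext => x; rewrite /set_coord; case: eqP => [->|].
have mHj j n : measurable_fun setT (Hj j n) by exact: block_measurableW (Hjm j n).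
have mHn n : measurable_fun setT (H n) by exact: block_measurableW (Hm n).
have mHja j : measurable_fun setT (fun w => Hj j (aw w) w) by exact: block_measurableW (IHj j).1.
have Ha : block_measurable K.+1 (fun w => H (aw w) w).
  move=> C mC; pose G := \bigcup_(i in block K.+1) F i.
  rewrite (_ : _ @^-1` C = \bigcup_j (a K.+1 @^-1` [set j] `&` (fun w => Hj j (aw w) w) @^-1` C)); last first.
    apply/seteqP; split=> [w /= Cw|w [j _ [/= <-]]]; last by rewrite -HE.
    by exists (a K.+1 w) => //; split => //=; rewrite -HE.
  apply: (@bigcupT_measurable _ (g_sigma_algebraType G)) => j.
  apply: (@measurableI _ (g_sigma_algebraType G)).
    apply: sub_sigma_algebra; exists (ia K.+1); first by right; exists K.+1 => //; rewrite leqnn.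
    by rewrite F_ia//; exact: events_preimage.
  have := (IHj j).1 C mC; apply: sub_sigma_algebra2 => A [i iK FA]; exists i => //; exact: blockS.
split=> //.
have mHa : measurable_fun setT (fun w => H (aw w) w) by exact: block_measurableW Ha.
have B0 : 0 <= B by rewrite (le_trans _ (HB (fun=> 0%N) point)).
apply: cvg_approx => e e0.
pose c := theta / K.+1%:R * (K.+2%:R * (1 + theta^-1)).
have c0 : 0 <= c by rewrite mulr_ge0 ?divr_ge0 ?mulr_ge0 ?addr_ge0 ?invr_ge0// ltW.
have e'0 : 0 < e / (2 * B + 1) by rewrite divr_gt0// ltr_wpDl// mulr_ge0.
have [J1 HJ1] := count_ge_small K.+1 e'0.
(* [J1] handles the Poisson count; the other bound makes B * c / J <= e, which is
   Markov's inequality for the count of a permutation, of mean at most [c]. *)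
pose J := maxn J1 (Num.truncn (B * c / e)).+1.
have J0 : 0 < J%:R :> R by rewrite ltr0n /J leq_max orbT.
have Je : B / J%:R * c <= e.
  rewrite mulrAC ler_pdivrMr// [e * _]mulrC -ler_pdivrMr//.
  have h1 : B * c / e <= (Num.truncn (B * c / e)).+1%:R by rewrite ltW// truncnS_gt.
  have h2 : (Num.truncn (B * c / e)).+1%:R <= J%:R :> R by rewrite ler_nat leq_maxr.
  exact: le_trans h1 h2.
have tail : fine (P [set w | (J <= a K.+1 w)%N]) <= e / (2 * B + 1) by apply: HJ1; rewrite leq_maxl.
have mi j : measurable_fun setT (\1_(a K.+1 @^-1` [set j]) : O -> R).
  exact: measurable_indic (measurable_count_eq _ _).
pose h' w := \sum_(j < J) \1_(a K.+1 @^-1` [set nat_of_ord j]) w * Hj j (aw w) w.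
have h'E w : h' w = (a K.+1 w < J)%N%:R * H (aw w) w.
  rewrite /h'; case: (ltnP (a K.+1 w) J) => aJ.
    rewrite (bigD1 (Ordinal aJ))//= big1 ?addr0.
      by rewrite indicE mem_set// -HE.
    move=> j /eqP ja; rewrite indicE memNset ?mul0r//= => E; apply: ja; exact: val_inj.
  rewrite mul0r big1// => j _; rewrite indicE memNset ?mul0r//= => E.
  by have := ltn_ord j; rewrite -E ltnNge aJ.
exists (fun N => \sum_(j < J) EN N (fun n => (n K.+1 == j)%:R * \int[P]_w Hj j n w)).
exists (\sum_(j < J) poisson_pmf (theta / K.+1%:R) j * \int[P]_w Hj j (aw w) w); split.
- apply: cvg_big => [|j _]; first exact: add_continuous.
  apply: (@cvg_ewens_mean_eq R theta theta_gt0 K.+1 j _ B) => //.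
  + apply/funext => n /=; congr (Rintegral _ _ _); congr H; apply/funext => x.
    by rewrite /set_coord /incr; case: eqP => // _; rewrite addn0.
  + by move=> n; apply: mean_norm_le.
  + exact: (IHj j).2.
- apply: nearW => N; rewrite -ewens_mean_sum.
  have -> : EN N (fun n => \int[P]_w H n w) - EN N (fun n => \sum_(j < J) (n K.+1 == j)%:R * \int[P]_w Hj j n w)
      = EN N (fun n => (J <= n K.+1)%N%:R * \int[P]_w H n w).
    rewrite -[X in _ + X]mulN1r -ewens_meanZ// -ewens_meanD//; congr ewens_mean; apply/funext => n.
    case: (leqP J (n K.+1)) => nJ.
      rewrite mul1r big1 ?mulr0 ?addr0// => j _; case: eqP => [E|_]; rewrite ?mul0r//.
      by have := ltn_ord j; rewrite -E ltnNge nJ.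
    rewrite mul0r (bigD1 (Ordinal nJ))//= eqxx mul1r big1 ?addr0; first by rewrite -HE mulN1r subrr.
    move=> j jn; case: eqP => [E|_]; rewrite ?mul0r//.
    by case/eqP: jn; apply: val_inj; rewrite /= E.
  rewrite (@le_trans _ _ (EN N (fun n => B / J%:R * (n K.+1)%:R)))//.
    apply: ewens_mean_norm_le => // t; rewrite normrM mulrC mulrAC -mulrA.
    apply: ler_pM => //; first exact: mean_norm_le.
    case: (leqP J _) => nJ; rewrite ?normr1 ?normr0 ?divr_ge0//.
    by rewrite ler_pdivlMr// mul1r ler_nat.
  rewrite ewens_meanZ// ewens_mean_countE// (le_trans _ Je)// ler_wpM2l ?divr_ge0//.
  have th0 : 0 <= theta / K.+1%:R by rewrite divr_ge0// ltW.
  exact: (ler_wpM2l th0 (weight_ratio_le theta_gt0 N K.+1)).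
- have -> : \sum_(j < J) poisson_pmf (theta / K.+1%:R) j * \int[P]_w Hj j (aw w) w = \int[P]_w h' w.
    rewrite /h' (@mean_sum _ _ _ P _ _ _ (fun=> B)); last 2 first.
    + by move=> j; exact: measurable_funM.
    + move=> j w; rewrite normrM indicE.
      by case: (_ \in _); rewrite ?mulr1n ?mulr0n ?normr1 ?normr0 ?mul1r ?mul0r.
    apply: eq_bigr => j _.
    rewrite (mean_indep (mHja j) (fun w => HjB _ _ _) (measurable_count_eq _ _)).
      by rewrite a_pmf.
    move=> C mC; apply: (@indep_blocks _ _ _ P _ D F F_ind FI Fm [set ia K.+1] (block K)) => //.
    + by move=> i ->; exact: iaD.
    + apply/seteqP; split => // i [-> [/iaD0//|[k /andP[_ kK] /ia_inj E]]].
      by rewrite -E ltnn in kK.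
    + apply: sub_sigma_algebra; exists (ia K.+1) => //.
      by rewrite F_ia//; exact: events_preimage.
    + exact: (IHj j).1.
  rewrite (le_trans (mean_dist_le P (B := B) (A := [set w | (J <= a K.+1 w)%N]) _ _ _ _ _ _))//.
  + apply: measurable_sum => j; exact: measurable_funM.
  + move=> w; rewrite h'E; case: (_ < _)%N; rewrite ?mul1r ?mul0r ?normr0//.
  + exact: measurable_count_ge.
  + by move=> w /= /negP; rewrite -ltnNge h'E => ->; rewrite mul1r.
  + rewrite (le_trans (ler_wpM2l _ tail)) ?mulr_ge0//.
    rewrite mulrA ler_pdivrMr ?ltr_wpDl ?mulr_ge0//.
    rewrite [leLHS]mulrC; apply: ler_wpM2l; [exact: ltW|by rewrite lerDl].
Qed.

End Truncated.

(** * The annulus around the circle and a convergent series *)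

Section Annulus.
Local Open Scope complex_scope.
Context (R : realType).

Lemma normc_real (s : R) (z : R[i]) : 0 <= s -> normc (s%:C * z) = s * normc z.
Proof. by move=> s0; rewrite normcM /= expr0n addr0 sqrtr_sqr ger0_norm. Qed.

(** For every point of the circle, [f] vanishes at its multiples by the real
    numbers close enough to 1; by compactness, how close can be chosen
    uniformly. *)
Lemma vanishing_annulus (f : R[i] -> R) (m : R) :
  set_nbhs [set z | normc z = expR m] [set z | f z = 0] ->
  exists2 e : R, 0 < e & forall z, z != 0 -> `|ln (normc z) - m| < e -> f z = 0.
Proof.
move=> fr; pose r := expR m; have r0 : 0 < r := expR_gt0 m.
pose K : set (R * R) := `[- r, r] `*` `[- r, r].
have cK : compact K by apply: compact_setX; exact: segment_compact.
have cphi : continuous (fun v : R * R => v.1 +i* v.2).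
  by apply: continuous_complex => v /=; [exact: cvg_fst|exact: cvg_snd].
have cnormc : continuous (fun v : R * R => normc (v.1 +i* v.2)).
  move=> v /=; apply: (@continuous_comp _ _ _ (fun v : R * R => v.1 ^+ 2 + v.2 ^+ 2) Num.sqrt); last exact: sqrt_continuous.
  by apply: cvgD; apply: cvgM; (exact: cvg_fst || exact: cvg_snd).
have cpsi : continuous (fun v : (R * R) * R => (v.2 * v.1.1) +i* (v.2 * v.1.2)).
  apply: continuous_complex => v /=; apply: cvgM; try exact: cvg_snd.
    by apply: (@continuous_comp _ _ _ fst fst); exact: cvg_fst.
  by apply: (@continuous_comp _ _ _ fst snd); [exact: cvg_fst|exact: cvg_snd].
(* The circle sits in the compact square [K]; at the other points of the square
   the condition [P] is void, also in a neighborhood of them. *)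
pose P (s : R) (v : R * R) := normc (v.1 +i* v.2) = r -> f ((s * v.1) +i* (s * v.2)) = 0.
have /(compact_near_coveringP K)/(_ R (nbhs (1 : R)) P (nbhs_filter _)) H := cK.
have {}H : \forall s \near (1 : R), K `<=` P s.
  apply: H => v Kv; have [vr|vr] := eqVneq (normc (v.1 +i* v.2)) r; last first.
    have h : \forall v' \near v, normc (v'.1 +i* v'.2) != r.
      apply: (cnormc v [set x | x != r]); exact: open_nbhs_nbhs (conj (@open_neq _ r) vr).
    exists ([set v : R * R | normc (v.1 +i* v.2) != r], setT); [by split; [exact: h|exact: filterT]|].
    by move=> [v' s] [] /= /eqP ne _ /ne.
  have h1 : nbhs ((1 * v.1) +i* (1 * v.2)) [set z | f z = 0].
    by rewrite !mul1r; exact: fr.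
  have [[A B] [/= vA B1] AB] := cpsi (v, 1) _ h1.
  by exists (A, B) => // -[v' s] /AB /= h' _.
have he : (fun t : R => expR t) @ (0 : R) --> (1 : R) by rewrite -expR0; exact: continuous_expR.
have /he : nbhs (1 : R) [set s | K `<=` P s] by exact: H.
move=> /nbhs_ballP[e /= e0 eP]; exists e => // z z0 ze.
have nz := normc_gt0 z0.
set t := ln (normc z) - m in ze.
have zE : normc z = expR t * r by rewrite /t /r -expRD subrK lnK.
have : ball 0 e t by rewrite /ball/= sub0r normrN.
move=> /eP /= h; pose x := expR (- t) * Re z; pose y := expR (- t) * Im z.
have nr : normc (x +i* y) = r.
  have -> : x +i* y = (expR (- t))%:C * z by case: (z) @x @y => u v; simpc.
  by rewrite normc_real ?expR_ge0// zE mulrA -expRD addNr expR0 mul1r.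
have := h (x, y); rewrite /P/= /x /y !mulrA -!expRD subrr expR0 !mul1r => /(_ _ _).
have -> : Re z +i* Im z = z by case: (z).
apply => //; split => /=; rewrite in_itv/= -ler_norml -nr.
  exact: (Re_le_normc (x +i* y)).
exact: (Im_le_normc (x +i* y)).
Qed.

Lemma root_sum_eq0 (h : R[i] -> R) k t : (0 < k)%N ->
  (forall x, x ^+ k = t -> h x = 0) -> root_sum h k t = 0.
Proof.
move=> k0 h0; have [//|/(root_sum_neq0 k0)[x [/h0 ->]]] := eqVneq (root_sum h k t) 0.
by rewrite eqxx.
Qed.

(** All roots [x] of [t] satisfy log|x| = (log|t|) / k. *)
Lemma roots_in_annulus (h : R[i] -> R) m e k t : (0 < k)%N ->
  (forall z, z != 0 -> `|ln (normc z) - m| < e -> h z = 0) ->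
  t != 0 -> `|k%:R^-1 * ln (normc t) - m| < e -> forall x, x ^+ k = t -> h x = 0.
Proof.
move=> k0 he t0 te x xk.
have x0 : x != 0 by apply: contra t0 => /eqP x0; rewrite -xk x0 expr0n gtn_eqF.
have nx := normc_gt0 x0.
apply: he => //; move: te.
have -> : ln (normc t) = k%:R * ln (normc x).
  rewrite -xk mulr_natl -lnXn//; congr ln.
  by elim: (k) => [|j IH]; rewrite ?expr0 ?normc1// !exprS normcM IH.
by rewrite mulKf ?pnatr_eq0 -?lt0n.
Qed.

End Annulus.

Section PowerSum.
Context (R : realType).

(** This is the mean value inequality for x^(-q), which compares the series of
    k^(-1-q) with a telescoping one. It follows from the convexity of the
    exponential and the concavity of the logarithm. *)
Lemma powR_telescope (q : R) (k : nat) : 0 < q ->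
  q * (k.+2%:R `^ (- q) / k.+2%:R) <= k.+1%:R `^ (- q) - k.+2%:R `^ (- q).
Proof.
move=> q0; have k1 : 0 < k.+1%:R :> R by []. have k2 : 0 < k.+2%:R :> R by [].
rewrite lerBrDr mulrCA -[X in _ + X <= _]mulr1 -mulrDr.
have -> : k.+1%:R `^ (- q) = k.+2%:R `^ (- q) * expR (- q * ln (1 - k.+2%:R^-1)).
  rewrite /powR !gt_eqF// -expRD -mulrDr; congr (expR (_ * _)).
  have -> : 1 - k.+2%:R^-1 = k.+1%:R / k.+2%:R :> R by field; rewrite lt0r_neq0.
  by rewrite ln_div ?posrE// addrC subrK.
apply: ler_wpM2l; first exact: powR_ge0.
rewrite (le_trans _ (expR_ge1Dx _))// addrC lerD2l mulNr -mulrN ler_pM2l//.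
rewrite lerNr; apply: le_ln1Dx.
by rewrite ltrN2 invf_lt1// ltr1n.
Qed.

Lemma cvgn_powR_series (q : R) : 0 < q -> cvgn (series (fun k : nat => k.+1%:R `^ (- q) / k.+1%:R : R)).
Proof.
move=> q0; apply: nondecreasing_is_cvgn.
  by apply: nondecreasing_series => n _ _; rewrite divr_ge0// powR_ge0.
exists (1 + q^-1) => _ [n _ <-].
have H (k : nat) : series (fun k : nat => k.+1%:R `^ (- q) / k.+1%:R) k.+1 <= 1 + q^-1 * (1 - k.+1%:R `^ (- q)).
  elim: k => [|k IH]; first by rewrite /series/= big_nat1 powR1 divr1 subrr mulr0 addr0.
  rewrite seriesSr (le_trans (lerD IH (lexx _)))//.
  have := powR_telescope k q0; rewrite -ler_pdivlMl// => h.
  by rewrite (le_trans (lerD (lexx _) h))// -addrA -mulrDr addrA subrK.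
case: n => [|n]; first by rewrite /series/= big_nil addr_ge0// invr_ge0 ltW.
rewrite (le_trans (H n))// lerD2l ler_piMr ?invr_ge0 ?(ltW q0)// gerBl powR_ge0//.
Qed.

Lemma powR_nat_small (q e : R) : 0 < q -> 0 < e -> \forall n \near \oo, n%:R `^ (- q) <= e.
Proof.
move=> q0 e0; have [m me] : exists m : nat, e `^ (- q^-1) <= m%:R.
  by exists (Num.truncn (e `^ (- q^-1))).+1; rewrite ltW// truncnS_gt.
near=> n.
have n0 : (0 < n)%N by near: n; exact: nbhs_infty_gt.
have mn : m%:R <= n%:R :> R by rewrite ler_nat; near: n; exact: nbhs_infty_ge.
have le : e `^ (- q^-1) <= n%:R by exact: le_trans mn.
have : ln (e `^ (- q^-1)) <= ln n%:R by rewrite ler_ln// posrE ?powR_gt0// ltr0n.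
rewrite ln_powR mulNr lerNl ler_pdivlMl// => h.
by rewrite /powR gt_eqF ?ltr0n// -[leRHS](lnK (x := e)) ?posrE// ler_expR mulNr -mulrN.
Unshelve. all: by end_near.
Qed.
End PowerSum.

(** * Probability that the roots of a long cycle leave the annulus *)

Section LogNorm.
Context (R : realType).

Lemma normc_prod k (z : 'I_k -> R[i]) : normc (\prod_i z i) = \prod_i normc (z i).
Proof. by rewrite (big_morph _ (@normcM R) (normc1 R)). Qed.

Lemma ln_prod k (x : 'I_k -> R) : (forall i, 0 < x i) -> ln (\prod_i x i) = \sum_i ln (x i).
Proof.
move=> x0; elim: k x x0 => [|k IH] x x0; first by rewrite !big_ord0 ln1.
by rewrite !big_ord_recr /= lnM ?posrE ?prodr_gt0// IH.
Qed.

Lemma measurable_ln_normc : measurable_fun setT (fun z : R[i] => ln (normc z)).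
Proof.
apply: measurableT_comp; first exact: measurable_ln.
rewrite (_ : @normc R = fun z => Num.sqrt (complex.Re z ^+ 2 + complex.Im z ^+ 2)); last by apply/funext => -[].
apply: measurableT_comp; first by apply: continuous_measurable_fun; exact: sqrt_continuous.
by apply: measurable_funD; apply: measurable_funX; [exact: measurable_Re|exact: measurable_Im].
Qed.

End LogNorm.

Section Bad.
Context (R : realType) (L : probability R[i] R) (L_Cstar : L [set z | z != 0] = 1%E).
Context d (O : measurableType d) (P : probability O R) (T : nat -> nat -> {RV P >-> R[i]}).
Context (T_ind : mutual_independence P [set kp : nat * nat | (1 <= kp.1)%N && (1 <= kp.2)%N]
  (fun kp => events (T kp.1 kp.2))).
Context (T_law : forall k p, (1 <= k)%N -> (1 <= p)%N -> law_of_product L k P (T k p)).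
Context dZ (OZ : measurableType dZ) (PZ : probability OZ R)
  (Z : {RV PZ >-> R[i]}) (Z_law : has_law PZ Z L)
  (q : R) (q_gt0 : 0 < q)
  (logZ_Uq : in_Uq q PZ (fun w => ln (Normc.normc (Z w)))).
Context (e : R) (e_gt0 : 0 < e).
Let m := fine 'E_PZ[fun w => ln (Normc.normc (Z w))].

(** The point 0, whose logarithm carries no information, is put with the bad
    values; it has probability 0. *)
Definition off_annulus k : set R[i] :=
  [set t | t = 0 \/ e <= `|k%:R^-1 * ln (Normc.normc t) - m|].

Lemma measurable_off_annulus k : measurable (off_annulus k).
Proof.
apply: measurableU; first exact: (measurable_set1_complex 0).
rewrite -[X in measurable X]setTI.
have mh : measurable_fun setT (fun t : R[i] => `|k%:R^-1 * ln (Normc.normc t) - m|).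
  apply: measurableT_comp => //; apply: measurable_funB; last exact: measurable_cst.
  apply: measurable_funM; [exact: measurable_cst|exact: measurable_ln_normc].
have := mh measurableT `[e, +oo[%classic (measurable_itv _).
by congr (measurable (_ `&` _)); apply/seteqP; split => t /=; rewrite in_itv/= andbT.
Qed.

Lemma T1_law p : (1 <= p)%N -> has_law P (T 1 p) L.
Proof.
move=> p1 A mA; have [dy [Oy [Py [Y [_ Y_law H]]]]] := T_law (leqnn 1) p1.
rewrite H// /law -(Y_law ord0)//; congr (Py _); apply/seteqP; split=> w /=;
  by rewrite big_ord_recl big_ord0 mulr1.
Qed.

Let ind1 (A : choiceType) (D' : set A) (u : A -> nat) : injective u ->
  mutual_independence P D' (fun i => events (T 1 (u i).+1)).
Proof.
move=> u_inj.
refine (@mutual_independence_reindex _ _ _ P _ _ _ D' _ (fun i => (1%N, (u i).+1)) T_ind _ _ _ _).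
- by move=> i _; exact: setI_closed_preimage.
- by move=> i _; exact: events_measurable.
- by [].
- by move=> i j _ _ [] /u_inj.
Qed.

(** [T k p] has the law of the product of [T 1 1], ..., [T 1 k], so log|T k p|
    is distributed as a sum of [k] independent copies of log|Z|. The sequence
    [T 1 p] itself is the one to which the hypothesis on large deviations is
    applied. *)
Lemma off_annulus_prob : exists2 C, 0 < C & forall k p, (1 <= k)%N -> (1 <= p)%N ->
  fine (P (T k p @^-1` off_annulus k)) <= C * k%:R `^ (- q).
Proof.
have mX p : measurable_fun setT (fun w => ln (Normc.normc (T 1 p.+1 w))).
  exact: (measurableT_comp (@measurable_ln_normc R)).
pose Xs p : {RV P >-> R} :=
  HB.pack (fun w => ln (Normc.normc (T 1 p.+1 w))) (isMeasurableFun.Build _ _ _ _ _ (mX p)).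
have Xs_ind : mutual_independence P setT (fun k => events (Xs k)).
  apply: (mutual_independence_sub (D := setT) (F := fun p => events (T 1 p.+1))) => //.
    move=> p _ _ [B mB <-]; exists ((fun z => ln (Normc.normc z)) @^-1` B) => //.
    by rewrite -[X in measurable X]setTI; exact: measurable_ln_normc.
  exact: (@ind1 nat setT id).
have Xs_law k : has_law P (Xs k) (law PZ (fun w => ln (Normc.normc (Z w)))).
  move=> A mA; have mB : measurable ((fun z : R[i] => ln (Normc.normc z)) @^-1` A).
    by rewrite -[X in measurable X]setTI; exact: measurable_ln_normc.
  by have := T1_law (ltn0Sn k) mB; rewrite -Z_law.
have [C C0 HC] := logZ_Uq.2 _ _ _ Xs Xs_ind Xs_law e e_gt0.
exists C => // k p k1 p1.
have [dy [Oy [Py [Y [Y_ind Y_law ->]]]]] := T_law k1 p1; last exact: measurable_off_annulus.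
rewrite /law (@mean_products R _ _ _ _ Py P k (fun i => Y i) (fun i : 'I_k => T 1 i.+1) L)//; last 3 first.
- exact: (@ind1 'I_k setT (@nat_of_ord k) (@ord_inj k)).
- by move=> i; exact: T1_law.
- exact: measurable_off_annulus.
pose B := [set w | e <= `|k%:R^-1 * \sum_(i < k) Xs i w - m|].
have mB : measurable B.
  rewrite -[X in measurable X]setTI.
  have mh : measurable_fun setT (fun w => `|k%:R^-1 * \sum_(i < k) Xs i w - m|).
    apply: measurableT_comp => //; apply: measurable_funB; last exact: measurable_cst.
    apply: measurable_funM; [exact: measurable_cst|].
    by apply: measurable_sum => i; exact: measurable_funP.
  have := mh measurableT `[e, +oo[%classic (measurable_itv _).
  by congr (measurable (_ `&` _)); apply/seteqP; split => t /=; rewrite in_itv/= andbT.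
(* Either a factor vanishes, or the logarithm of the product is a sum. *)
pose E (i : option 'I_k) := if i is Some i then T 1 i.+1 @^-1` [set 0] else B.
have mprod : measurable_fun setT (fun w => \prod_(i < k) T 1 i.+1 w).
  by apply: measurable_complex_prod => i; exact: measurable_funP.
rewrite (le_trans (@fine_prob_le_sum _ _ _ P _ (None :: [seq Some i | i <- enum 'I_k]) _ E _ _ _))//.
- by rewrite -[X in measurable X]setTI; apply: mprod => //; exact: measurable_off_annulus.
- case=> [i|]//=; rewrite -[X in measurable X]setTI; apply: measurable_funP => //.
  exact: measurable_set1_complex.
- move=> w /= H; have [[i Ti]|nz] := pselect (exists i : 'I_k, T 1 i.+1 w = 0).
    by exists (Some i) => //; rewrite inE/= map_f// mem_enum.
  exists None; first by rewrite inE.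
  have Tn (i : 'I_k) : T 1 i.+1 w != 0 by apply/eqP => Ti; apply: nz; exists i.
  case: H => [/eqP/prodf_eq0[i _]|]; first by rewrite (negPf (Tn i)).
  by rewrite normc_prod ln_prod// => i; exact: normc_gt0.
- rewrite big_cons big_map big1 ?addr0; last first.
    by move=> i _; rewrite (@law_neq0 R L L_Cstar)//; exact: T1_law.
  rewrite powRN -[leRHS]/(fine (C / k%:R `^ q)%:E); apply: fine_le => //; first exact: fin_num_measure.
  exact: HC.
Qed.

End Bad.

(** * Negligibility of the long cycles of the permutation *)

Section EwensTail.
Context (R : realType) (theta : R) (theta_gt0 : 0 < theta) (q : R) (q_gt0 : 0 < q).
Local Notation EN := (ewens_mean theta).

Lemma ewens_mean_count_ge0 n k : 0 <= EN n (fun m => (m k)%:R).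
Proof. by rewrite -[leLHS](ewens_mean_cst theta_gt0 n 0); apply: ewens_mean_le. Qed.

Lemma powR_le_half (n k : nat) : (0 < n)%N -> (n < 2 * k)%N ->
  k%:R `^ (- q) <= 2 `^ q * n%:R `^ (- q) :> R.
Proof.
move=> n0 nk; have k0 : (0 < k)%N by move: nk; case: (k).
rewrite !powRN -[leLHS]mul1r ler_pdivrMr ?powR_gt0 ?ltr0n// mulrAC ler_pdivlMr ?powR_gt0 ?ltr0n// mul1r.
rewrite -powRM//; apply: ge0_ler_powR; rewrite ?nnegrE ?mulr_ge0//; first exact: ltW.
by rewrite -natrM ler_nat ltnW.
Qed.

(** Up to length [N / 2] the mean counts are at most [2 * theta / k]. Beyond,
    there are at most two cycles on average, and each has a weight of order [N
    `^ (- q)]. *)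
Lemma ewens_tail_sum (K N : nat) : (0 < N)%N ->
  \sum_(K <= k < N) k.+1%:R `^ (- q) * EN N (fun m => (m k.+1)%:R) <=
  2 * theta * \sum_(K <= k < N) (k.+1%:R `^ (- q) / k.+1%:R) + 2 * 2 `^ q * N%:R `^ (- q).
Proof.
move=> N0; rewrite (bigID (fun k => 2 * k.+1 <= N)%N)/=; apply: lerD.
  rewrite mulr_sumr big_mkcond; apply: ler_sum => k _; case: ifP => kN; last first.
    by rewrite mulr_ge0 ?divr_ge0 ?powR_ge0// mulr_ge0// ltW.
  rewrite ewens_mean_countE// [leRHS]mulrCA ler_wpM2l ?powR_ge0//.
  rewrite -[leRHS]mulrA [leRHS]mulrC ler_wpM2l ?divr_ge0 ?(ltW theta_gt0)//.
  exact: weight_ratio_le2.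
apply: (@le_trans _ _ (2 `^ q * N%:R `^ (- q) * \sum_(K <= k < N | ~~ (2 * k.+1 <= N)%N) EN N (fun m => (m k.+1)%:R))).
  rewrite mulr_sumr; apply: ler_sum => k; rewrite -ltnNge => kN.
  by rewrite ler_wpM2r ?ewens_mean_count_ge0// powR_le_half.
rewrite -[2 * _ * _]mulrA mulrC ler_wpM2r ?mulr_ge0 ?powR_ge0//.
rewrite (le_trans _ (ewens_mean_large_cycles theta_gt0 N0))//.
rewrite [leLHS]big_mkcond [leRHS]big_mkcond [leRHS]big_ord_recl/= add0r -(big_mkord xpredT (fun i => if (N < 2 * i.+1)%N then EN N (fun m => (m i.+1)%:R) else 0)).
have [KN|NK] := leqP K N; last by rewrite big_geq ?(ltnW NK)// sumr_ge0// => i _; case: ifP => // _; exact: ewens_mean_count_ge0.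
rewrite [leRHS](big_cat_nat _ KN)//= ler_wpDl ?sumr_ge0//.
  by move=> i _; case: ifP => // _; exact: ewens_mean_count_ge0.
by apply: ler_sum => i _; rewrite ltnNge.
Qed.

Lemma ewens_tail_small (c e : R) : 0 <= c -> 0 < e -> exists K0, forall K, (K0 <= K)%N ->
  \forall N \near \oo, c * \sum_(K <= k < N) k.+1%:R `^ (- q) * EN N (fun m => (m k.+1)%:R) <= e.
Proof.
move=> c0 e0; pose c' := c + 1; have c'0 : 0 < c' by rewrite ltr_wpDl.
pose e' := e / c'; have e'0 : 0 < e' by rewrite divr_gt0.
have t0 : 0 < 2 * theta by rewrite mulr_gt0.
have p0 : 0 < 2 * 2 `^ q :> R by rewrite mulr_gt0// powR_gt0.
have e1 : 0 < e' / 2 / (2 * theta) by rewrite !divr_gt0.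
have e2 : 0 < e' / 2 / (2 * 2 `^ q) by rewrite !divr_gt0.
have u0 (k : nat) : 0 <= k.+1%:R `^ (- q) / k.+1%:R :> R by rewrite divr_ge0// powR_ge0.
have [K0 HK] := series_tail_small u0 (cvgn_powR_series q_gt0) e1.
exists K0 => K K0K; near=> N.
have N0 : (0 < N)%N by near: N; exact: nbhs_infty_gt.
have h2 : 2 * 2 `^ q * N%:R `^ (- q) <= e' / 2.
  by rewrite mulrC -ler_pdivlMr//; near: N; exact: powR_nat_small.
have h1 : 2 * theta * \sum_(K <= k < N) (k.+1%:R `^ (- q) / k.+1%:R) <= e' / 2.
  rewrite mulrC -ler_pdivlMr// (le_trans _ (HK N))//.
  have [KN|NK] := leqP K N; last by rewrite big_geq ?(ltnW NK)// sumr_ge0.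
  by rewrite [leRHS](big_cat_nat K0K KN)//= ler_wpDl// sumr_ge0.
have h := ewens_tail_sum K N0.
apply: (@le_trans _ _ (c' * e')); last by rewrite mulrC divfK// gt_eqF.
apply: ler_pM => //; last by rewrite (le_trans h)// (splitr e') lerD.
  by apply: sumr_ge0 => k _; rewrite mulr_ge0 ?powR_ge0 ?ewens_mean_count_ge0.
by rewrite lerDl.
Unshelve. all: by end_near.
Qed.

End EwensTail.

Section BadEvents.
Context (R : realType) d (O : measurableType d) (P : probability O R) (T : nat -> nat -> {RV P >-> R[i]}).
Context (f : R[i] -> R) (f_cont : continuous f).

(** [bad k p] stands for the event that some root of [T k p] leaves the
    annulus where [f] vanishes. *)
Context (bad : nat -> nat -> set O) (C q : R) (C_gt0 : 0 < C).
Context (bad_m : forall k p, measurable (bad k p)).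
Context (bad_prob : forall k p, (1 <= k)%N -> (1 <= p)%N -> fine (P (bad k p)) <= C * k%:R `^ (- q)).
Context (bad_f : forall k p w, (1 <= k)%N -> (1 <= p)%N -> ~ bad k p w -> root_sum f k (T k p w) = 0).
Local Notation Y := (cycle_sum T f).

Definition bad_between K N (n : nat -> nat) : set O :=
  \bigcup_(k in [set k | (K <= k < N)%N]) \bigcup_(p in [set p | (p < n k.+1)%N]) bad k.+1 p.+1.

Lemma measurable_bad_between K N n : measurable (bad_between K N n).
Proof. by apply: bigcup_measurable => k _; apply: bigcup_measurable => p _; exact: bad_m. Qed.

Lemma cycle_sum_bad_between K N n w : (K <= N)%N -> ~ bad_between K N n w -> Y N n w = Y K n w.
Proof.
move=> KN nb; rewrite /cycle_sum -(big_mkord xpredT (fun k => \sum_(p < n k.+1) root_sum f k.+1 (T k.+1 p.+1 w))).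
rewrite (big_cat_nat (n := K))//= big_mkord -[RHS]addr0; congr (_ + _).
rewrite big_nat big1// => k kKN; rewrite big1// => p _; apply: bad_f => // bw.
by apply: nb; exists k => //; exists p => //=.
Qed.

Lemma prob_bad_between K N n :
  fine (P (bad_between K N n)) <= C * \sum_(K <= k < N) k.+1%:R `^ (- q) * (n k.+1)%:R.
Proof.
pose s := [seq (k, p) | k <- index_iota K N, p <- iota 0 (n k.+1)].
rewrite (le_trans (@fine_prob_le_sum _ _ _ P _ s _ (fun kp => bad kp.1.+1 kp.2.+1) (measurable_bad_between _ _ _) _ _))//.
- by move=> w [k /= kKN [p /= pn bw]]; exists (k, p) => //; apply: allpairs_f_dep; rewrite ?mem_index_iota ?mem_iota.
- rewrite big_allpairs_dep mulr_sumr; apply: ler_sum => k _ /=.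
  rewrite (le_trans (ler_sum _ (fun p _ => bad_prob (ltn0Sn k) (ltn0Sn p))))//.
  by rewrite big_const_seq count_predT size_iota iter_addr addr0 mulrA mulr_natr.
Qed.

Lemma mean_cycle_sum_tail (g : R -> R) (B : R) K N n : continuous g -> (forall x, `|g x| <= B) -> (K <= N)%N ->
  `|\int[P]_w g (Y N n w) - \int[P]_w g (Y K n w)|
  <= 2 * B * C * \sum_(K <= k < N) k.+1%:R `^ (- q) * (n k.+1)%:R.
Proof.
move=> cg gB KN.
have mY K' : measurable_fun setT (fun w => g (Y K' n w)).
  by apply: measurableT_comp; [exact: continuous_measurable_fun|exact: measurable_cycle_sum].
rewrite (le_trans (mean_dist_le P (B := B) (mY N) (mY K) _ _ (measurable_bad_between K N n) _))//.
  by move=> w /(cycle_sum_bad_between KN) ->.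
rewrite -[leRHS]mulrA ler_wpM2l ?prob_bad_between// mulr_ge0//.
by rewrite (le_trans _ (gB 0)).
Qed.

(** Ignoring the cycles longer than [K] changes the statistic only if one of
    them is bad; the union bound makes the error small uniformly in the size
    of the permutation. *)
Lemma ewens_mean_truncate (theta : R) (g : R -> R) (B e : R) : 0 < theta -> 0 < q ->
  continuous g -> (forall x, `|g x| <= B) -> 0 < e ->
  exists K0, forall K, (K0 <= K)%N -> \forall N \near \oo,
    `|ewens_mean theta N (fun n => \int[P]_w g (Y N n w)) -
      ewens_mean theta N (fun n => \int[P]_w g (Y K n w))| <= e.
Proof.
move=> theta0 q0 cg gB e0; have B0 : 0 <= B by rewrite (le_trans _ (gB 0)).
have c0 : 0 <= 2 * B * C by rewrite !mulr_ge0// ltW.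
have [K0 HK] := ewens_tail_small theta0 q0 c0 e0.
exists K0 => K K0K; near=> N.
have KN : (K <= N)%N by near: N; exact: nbhs_infty_ge.
rewrite -[X in `|_ - X|]mul1r -mulNr -ewens_meanZ -ewens_meanD.
rewrite (@le_trans _ _ (ewens_mean theta N (fun n => 2 * B * C * \sum_(K <= k < N) k.+1%:R `^ (- q) * (n k.+1)%:R)))//.
  apply: ewens_mean_norm_le => // t; rewrite mulN1r; exact: mean_cycle_sum_tail.
rewrite ewens_meanZ ewens_mean_sum.
under eq_bigr do rewrite ewens_meanZ.
by near: N; exact: HK.
Unshelve. all: by end_near.
Qed.

End BadEvents.

(** * Negligibility of the tail of the limit measure *)

Section FiniteRootMeasure.
Context (R : realType) (a : nat -> nat) (T : nat -> nat -> R[i]) (K : nat).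
Local Notation mu := (mu_infty a T).
Implicit Types h : R[i] -> R.

Definition vanishes_beyond (h : R[i] -> R) := forall k p, (K <= k)%N -> (p < a k.+1)%N ->
  forall x, x ^+ k.+1 = T k.+1 p.+1 -> h x = 0.

Lemma ge0_integral_vanishes_beyond h : measurable_fun setT h -> (forall x, 0 <= h x) -> vanishes_beyond h ->
  (\int[mu]_x (h x)%:E = (\sum_(k < K) \sum_(p < a k.+1) root_sum h k.+1 (T k.+1 p.+1))%:E)%E.
Proof.
move=> mh h0 hK; rewrite ge0_integral_mu_infty// (nneseries_split 1 K); last first.
  by move=> k _; rewrite lee_fin sumr_ge0// => p _; apply: sumr_ge0.
rewrite eseries0 ?adde0; last first.
  case=> // k; rewrite add1n ltnS => Kk _; congr EFin; rewrite big1// => p _.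
  by apply: root_sum_eq0 => //; exact: hK.
by rewrite add1n big_add1/= -sumEFin big_mkord.
Qed.

(** The integral is a finite sum, for the positive and the negative part of
    [h] separately. *)
Lemma integral_vanishes_beyond h : measurable_fun setT h -> vanishes_beyond h ->
  mu.-integrable setT (EFin \o h) /\
  \int[mu]_x h x = \sum_(k < K) \sum_(p < a k.+1) root_sum h k.+1 (T k.+1 p.+1).
Proof.
move=> mh hK; split.
  apply/integrableP; split; first exact/measurable_EFinP.
  rewrite (_ : (fun x => `|(EFin \o h) x|)%E = fun x => `|h x|%:E)//.
  rewrite (@ge0_integral_vanishes_beyond (fun x => `|h x|)) ?ltry//; first exact: measurableT_comp.
  by move=> k p Kk pa x /(hK _ _ Kk pa) ->; rewrite normr0.
have m0 : measurable_fun setT (fun _ : R[i] => 0 : R) by exact: measurable_cst.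
rewrite /Rintegral integralE.
rewrite (_ : (fun x => (h x)%:E)^\+%E = fun x => (Num.max (h x) 0)%:E); last first.
  by apply/funext => x; rewrite funeposE EFin_max.
rewrite (_ : (fun x => (h x)%:E)^\-%E = fun x => (Num.max (- h x) 0)%:E); last first.
  by apply/funext => x; rewrite funenegE EFin_max.
rewrite !(@ge0_integral_vanishes_beyond (fun x => Num.max _ 0))//.
- rewrite -EFinB/= -sumrB; apply: eq_bigr => k _; rewrite -sumrB; apply: eq_bigr => p _.
  rewrite /root_sum -sumrB; apply: eq_bigr => x _.
  case: (leP (h x) 0) => hx; first by rewrite max_l ?oppr_ge0// sub0r opprK.
  by rewrite max_r ?oppr_le0 ?(ltW hx)// subr0.
- by apply: measurable_maxr => //; exact: measurableT_comp.
- by move=> x; rewrite le_max lexx orbT.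
- by move=> k p Kk pa x /(hK _ _ Kk pa) ->; rewrite oppr0 maxxx.
- exact: measurable_maxr.
- by move=> x; rewrite le_max lexx orbT.
- by move=> k p Kk pa x /(hK _ _ Kk pa) ->; rewrite maxxx.
Qed.

End FiniteRootMeasure.

Section MeasurableLimit.
Context (R : realType) d (O : measurableType d).

Lemma measurable_random_sum (a : O -> nat) (u : nat -> O -> R) :
  measurable_fun setT a -> (forall p, measurable_fun setT (u p)) ->
  measurable_fun setT (fun w => \sum_(p < a w) u p w).
Proof.
move=> ma mu _ C mC; rewrite setTI.
rewrite (_ : _ @^-1` C = \bigcup_j (a @^-1` [set j] `&` (fun w => \sum_(p < j) u p w) @^-1` C)); last first.
  by apply/seteqP; split=> [w /= Cw|w [j _ [/= <-]]//]; exists (a w).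
apply: bigcupT_measurable => j; apply: measurableI; rewrite -[X in measurable X]setTI.
  exact: ma.
by apply: measurable_sum.
Qed.

Context (a : nat -> O -> nat) (T : nat -> nat -> O -> R[i]).
Context (ma : forall k, measurable_fun setT (a k)) (mT : forall k p, measurable_fun setT (T k p)).

(** Measurability holds without exceptional set, because [Rintegral] is
    defined from the extended integrals of the positive and negative parts
    even where [f] is not integrable. *)
Lemma measurable_integral_mu_infty (f : R[i] -> R) : continuous f ->
  measurable_fun setT (fun w => \int[mu_infty (a^~ w) (fun k p => T k p w)]_x f x).
Proof.
move=> cf.
have pos (h : R[i] -> R) : continuous h -> (forall x, 0 <= h x) ->
  measurable_fun setT (fun w => (\int[mu_infty (a^~ w) (fun k p => T k p w)]_x (h x)%:E)%E).
  move=> ch h0; have mh := measurable_continuous_complex ch.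
  under eq_fun do rewrite ge0_integral_mu_infty//.
  under eq_fun do rewrite eseries_cond.
  apply: (@ge0_emeasurable_sum _ _ _ setT (fun k w => (\sum_(p < a k w) root_sum h k (T k p.+1 w))%:E) (fun k => (0 < k)%N)).
    by move=> k w _ _; rewrite lee_fin; apply: sumr_ge0 => p _; apply: sumr_ge0.
  move=> k k0; apply/measurable_EFinP; apply: (@measurable_random_sum (a k) (fun p w => root_sum h k (T k p.+1 w))) => // p.
  exact: (measurableT_comp (measurable_root_sum_XnsubC (k0 : (0 < k)%N) ch) (mT k p.+1)).
have cmax (h : R[i] -> R) : continuous h -> continuous (fun x => Num.max (h x) 0).
  by move=> ch x; exact: (@continuous_max _ _ h (fun=> 0) x (ch x) (@cst_continuous _ _ 0 x)).
rewrite /Rintegral; apply: measurableT_comp => //.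
under eq_fun do rewrite integralE.
rewrite (_ : (fun x => (f x)%:E)^\+%E = fun x => (Num.max (f x) 0)%:E); last first.
  by apply/funext => x; rewrite funeposE EFin_max.
rewrite (_ : (fun x => (f x)%:E)^\-%E = fun x => (Num.max (- f x) 0)%:E); last first.
  by apply/funext => x; rewrite funenegE EFin_max.
apply: emeasurable_funB; apply: pos; try by move=> x; rewrite le_max lexx orbT.
  exact: cmax.
by apply: (cmax (fun x => - f x)) => x; apply: continuousN; exact: cf.
Qed.

End MeasurableLimit.

Section LimitTail.
Context (R : realType) (theta : R) (theta_gt0 : 0 < theta).
Context d (O : measurableType d) (P : probability O R) (a : nat -> {RV P >-> nat})
  (T : nat -> nat -> {RV P >-> R[i]}).
Context (I : choiceType) (D : set I) (F : I -> set (set O)) (ia : nat -> I) (iT : nat -> nat -> I).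
Context (F_ind : mutual_independence P D F).
Context (FI : forall i, D i -> setI_closed (F i)).
Context (Fm : forall i, D i -> F i `<=` measurable).
Context (iaD : forall k, (1 <= k)%N -> D (ia k)).
Context (iTD : forall k p, (1 <= k)%N -> (1 <= p)%N -> D (iT k p)).
Context (iaT : forall k l p, ia k <> iT l p).
Context (F_ia : forall k, (1 <= k)%N -> F (ia k) = events (a k)).
Context (F_iT : forall k p, (1 <= k)%N -> (1 <= p)%N -> F (iT k p) = events (T k p)).
Context (a_pmf : forall k n, (1 <= k)%N -> P (a k @^-1` [set n]) = (poisson_pmf (theta / k%:R) n)%:E).
Context (B : nat -> set R[i]) (mB : forall k, measurable (B k)) (C q : R) (C_gt0 : 0 < C) (q_gt0 : 0 < q).
Context (B_prob : forall k p, (1 <= k)%N -> (1 <= p)%N ->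
  fine (P (T k p @^-1` B k)) <= C * k%:R `^ (- q)).

Lemma sum_poisson_le1 k J : (1 <= k)%N -> \sum_(n < J) poisson_pmf (theta / k%:R) n <= 1.
Proof.
move=> k1; have -> : \sum_(n < J) poisson_pmf (theta / k%:R) n = \int[P]_w (\sum_(n < J) \1_(a k @^-1` [set nat_of_ord n]) w).
  rewrite (@mean_sum _ _ _ P _ _ _ (fun=> 1)).
  - by apply: eq_bigr => n _; rewrite mean_indic ?a_pmf//; exact: measurable_count_eq.
  - by move=> n; apply: measurable_indic; exact: measurable_count_eq.
  - by move=> n w; rewrite indicE normr_nat; case: (_ \in _).
rewrite (le_trans (ler_norm _))//; apply: (@mean_norm_le _ _ _ P _ 1).
  by apply: measurable_sum => n; apply: measurable_indic; exact: measurable_count_eq.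
move=> w; have [aJ|Ja] := ltnP (a k w) J.
  rewrite (bigD1 (Ordinal aJ))//= big1 ?addr0; first by rewrite indicE normr_nat; case: (_ \in _).
  by move=> j /eqP ja; rewrite indicE memNset//= => E; apply: ja; exact: val_inj.
rewrite big1 ?normr0// => j _; rewrite indicE memNset//= => E.
by have := ltn_ord j; rewrite -E ltnNge Ja.
Qed.

(** The mean of a Poisson variable is its parameter. *)
Lemma sum_poisson_mean_le k J : (1 <= k)%N ->
  \sum_(n < J) n%:R * poisson_pmf (theta / k%:R) n <= theta / k%:R.
Proof.
move=> k1; have th0 : 0 < theta / k%:R by rewrite divr_gt0// ltr0n.
case: J => [|J]; first by rewrite big_ord0 ltW.
rewrite big_ord_recl mul0r add0r -[leRHS]mulr1.
rewrite (le_trans _ (ler_wpM2l (ltW th0) (sum_poisson_le1 J k1)))// mulr_sumr.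
apply: ler_sum => n _; rewrite lift0 /poisson_pmf th0 factS natrM exprS; set x := theta / _.
by rewrite le_eqVlt; apply/orP; left; apply/eqP; field; rewrite pnatr_eq0 -lt0n fact_gt0 nat1r pnatr_eq0.
Qed.

Definition bad_count k : set O :=
  \bigcup_p ([set w | (p < a k w)%N] `&` T k p.+1 @^-1` B k).

Lemma measurable_bad k p : measurable (T k p @^-1` B k).
Proof. by rewrite -[X in measurable X]setTI; exact: measurable_funP. Qed.

Lemma measurable_bad_count k : measurable (bad_count k).
Proof.
apply: bigcupT_measurable => p; apply: measurableI; last exact: measurable_bad.
exact: (measurable_count_ge a k p.+1).
Qed.

Lemma prob_count_bad k p n : (1 <= k)%N -> (1 <= p)%N ->
  P (a k @^-1` [set n] `&` T k p @^-1` B k) = (P (a k @^-1` [set n]) * P (T k p @^-1` B k))%E.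
Proof.
move=> k1 p1; apply: (@indep_blocks _ _ _ P _ D F F_ind FI Fm [set ia k] [set iT k p]).
- by move=> i ->; exact: iaD.
- by move=> i ->; exact: iTD.
- by apply/seteqP; split=> // i [-> /iaT].
- by apply: sub_sigma_algebra; exists (ia k) => //; rewrite F_ia//; exact: events_preimage.
- by apply: sub_sigma_algebra; exists (iT k p) => //; rewrite F_iT//; exact: events_preimage.
Qed.

(** Given the number of points [T k p] in use, which is independent of them,
    the union bound applies; the mean of this number is [theta / k]. *)
Lemma prob_bad_count k : (1 <= k)%N -> fine (P (bad_count k)) <= C * theta * (k%:R `^ (- q) / k%:R).
Proof.
move=> k1; apply/ler_addgt0Pr => e e0.
have [J HJ] := count_ge_small a k e0.
pose s := [seq (n, p) | n <- iota 0 J, p <- iota 0 n].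
(* The values of the count beyond [J] are handled together, by the index [None]. *)
pose E (np : option (nat * nat)) := if np is Some np then
   a k @^-1` [set np.1] `&` T k np.2.+1 @^-1` B k else [set w | (J <= a k w)%N].
rewrite (le_trans (@fine_prob_le_sum _ _ _ P _ (None :: [seq Some np | np <- s]) _ E (measurable_bad_count k) _ _))//.
- case=> [np|]; last exact: measurable_count_ge.
  by apply: measurableI; [exact: measurable_count_eq|exact: measurable_bad].
- move=> w [p _ [/= pa Bw]]; have [Ja|aJ] := leqP J (a k w); first by exists None; rewrite ?inE.
  exists (Some (a k w, p)) => //; rewrite inE/= map_f//.
  by apply: allpairs_f_dep; rewrite mem_iota.
rewrite big_cons big_map addrC lerD ?HJ// big_allpairs_dep/=.
apply: (@le_trans _ _ (\sum_(n <- iota 0 J) C * k%:R `^ (- q) * (n%:R * poisson_pmf (theta / k%:R) n))).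
  apply: ler_sum => n _; rewrite (@le_trans _ _ (\sum_(p <- iota 0 n) poisson_pmf (theta / k%:R) n * (C * k%:R `^ (- q))))//.
    apply: ler_sum => p _; rewrite prob_count_bad// fineM ?fin_num_measure//; [|exact: measurable_count_eq|exact: measurable_bad].
    by rewrite a_pmf// ler_wpM2l ?poisson_pmf_ge0// B_prob.
  by rewrite big_const_seq count_predT size_iota iter_addr addr0 [leRHS]mulrC -mulrA mulr_natl.
rewrite -mulr_sumr -[X in iota 0 X]subn0 -/(index_iota 0 J) big_mkord.
rewrite (le_trans (ler_wpM2l _ (sum_poisson_mean_le J k1))) ?mulr_ge0 ?powR_ge0 ?(ltW C_gt0)//.
by rewrite le_eqVlt; apply/orP; left; apply/eqP; ring.
Qed.

Definition bad_after K : set O := \bigcup_(k in [set k | (K <= k)%N]) bad_count k.+1.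

Lemma measurable_bad_after K : measurable (bad_after K).
Proof. by apply: bigcup_measurable => k _; exact: measurable_bad_count. Qed.

(** The union bound gives a convergent series of the same kind as for
    permutations. *)
Lemma bad_after_small e : 0 < e -> exists K0, forall K, (K0 <= K)%N -> fine (P (bad_after K)) <= e.
Proof.
move=> e0; have c0 : 0 < C * theta by rewrite mulr_gt0.
have e1 : 0 < e / (C * theta) by rewrite divr_gt0.
have u0 (k : nat) : 0 <= k.+1%:R `^ (- q) / k.+1%:R :> R by rewrite divr_ge0// powR_ge0.
have [K0 HK] := series_tail_small u0 (cvgn_powR_series q_gt0) e1.
exists K0 => K K0K.
suff H : (P (bad_after K) <= e%:E)%E.
  by rewrite -[leRHS]/(fine e%:E); apply: fine_le => //; apply: fin_num_measure; exact: measurable_bad_after.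
apply: (le_trans (@measure_sigma_subadditive_tail _ _ _ P _ (fun k => bad_count k.+1) K _ _ _)).
- by move=> k; exact: measurable_bad_count.
- exact: measurable_bad_after.
- by move=> w [k /= Kk ?]; exists k => //=; apply/negP; rewrite -leqNgt.
apply: lime_le; first by apply: is_cvg_nneseries.
apply: nearW => n; have [Kn|nK] := leqP K n; last by rewrite big_geq ?(ltnW nK)// lee_fin ltW.
rewrite (@le_trans _ _ (\sum_(K <= k < n) (C * theta * (k.+1%:R `^ (- q) / k.+1%:R))%:E)%E)//.
  apply: lee_sum => k _; rewrite -[leLHS]fineK ?fin_num_measure//; last exact: measurable_bad_count.
  by rewrite lee_fin prob_bad_count.
rewrite sumEFin lee_fin -mulr_sumr mulrC -ler_pdivlMr// (le_trans _ (HK n))//.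
by rewrite [leRHS](big_cat_nat K0K Kn)//= ler_wpDl// sumr_ge0.
Qed.

Lemma vanishes_beyond_off_bad (h : R[i] -> R) K w :
  (forall k t, (1 <= k)%N -> ~ B k t -> forall x, x ^+ k = t -> h x = 0) ->
  ~ bad_after K w -> vanishes_beyond (fun k => a k w) (fun k p => T k p w) K h.
Proof.
move=> hB nb k p Kk pa x xT; apply: (hB k.+1 (T k.+1 p.+1 w)) xT => // Bw.
by apply: nb; exists k => //; exists p.
Qed.

(** This is the Borel-Cantelli lemma: almost surely, bad values stop
    occurring. *)
Lemma ae_not_bad_after : {ae P, forall w, exists K, ~ bad_after K w}.
Proof.
exists (\bigcap_K bad_after K); split.
- by apply: bigcapT_measurable => K; exact: measurable_bad_after.
- have mc : measurable (\bigcap_K bad_after K) by apply: bigcapT_measurable => K; exact: measurable_bad_after.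
  suff : fine (P (\bigcap_K bad_after K)) <= 0.
    move=> h; apply/eqP; rewrite eq_le measure_ge0 andbT -[leLHS]fineK ?fin_num_measure//.
  apply/ler_addgt0Pr => e e0; rewrite add0r; have [K HK] := bad_after_small e0.
  rewrite (le_trans _ (HK K (leqnn K)))//; apply: fine_prob_le => //; first exact: measurable_bad_after.
  exact: bigcap_inf.
- by move=> w /= nK K _; apply: contrapT => nb; apply: nK; exists K.
Qed.

End LimitTail.

(** * Convergence of the linear statistics *)

Lemma expectation_bounded (R : realType) d (O : measurableType d) (P : probability O R)
    (X : O -> R) (B : R) : measurable_fun setT X -> (forall w, `|X w| <= B) ->
  'E_P[X]%E = (\int[P]_w X w)%:E.
Proof.
move=> mX XB; rewrite unlock /Rintegral fineK//.
exact: integrable_fin_num (bounded_prob_integrable P mX XB).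
Qed.

Section PoissonRoots.
Context (R : realType) (theta : R) (theta_gt0 : 0 < theta) (L : probability R[i] R)
  (L_Cstar : L [set z | z != 0] = 1%E).
Context d (O : measurableType d) (P : probability O R)
  (a : nat -> {RV P >-> nat}) (T : nat -> nat -> {RV P >-> R[i]})
  (aT_law : poisson_roots_data theta L a T).
Context (f : R[i] -> R) (f_cont : continuous f).
Context (B : nat -> set R[i]) (B_meas : forall k, measurable (B k)) (C q : R) (C_gt0 : 0 < C) (q_gt0 : 0 < q).
Context (B_prob : forall k p, (1 <= k)%N -> (1 <= p)%N ->
  fine (P (T k p @^-1` B k)) <= C * k%:R `^ (- q)).
Context (f_B : forall k t, (1 <= k)%N -> ~ B k t -> forall x, x ^+ k = t -> f x = 0).

Let I : choiceType := (nat + nat * nat)%type.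
Let D : set I := [set i : nat + nat * nat | match i with
           | inl k => (1 <= k)%N
           | inr (k, p) => (1 <= k)%N && (1 <= p)%N
           end].
Let F (i : I) : set (set O) := match i with
           | inl k => events (a k)
           | inr (k, p) => events (T k p)
           end.
Let D0 : set I := [set i | D i /\ exists kp, i = inr kp].
Let ia (k : nat) : I := inl k.
Let iT (k p : nat) : I := inr (k, p).

Let F_ind : mutual_independence P D F. Proof. by case: aT_law. Qed.
Let FI i : D i -> setI_closed (F i).
Proof. by case: i => [k|[k p]] _; exact: setI_closed_preimage. Qed.
Let Fm i : D i -> F i `<=` measurable.
Proof. by case: i => [k|[k p]] _; exact: events_measurable. Qed.
Let a_pmf : forall k n, (1 <= k)%N -> P (a k @^-1` [set n]) = (poisson_pmf (theta / k%:R) n)%:E.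
Proof. by case: aT_law. Qed.
Let T_law : forall k p, (1 <= k)%N -> (1 <= p)%N -> law_of_product L k P (T k p).
Proof. by case: aT_law. Qed.

Lemma poisson_roots_indep :
  mutual_independence P [set kp : nat * nat | (1 <= kp.1)%N && (1 <= kp.2)%N]
    (fun kp => events (T kp.1 kp.2)).
Proof.
have := @mutual_independence_reindex _ _ _ P I (nat * nat)%type D
  [set kp : nat * nat | (1 <= kp.1)%N && (1 <= kp.2)%N] F (fun kp => inr kp) F_ind FI Fm _ _.
have h1 (kp : nat * nat) : [set kp : nat * nat | (1 <= kp.1)%N && (1 <= kp.2)%N] kp -> D (inr kp) by case: kp.
move=> /(_ h1) H; apply: (mutual_independence_sub (D := [set kp : nat * nat | (1 <= kp.1)%N && (1 <= kp.2)%N]) (F := fun kp => F (inr kp))) => //.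
  by move=> [k p] _ A.
by apply: H => kp kp' _ _ [].
Qed.

Lemma bounded_block_measurable (g : R -> R) K n : continuous g ->
  block_measurable F D0 ia 0 (fun w => g (cycle_sum T f K n w)).
Proof.
move=> cg Cs mC; set G := \bigcup_(i in _) F i.
have mT k p : (1 <= k)%N -> (1 <= p)%N ->
    measurable_fun setT (T k p : g_sigma_algebraType G -> R[i]).
  move=> k1 p1 _ A mA; rewrite setTI; apply: sub_sigma_algebra; exists (iT k p); last exact: events_preimage.
  by left; split; [rewrite /D/= k1|exists (k, p)].
have mY : measurable_fun setT (cycle_sum T f K n : g_sigma_algebraType G -> R).
  apply: measurable_sum => k; apply: measurable_sum => p.
  exact: (measurableT_comp (measurable_root_sum_XnsubC (ltn0Sn k) f_cont) (mT k.+1 p.+1 _ _)).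
have mgY : measurable_fun setT (fun w : g_sigma_algebraType G => g (cycle_sum T f K n w)).
  exact: (measurableT_comp (continuous_measurable_fun cg) mY).
by have := mgY measurableT _ mC; rewrite setTI.
Qed.

Lemma ae_integrable_mu_infty :
  {ae P, forall w, (mu_infty (fun k => a k w) (fun k p => T k p w)).-integrable setT (EFin \o f)}.
Proof.
have iaD k : (1 <= k)%N -> D (ia k) by [].
have iTD k p : (1 <= k)%N -> (1 <= p)%N -> D (iT k p) by rewrite /D/= => -> ->.
have iaT k l p : ia k <> iT l p by [].
have := @ae_not_bad_after R theta theta_gt0 d O P a T I D F ia iT F_ind FI Fm iaD iTD iaT _ _ a_pmf B B_meas C q C_gt0 q_gt0 B_prob.
move=> /(_ (fun _ _ => erefl) (fun _ _ _ _ => erefl)).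
apply: filterS => w [K nb].
apply: (integral_vanishes_beyond (K := K) _ _).1; first exact: measurable_continuous_complex.
exact: vanishes_beyond_off_bad nb.
Qed.

(** Cutting at length [K] costs little on the side of permutations, by
    [ewens_mean_truncate], and on the side of the limit measure, by
    [bad_after_small]; the truncated means converge by [cvg_truncated]. *)
Lemma cvg_mean_poisson_roots (g : R -> R) (A : R) : continuous g -> (forall x, `|g x| <= A) ->
  (fun N => ewens_mean theta N (fun n => \int[P]_w g (cycle_sum T f N n w))) @ \oo -->
  \int[P]_w g (\int[mu_infty (fun k => a k w) (fun k p => T k p w)]_z f z).
Proof.
move=> cg gA; apply: cvg_approx => e e0.
have A0 : 0 <= A by rewrite (le_trans _ (gA 0)).
have iaD k : (1 <= k)%N -> D (ia k) by [].
have iTD k p : (1 <= k)%N -> (1 <= p)%N -> D (iT k p) by rewrite /D/= => -> ->.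
have iaT k l p : ia k <> iT l p by [].
have e1 : 0 < e / (2 * A + 1) by rewrite divr_gt0// ltr_wpDl// mulr_ge0.
have [K1 HK1] := @bad_after_small R theta theta_gt0 d O P a T I D F ia iT F_ind FI Fm iaD iTD iaT (fun _ _ => erefl) (fun _ _ _ _ => erefl) a_pmf B B_meas C q C_gt0 q_gt0 B_prob _ e1.
have bad_m k p : measurable (T k p @^-1` B k) by exact: measurable_bad.
have bad_f k p w : (1 <= k)%N -> (1 <= p)%N -> ~ (T k p @^-1` B k) w -> root_sum f k (T k p w) = 0.
  by move=> k1 p1 nB; apply: root_sum_eq0 => //; exact: f_B.
have [K0 HK0] := @ewens_mean_truncate R d O P T f f_cont (fun k p => T k p @^-1` B k) C q C_gt0 bad_m B_prob bad_f theta g A e theta_gt0 q_gt0 cg gA e0.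
pose K := maxn K0 K1.
have ia_inj : injective ia by move=> k l [].
have D0D : D0 `<=` D by move=> i [].
have iaD0 k : ~ D0 (ia k) by move=> [_ [kp]].
have gY_dep n n' : (forall k, (1 <= k <= K)%N -> n k = n' k) ->
    (fun w => g (cycle_sum T f K n w)) = (fun w => g (cycle_sum T f K n' w)).
  move=> nn; apply/funext => w; congr g; apply: eq_bigr => k _.
  by rewrite nn//= ltn_ord.
have [mY cY] := @cvg_truncated R theta theta_gt0 d O P a I D F D0 ia F_ind FI Fm ia_inj D0D
  iaD iaD0 (fun _ _ => erefl) a_pmf K (fun n w => g (cycle_sum T f K n w)) A (fun n w => gA _)
  (fun n => bounded_block_measurable K n cg) gY_dep.
exists (fun N => ewens_mean theta N (fun n => \int[P]_w g (cycle_sum T f K n w))).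
exists (\int[P]_w g (cycle_sum T f K (fun k => a k w) w)); split=> //.
  by apply: HK0; rewrite leq_maxl.
have mg : measurable_fun setT g by exact: continuous_measurable_fun.
rewrite (le_trans (mean_dist_le P (B := A) (A := bad_after a T B K) _ _ _ _ _ _))//.
- apply: measurableT_comp => //.
  exact: (@measurable_integral_mu_infty R d O (fun k => a k) (fun k p => T k p)).
- exact: (block_measurableW Fm D0D iaD mY).
- exact: measurable_bad_after.
- move=> w nb; congr g; apply: (integral_vanishes_beyond (K := K) _ _).2; first exact: measurable_continuous_complex.
  exact: vanishes_beyond_off_bad nb.
- have h : fine (P (bad_after a T B K)) <= e / (2 * A + 1) by apply: HK1; rewrite leq_maxr.
  rewrite (le_trans (ler_wpM2l _ h)) ?mulr_ge0//.
  rewrite mulrA ler_pdivrMr ?ltr_wpDl ?mulr_ge0//.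
  by rewrite [leLHS]mulrC ler_wpM2l ?(ltW e0)// lerDl.
Qed.

End PoissonRoots.

Theorem proposition3p5 (R : realType) (theta : R) (theta_gt0 : 0 < theta)
  (L : probability R[i] R) (L_Cstar : L [set z | z != 0] = 1%E)
  (* the random matrices M_N, for N >= 1 *)
  (dM : nat -> measure_display) (OM : forall N, measurableType (dM N))
  (PM : forall N, probability (OM N) R)
  (M : forall N, {RV (PM N) >-> 'M[R[i]]_N})
  (M_law : forall N, (1 <= N)%N -> ewens_mx_law theta L (M N))
  (* Z has law L *)
  (dZ : measure_display) (OZ : measurableType dZ) (PZ : probability OZ R)
  (Z : {RV PZ >-> R[i]}) (Z_law : has_law PZ Z L)
  (q : R) (q_gt0 : 0 < q)
  (logZ_Uq : in_Uq q PZ (fun w => ln (Normc.normc (Z w))))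
  (* the variables from which mu_infty is built *)
  (d : measure_display) (O : measurableType d) (P : probability O R)
  (a : nat -> {RV P >-> nat}) (T : nat -> nat -> {RV P >-> R[i]})
  (aT_law : poisson_roots_data theta L a T)
  (f : R[i] -> R) (f_cont : continuous f) (f_bounded : bounded_fun f) :
  let radius := expR (fine 'E_PZ[fun w => ln (Normc.normc (Z w))]) in
  let mu_oo w := mu_infty (fun k => a k w) (fun k p => T k p w) in
  set_nbhs [set z | Normc.normc z = radius] [set z | f z = 0] ->
  {ae P, forall w, (mu_oo w).-integrable setT (EFin \o f)} /\
  cvg_in_distribution PM
    (fun N w => \int[eigenvalue_measure (M N w)]_z f z)
    P (fun w => \int[mu_oo w]_z f z).
Proof.
move=> radius mu_oo f_radius.
have T_law : forall k p, (1 <= k)%N -> (1 <= p)%N -> law_of_product L k P (T k p) by case: aT_law.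
have T_ind := poisson_roots_indep aT_law.
have [e e0 f_annulus] := vanishing_annulus f_radius.
have [C C0 B_prob] := off_annulus_prob L_Cstar T_ind T_law Z_law logZ_Uq e0.
have B_meas k := measurable_off_annulus Z e k.
have f_B k t : (1 <= k)%N -> ~ off_annulus Z e k t -> forall x, x ^+ k = t -> f x = 0.
  move=> k1 nB; apply: (roots_in_annulus k1 f_annulus).
    by apply/eqP => t0; apply: nB; left.
  by rewrite ltNge; apply/negP => h; apply: nB; right.
split; first exact: (ae_integrable_mu_infty theta_gt0 aT_law f_cont B_meas C0 q_gt0 B_prob f_B).
have mX N : measurable_fun setT (fun w => \int[eigenvalue_measure (M N w)]_z f z).
  exact: (measurable_integral_eigenvalue f_cont (@measurable_funPT _ _ _ _ (M N))).
have mXoo : measurable_fun setT (fun w => \int[mu_oo w]_z f z).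
  exact: (@measurable_integral_mu_infty R d O (fun k => a k) (fun k p => T k p)).
split=> // g g_cont [A0 [_ gA0]].
pose A := A0 + 1; have gA x : `|g x| <= A by apply: gA0 => //; rewrite ltrDl.
have mg : measurable_fun setT g by exact: continuous_measurable_fun.
under eq_fun do rewrite (@expectation_bounded _ _ _ _ _ A (measurableT_comp mg (mX _)) (fun w => gA _)).
rewrite (@expectation_bounded _ _ _ _ _ A (measurableT_comp mg mXoo) (fun w => gA _)).
apply: cvg_EFin; first by apply: nearW.
have := cvg_mean_poisson_roots theta_gt0 aT_law f_cont B_meas C0 q_gt0 B_prob f_B g_cont gA.
apply: cvg_trans; apply: near_eq_cvg; near=> N.
have N1 : (1 <= N)%N by near: N; exact: nbhs_infty_ge.
rewrite /= -(mean_ewens_matrix L_Cstar T_ind T_law f_cont (M_law N N1) g_cont gA).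
Unshelve. all: by end_near.
Qed.
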